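(* There exist two-generated groups with polynomial time word problem and NP-hard discrete log problem.
   Context: For a group generated by two elements $x,y$, a word $w=x^{k_0}y^{l_1}x^{k_1}\cdots y^{l_t}x^{k_t}y^{l_{t+1}}$ in $\{x^{\pm1},y^{\pm1}\}^*$, with $k_i,l_i\neq 0$ for $1\le i\le t$, has length $$\ell(w)=\log(|k_0|+1)+\log(|l_{t+1}|+1)+\sum_{i=1}^t\log(|k_il_i|+1),$$ i.e. up to linear equivalence exponents are written in binary. Complexity is measured in terms of the length $\ell$ of the input. Word problem: given a word in the generators, decide whether it represents the trivial element. Discrete log problem: given two words representing elements $g,h$ of the group, find $x\in\mathbb{Z}$ with $g^x=h$ or determine that no such $x$ exists. *)

(* Defs.v *)
From Stdlib Require Import ZArith Reals.
From HB Require Import structures.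
From mathcomp Require Import all_boot.

Set Implicit Arguments.
Unset Strict Implicit.
Unset Printing Implicit Defensive.

Delimit Scope R_scope with coqR.

(** * Turing machines: deterministic, multi-tape, with tape alphabet
    {0, 1, blank}. *)

(* [None] is the blank. *)
Definition symbol : Type := option bool.

Inductive move := MoveL | Stay | MoveR.

(* A two-way infinite tape: [tleft] lists the cells to the left of the head,
   nearest first; [tright] starts with the scanned cell. Cells beyond either
   list are blank. *)
Record tape := Tape { tleft : seq symbol; tright : seq symbol }.

Definition tape_read (tp : tape) : symbol := head None (tright tp).

Definition tape_write (a : symbol) (tp : tape) : tape :=
  Tape (tleft tp) (a :: behead (tright tp)).

Definition tape_move (m : move) (tp : tape) : tape :=
  match m with
  | MoveL => Tape (behead (tleft tp)) (head None (tleft tp) :: tright tp)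
  | Stay => tp
  | MoveR => Tape (tape_read tp :: tleft tp) (behead (tright tp))
  end.

(* The machine has [(tm_tapes M).+1] tapes, so at least one; it halts when
   [tm_delta] returns [None]. *)
Record TM := {
  tm_tapes : nat;
  tm_state : finType;
  tm_start : tm_state;
  tm_delta : tm_state -> {ffun 'I_tm_tapes.+1 -> symbol} ->
             option (tm_state * {ffun 'I_tm_tapes.+1 -> symbol * move})
}.

Definition config (M : TM) : Type :=
  (tm_state M * {ffun 'I_(tm_tapes M).+1 -> tape})%type.

Definition tm_step (M : TM) (c : config M) : option (config M) :=
  match tm_delta c.1 [ffun i => tape_read (c.2 i)] with
  | Some (q, a) =>
      Some (q, [ffun i => tape_move (a i).2 (tape_write (a i).1 (c.2 i))])
  | None => None
  end.

(* The configuration in which [M] halts, if it does so within [n] steps. *)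
Fixpoint tm_run (M : TM) (n : nat) (c : config M) : option (config M) :=
  match tm_step c, n with
  | None, _ => Some c
  | Some c', n'.+1 => tm_run n' c'
  | Some _, 0 => None
  end.

(* Input and output are both on tape 0, starting at the head. *)
Definition tm_init (M : TM) (s : seq bool) : config M :=
  (tm_start M,
   [ffun i => Tape [::] (if i == ord0 then map Some s else [::])]).

Fixpoint leading_bits (r : seq symbol) : seq bool :=
  if r is Some b :: r' then b :: leading_bits r' else [::].

Definition tm_output (M : TM) (c : config M) : seq bool :=
  leading_bits (tright (c.2 ord0)).

Definition computes_within (M : TM) (s : seq bool) (n : nat) (o : seq bool) :=
  exists2 c, tm_run n (tm_init M s) = Some c & tm_output c = o.

(** * Polynomial time, NP, NP-hardness *)

(* Instances [i : I] are presented to the machine as [enc i]; the running time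
   is polynomial in the real-valued length [len i]. *)
Definition polytime (I : Type) (enc : I -> seq bool) (len : I -> R)
    (f : I -> seq bool) : Prop :=
  exists (M : TM) (c d : nat), forall i : I, exists2 t : nat,
    (INR t <= INR c * len i ^ d + INR c)%coqR & computes_within M (enc i) t (f i).

Definition polytime_string (f : seq bool -> seq bool) : Prop :=
  polytime id (fun s => INR (size s)) f.

(* Self-delimiting: each item is announced by [true], the end by [false]. *)
Definition encode_seq (T : Type) (enc : T -> seq bool) (s : seq T) : seq bool :=
  flatten [seq true :: enc a | a <- s] ++ [:: false].

Definition encode_string : seq bool -> seq bool :=
  encode_seq (fun b => [:: b]).

(* [u] is the certificate, [V] the polynomial time verifier. *)
Definition NP (L : seq bool -> Prop) : Prop :=
  exists (V : seq bool -> bool) (c d : nat),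
    polytime_string (fun s => [:: V s]) /\
    forall s, L s <-> exists2 u : seq bool,
      size u <= c * size s ^ d + c & V (encode_string s ++ u).

(* A search problem is given by the encoding [enc] of its instances and by the
   relation [sol] between instances and solutions; it asks to find a solution
   or to determine that none exists. It is NP-hard if every language in NP
   reduces to it by a polynomial time many-one reduction: the members are the
   strings whose associated instance has a solution. *)
Definition NP_hard (I A : Type) (enc : I -> seq bool) (sol : I -> A -> Prop) :
    Prop :=
  forall L : seq bool -> Prop, NP L ->
  exists f : seq bool -> I,
    polytime_string (fun s => enc (f s)) /\
    forall s, L s <-> exists a : A, sol (f s) a.

(** * Words with binary exponents *)

(* [Word k0 [:: (l1, k1); ...; (lt, kt)] l _] stands for the word
   x^k0 y^l1 x^k1 ... y^lt x^kt y^l. *)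
Record word := Word {
  w_head : Z;
  w_mid : seq (Z * Z);
  w_last : Z;
  w_midP : all (fun p => ~~ (p.1 =? 0)%Z && ~~ (p.2 =? 0)%Z) w_mid
}.

Definition word_length (w : word) : R :=
  (ln (IZR (Z.abs (w_head w)) + 1) + ln (IZR (Z.abs (w_last w)) + 1) +
   foldr (fun p r => ln (IZR (Z.abs (p.2 * p.1)) + 1) + r) 0 (w_mid w))%coqR.

(* Least significant bit first. *)
Fixpoint positive_bits (p : positive) : seq bool :=
  match p with
  | xH => [:: true]
  | xO q => false :: positive_bits q
  | xI q => true :: positive_bits q
  end.

Definition encode_Z (k : Z) : seq bool :=
  match k with
  | Z0 => false :: encode_string [::]
  | Zpos p => false :: encode_string (positive_bits p)
  | Zneg p => true :: encode_string (positive_bits p)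
  end.

Definition encode_word (w : word) : seq bool :=
  encode_Z (w_head w) ++
  encode_seq (fun p => encode_Z p.1 ++ encode_Z p.2) (w_mid w) ++
  encode_Z (w_last w).

Definition encode_word_pair (p : word * word) : seq bool :=
  encode_word p.1 ++ encode_word p.2.

(** * The two algorithmic problems *)

Local Open Scope group_scope.

Definition zpow (G : groupType) (g : G) (k : Z) : G :=
  match k with
  | Z0 => 1
  | Zpos p => g ^+ Pos.to_nat p
  | Zneg p => g ^- Pos.to_nat p
  end.

Definition word_eval (G : groupType) (x y : G) (w : word) : G :=
  zpow x (w_head w) *
  foldr (fun p g => zpow y p.1 * zpow x p.2 * g) 1 (w_mid w) *
  zpow y (w_last w).

Definition generated_by (G : groupType) (x y : G) : Prop :=
  forall g : G, exists w : word, word_eval x y w = g.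

Definition polytime_word_problem (G : groupType) (x y : G) : Prop :=
  polytime encode_word word_length (fun w => [:: word_eval x y w == 1]).

Definition discrete_log (G : groupType) (x y : G) (gh : word * word) (k : Z) :
    Prop :=
  zpow (word_eval x y gh.1) k = word_eval x y gh.2.

Definition NP_hard_discrete_log (G : groupType) (x y : G) : Prop :=
  NP_hard encode_word_pair (discrete_log x y).

(* Main.v *)
(** Let PSL2(Z) = <sigma, tau> act on the cosets of <tau>, which are coded by a bit
    and a string of bits, and attach a lamp to the base coset. The group G acts on
    triples (v, q, n): the generator x moves the coset v by sigma; y moves v by tau
    and, if v is the base coset, reflects n by n -> -n, while it reflects n by
    n -> 1 - n if v lies in the tau-orbit labelled q. The integer n is taken modulo
    m_q, so that the orders m_q of the rotations can be prescribed freely. Both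
    generators have finite order (2 and 6), hence binary exponents are harmless.

    Let m_q = 3^(T+1) if T is the number of the first certificate showing that the
    Turing machine and input coded by q are accepted, and m_q = 0 if there is none.
    A word of length n can only produce a rotation n -> n + e with |e| <= n, and
    e > 0 is divisible by m_q iff 3^(i+1) divides e for some accepted certificate
    number i < log e; so certificates may be searched exhaustively and the word
    problem is polynomial. On the other hand, conjugating the lamp by a short word
    gives an element t whose powers t^4 and t^2 satisfy t^2 in <t^4> iff m_q is
    finite, i.e. iff q is accepted; this even makes the discrete logarithm problem
    undecidable, and it is certainly NP-hard, since the certificate can contain the
    witness and the running time.

    Polynomial time computability is established for functions on binary trees: a
    small language of stack programs compiles to Turing machines, and the functions
    that it computes in polynomial time are closed under composition, pairing, case
    distinction and iteration. *)

Require Import Defs.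
From Stdlib Require Import ZArith Reals Lra.
From HB Require Import structures.
From mathcomp Require Import all_boot boolp zify.

Set Implicit Arguments.
Unset Strict Implicit.
Unset Printing Implicit Defensive.

(** The group is fixed before the language in NP is known, so the machine is part of the string q
    and a universal simulator is required. Acceptance of q is undecidable; only divisibility of a
    small e by m_q is ever computed, which dictates m_q = 3^(T+1). Powers of one base form a
    divisibility chain, so any accepted certificate number i with 3^(i+1) dividing e can stand in
    for the least one; exponential growth forces T < log e; odd orders make t^2 a power of t^4; and
    since no order is 1 or 2, a product of an odd number of reflections is never trivial, so parity
    is visible. The powers 4 and 2 replace 2 and 1 because at some points t acts as a single
    reflection, so that t is never a power of t^2. At one further point t rotates modulo the order
    of the reversed and negated string; instances are encoded so that this string is always
    accepted, and t has finite order exactly when q is accepted. The lamp commutes with tau, so that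
    y = lamp tau has order 6 and yields both factors, as y^3 and y^4. *)

(** * A language of stack programs with exact step counts *)

Inductive reg := RM | RA | RB | RC.

Record store := Store { sM : seq bool; sA : seq bool; sB : seq bool; sC : seq bool }.

Definition get (r : reg) (s : store) : seq bool :=
  match r with RM => sM s | RA => sA s | RB => sB s | RC => sC s end.

Definition set (r : reg) (l : seq bool) (s : store) : store :=
  let: Store m a b c := s in
  match r with
  | RM => Store l a b c | RA => Store m l b c
  | RB => Store m a l c | RC => Store m a b l
  end.

Inductive cmd :=
| Skip
| Push of reg & bool
| Seq of cmd & cmd
| Case of reg & cmd & cmd & cmd
| While of reg & cmd.

(* [Case] and [While] pop the bit they test. The counter is the exact number
   of steps of the compiled Turing machine. *)
Inductive exec : cmd -> store -> nat -> store -> Prop :=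
| ESkip s : exec Skip s 1 s
| EPush r b s : exec (Push r b) s 2 (set r (b :: get r s) s)
| ESeq c1 c2 s n1 s1 n2 s2 :
    exec c1 s n1 s1 -> exec c2 s1 n2 s2 -> exec (Seq c1 c2) s (n1 + n2) s2
| ECaseT r ct cf ce s l n s' : get r s = true :: l ->
    exec ct (set r l s) n s' -> exec (Case r ct cf ce) s n.+1 s'
| ECaseF r ct cf ce s l n s' : get r s = false :: l ->
    exec cf (set r l s) n s' -> exec (Case r ct cf ce) s n.+1 s'
| ECaseE r ct cf ce s n s' : get r s = [::] ->
    exec ce s n s' -> exec (Case r ct cf ce) s n.+1 s'
| EWhileT r c s l n1 s1 n2 s2 : get r s = true :: l ->
    exec c (set r l s) n1 s1 -> exec (While r c) s1 n2 s2 ->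
    exec (While r c) s (n1 + n2).+1 s2
| EWhileF r c s l : get r s = false :: l ->
    exec (While r c) s 1 (set r l s)
| EWhileE r c s : get r s = [::] -> exec (While r c) s 1 s.

(** * Compilation of stack programs to four-tape Turing machines *)

Definition idx (r : reg) : 'I_4 :=
  match r with
  | RM => ord0 | RA => @Ordinal 4 1 isT | RB => @Ordinal 4 2 isT
  | RC => @Ordinal 4 3 isT
  end.

Notation reads := {ffun 'I_4 -> symbol}.
Notation acts := {ffun 'I_4 -> symbol * move}.
Notation tapes := {ffun 'I_4 -> tape}.

Definition read_all (tp : tapes) : reads := [ffun i => tape_read (tp i)].

Definition act_all (a : acts) (tp : tapes) : tapes :=
  [ffun i => tape_move (a i).2 (tape_write (a i).1 (tp i))].

Definition act_on (r : reg) (x : symbol * move) (rd : reads) : acts :=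
  [ffun i => if i == idx r then x else (rd i, Stay)].

Definition no_act (rd : reads) : acts := [ffun i => (rd i, Stay)].

(** The top of the stack is under the head. The cells to its left are unconstrained: a pop leaves
    its symbol there and a push overwrites it. The trailing blanks are needed because an idle step
    at the end of the tape writes an explicit blank. *)
Definition rep1 (tp : tape) (l : seq bool) : Prop :=
  exists k, tright tp = map Some l ++ nseq k None.

Definition rep (tp : tapes) (s : store) : Prop :=
  forall r, rep1 (tp (idx r)) (get r s).

Lemma rep1_read tp l : rep1 tp l -> tape_read tp = ohead l.
Proof. by case=> k; rewrite /tape_read => ->; case: l => //=; case: k. Qed.

Lemma rep1_noop tp l :
  rep1 tp l -> rep1 (tape_move Stay (tape_write (tape_read tp) tp)) l.
Proof.
case: tp => tl tr [k /= ->]; rewrite /rep1 /tape_write /tape_read /=.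
case: l => [|b l] /=; last by exists k.
by case: k => [|k]; [exists 1 | exists k.+1].
Qed.

Lemma rep1_push tp l b : rep1 tp l ->
  rep1 (tape_move Stay (tape_write (Some b)
          (tape_move MoveL (tape_write (tape_read tp) tp)))) (b :: l).
Proof.
move=> /rep1_noop[k /= E]; exists k; rewrite /tape_write /=.
by move: E => /= ->.
Qed.

Lemma rep1_pop tp l b : rep1 tp (b :: l) ->
  rep1 (tape_move MoveR (tape_write (tape_read tp) tp)) l.
Proof. by case=> k E; exists k; rewrite /= E. Qed.

Lemma get_set r r' l s : get r (set r' l s) =
  if idx r == idx r' then l else get r s.
Proof. by case: s => ????; case: r; case: r'. Qed.

Lemma rep_noop tp s : rep tp s -> rep (act_all (no_act (read_all tp)) tp) s.
Proof. by move=> H r; rewrite !ffunE; apply: rep1_noop. Qed.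

Lemma rep_push tp s r b : rep tp s ->
  let tp1 := act_all (act_on r (read_all tp (idx r), MoveL) (read_all tp)) tp in
  rep (act_all (act_on r (Some b, Stay) (read_all tp1)) tp1)
      (set r (b :: get r s) s).
Proof.
move=> H tp1 r'; rewrite get_set /tp1 !ffunE; case: eqP => [E|] /=.
  by rewrite E; apply: rep1_push.
by move=> _; do 2!apply: rep1_noop.
Qed.

Lemma rep_pop tp s r b l : rep tp s -> get r s = b :: l ->
  rep (act_all (act_on r (read_all tp (idx r), MoveR) (read_all tp)) tp)
      (set r l s).
Proof.
move=> H E r'; rewrite get_set !ffunE; case: eqP => [Er|] /=.
  by rewrite Er; apply: (@rep1_pop _ _ b); rewrite -E; apply: H.
by move=> _; apply: rep1_noop.
Qed.

Lemma rep_read tp s r : rep tp s -> read_all tp (idx r) = ohead (get r s).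
Proof. by move=> H; rewrite ffunE; apply: rep1_read. Qed.

Fixpoint cstate (c : cmd) : finType :=
  match c with
  | Skip => unit
  | Push _ _ => bool
  | Seq c1 c2 => (cstate c1 + cstate c2)%type
  | Case _ c1 c2 c3 => option (cstate c1 + (cstate c2 + cstate c3))
  | While _ c => option (cstate c)
  end.

Fixpoint cstart (c : cmd) : cstate c :=
  match c with
  | Skip => tt
  | Push _ _ => false
  | Seq c1 c2 => inl (cstart c1)
  | Case _ _ _ _ => None
  | While _ _ => None
  end.

Definition lift_exit (S S' : Type) (f : S -> S') (k : option S')
    (x : option S * acts) : option S' * acts :=
  (if x.1 is Some s then Some (f s) else k, x.2).

(* [None] as the next state means exit. *)
Fixpoint cdelta (c : cmd) : cstate c -> reads -> option (cstate c) * acts :=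
  match c return cstate c -> reads -> option (cstate c) * acts with
  | Skip => fun _ rd => (None, no_act rd)
  | Push r b => fun s rd =>
      if s then (None, act_on r (Some b, Stay) rd)
      else (Some true, act_on r (rd (idx r), MoveL) rd)
  | Seq c1 c2 => fun s rd =>
      match s with
      | inl s1 => lift_exit inl (Some (inr (cstart c2))) (cdelta s1 rd)
      | inr s2 => lift_exit inr None (cdelta s2 rd)
      end
  | Case r c1 c2 c3 => fun s rd =>
      match s with
      | None =>
        match rd (idx r) with
        | Some true => (Some (Some (inl (cstart c1))),
                        act_on r (rd (idx r), MoveR) rd)
        | Some false => (Some (Some (inr (inl (cstart c2)))),
                         act_on r (rd (idx r), MoveR) rd)
        | None => (Some (Some (inr (inr (cstart c3)))), no_act rd)
        end
      | Some (inl s1) => lift_exit (Some \o inl) None (cdelta s1 rd)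
      | Some (inr (inl s2)) => lift_exit (Some \o inr \o inl) None (cdelta s2 rd)
      | Some (inr (inr s3)) => lift_exit (Some \o inr \o inr) None (cdelta s3 rd)
      end
  | While r c => fun s rd =>
      match s with
      | None =>
        match rd (idx r) with
        | Some true => (Some (Some (cstart c)), act_on r (rd (idx r), MoveR) rd)
        | Some false => (None, act_on r (rd (idx r), MoveR) rd)
        | None => (None, no_act rd)
        end
      | Some s1 => lift_exit Some (Some None) (cdelta s1 rd)
      end
  end.

Inductive exits (S : Type) (d : S -> reads -> option S * acts) :
    nat -> S -> tapes -> tapes -> Prop :=
| ExitNow s tp : (d s (read_all tp)).1 = None ->
    exits d 1 s tp (act_all (d s (read_all tp)).2 tp)
| ExitStep s s' tp n tp' : (d s (read_all tp)).1 = Some s' ->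
    exits d n s' (act_all (d s (read_all tp)).2 tp) tp' ->
    exits d n.+1 s tp tp'.

Lemma exits_last (S S' : Type) d (d' : S' -> reads -> option S' * acts)
    (f : S -> S') n s tp tp' :
  (forall s rd, d' (f s) rd = lift_exit f None (d s rd)) ->
  exits d n s tp tp' -> exits d' n (f s) tp tp'.
Proof.
move=> Hd; elim=> {n s tp tp'} [s tp E | s s' tp n tp' E _ IH].
  by have -> : (d s (read_all tp)).2 = (d' (f s) (read_all tp)).2;
    [rewrite Hd | apply: ExitNow; rewrite Hd /= E].
by apply: (@ExitStep _ _ _ (f s')); rewrite Hd /= ?E.
Qed.

(** The transition by which the inner machine exits is redirected to [k] and still performs its
    actions, so no step is lost and the counters simply add. *)
Lemma exits_then (S S' : Type) d (d' : S' -> reads -> option S' * acts)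
    (f : S -> S') k n s tp tp' m tp'' :
  (forall s rd, d' (f s) rd = lift_exit f (Some k) (d s rd)) ->
  exits d n s tp tp' -> exits d' m k tp' tp'' -> exits d' (n + m) (f s) tp tp''.
Proof.
move=> Hd; elim=> {n s tp tp'} [s tp E | s s' tp n tp' E _ IH] H.
  by apply: (@ExitStep _ _ _ k); rewrite Hd /= ?E.
by apply: (@ExitStep _ _ _ (f s')); rewrite Hd /= ?E //; apply: IH.
Qed.

Lemma exec_exits c s n s' : exec c s n s' -> forall tp, rep tp s ->
  exists2 tp', exits (@cdelta c) n (cstart c) tp tp' & rep tp' s'.
Proof.
elim=> {c s n s'}.
- move=> s tp /rep_noop H; eexists; last exact: H.
  exact: (@ExitNow _ (@cdelta Skip) tt).
- move=> r b s tp /(rep_push r b) H; eexists; last exact: H.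
  by apply: (@ExitStep _ (@cdelta (Push r b)) _ true) => //=; apply: ExitNow.
- move=> c1 c2 s n1 s1 n2 s2 _ IH1 _ IH2 tp /IH1[tp1 E1 /IH2[tp2 E2 R]].
  exists tp2 => //; apply: (exits_then (k := inr (cstart c2)) _ E1) => //.
  exact: exits_last E2.
- move=> r ct cf ce s l n s' E _ IH tp R.
  have [tp' Ex R'] := IH _ (rep_pop R E).
  exists tp' => //; have Er := rep_read r R; rewrite E /= in Er.
  apply: (@ExitStep _ _ _ (Some (inl (cstart ct)))); rewrite /= Er //= -Er.
  exact: (exits_last (f := Some \o inl)) Ex.
- move=> r ct cf ce s l n s' E _ IH tp R.
  have [tp' Ex R'] := IH _ (rep_pop R E).
  exists tp' => //; have Er := rep_read r R; rewrite E /= in Er.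
  apply: (@ExitStep _ _ _ (Some (inr (inl (cstart cf))))); rewrite /= Er //= -Er.
  exact: (exits_last (f := Some \o inr \o inl)) Ex.
- move=> r ct cf ce s n s' E _ IH tp R.
  have [tp' Ex R'] := IH _ (rep_noop R).
  exists tp' => //; have Er := rep_read r R; rewrite E /= in Er.
  apply: (@ExitStep _ _ _ (Some (inr (inr (cstart ce))))); rewrite /= Er //=.
  exact: (exits_last (f := Some \o inr \o inr)) Ex.
- move=> r c s l n1 s1 n2 s2 E _ IH1 _ IH2 tp R.
  have [tp1 E1 R1] := IH1 _ (rep_pop R E); have [tp2 E2 R2] := IH2 _ R1.
  exists tp2 => //; have Er := rep_read r R; rewrite E /= in Er.
  apply: (@ExitStep _ _ _ (Some (cstart c))); rewrite /= Er //= -Er.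
  exact: (exits_then (f := Some)) E1 E2.
- move=> r c s l E tp R; have Er := rep_read r R; rewrite E /= in Er.
  eexists; last exact: (rep_pop R E).
  have -> : act_on r (read_all tp (idx r), MoveR) (read_all tp) =
     (@cdelta (While r c) None (read_all tp)).2 by rewrite /= Er.
  by apply: ExitNow; rewrite /= Er.
- move=> r c s E tp R; have Er := rep_read r R; rewrite E /= in Er.
  eexists; last exact: (rep_noop R).
  have -> : no_act (read_all tp) =
     (@cdelta (While r c) None (read_all tp)).2 by rewrite /= Er.
  by apply: ExitNow; rewrite /= Er.
Qed.

Definition machine (c : cmd) : TM := {|
  tm_tapes := 3;
  tm_state := option (cstate c);
  tm_start := Some (cstart c);
  tm_delta := fun s rd =>
    if s is Some s' then Some (cdelta s' rd) else None
|}.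

Lemma machine_run c n s tp tp' : exits (@cdelta c) n s tp tp' ->
  @tm_run (machine c) n (Some s, tp) = Some (None, tp').
Proof.
elim=> {n s tp tp'} [s tp E | s s' tp n tp' E _ IH].
  rewrite /= /tm_step /= -/(read_all tp); case: cdelta E => [o a] /= ->.
  by rewrite /tm_step /=.
rewrite /= /tm_step /= -/(read_all tp).
by case: cdelta E IH => [o a] /= -> IH.
Qed.

Lemma leading_bits_rep (l : seq bool) k :
  leading_bits (map Some l ++ nseq k None) = l.
Proof. by elim: l => [|b l /= ->] //; case: k. Qed.

Lemma machine_computes c s n o :
  exec c (Store s [::] [::] [::]) n (Store o [::] [::] [::]) ->
  computes_within (machine c) s n o.
Proof.
move=> /exec_exits /(_ (@tm_init (machine c) s).2)[].
  by case; exists 0; rewrite /= ffunE /= ?cats0.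
move=> tp' /machine_run E R; exists (None, tp') => //.
rewrite /tm_output /=; have [k /= ->] := R RM; exact: leading_bits_rep.
Qed.

(** * Polynomial bounds *)

(** The base [n.+1] is positive, which makes the bound monotone in [d] as well, also at [n = 0]. *)
Definition bd (c d n : nat) : nat := c * n.+1 ^ d.

Definition poly (f : nat -> nat) : Prop := exists c d, forall n, f n <= bd c d n.

Lemma leq_expl m n e : m <= n -> m ^ e <= n ^ e.
Proof. by case: e => // e h; rewrite leq_exp2r. Qed.

Lemma bd_mono c d c' d' m n :
  c <= c' -> d <= d' -> m <= n -> bd c d m <= bd c' d' n.
Proof.
move=> hc hd hm; apply: leq_mul => //.
apply: (@leq_trans (n.+1 ^ d)); first exact: leq_expl.
exact: leq_pexp2l.
Qed.

Lemma poly_bd c d : poly (bd c d). Proof. by exists c, d. Qed.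

Lemma poly_const k : poly (fun=> k).
Proof. by exists k, 0 => n; rewrite /bd expn0 muln1. Qed.

Lemma poly_id : poly id.
Proof. by exists 1, 1 => n; rewrite /bd expn1 mul1n. Qed.

Lemma poly_add f g : poly f -> poly g -> poly (fun n => f n + g n).
Proof.
move=> [c [d H]] [c' [d' H']]; exists (c + c'), (maxn d d') => n.
rewrite /bd mulnDl; apply: leq_add.
  by apply: leq_trans (H n) _; apply: bd_mono; rewrite ?leq_maxl.
by apply: leq_trans (H' n) _; apply: bd_mono; rewrite ?leq_maxr.
Qed.

Lemma poly_mul f g : poly f -> poly g -> poly (fun n => f n * g n).
Proof.
move=> [c [d H]] [c' [d' H']]; exists (c * c'), (d + d') => n.
by rewrite /bd expnD mulnACA; apply: leq_mul.
Qed.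

Lemma poly_comp f g : poly f -> poly g -> poly (fun n => f (g n)).
Proof.
move=> [c [d H]] [c' [d' H']]; exists (c * c'.+1 ^ d), (d' * d) => n.
apply: leq_trans (H _) _; rewrite /bd -mulnA leq_mul2l expnM -expnMn.
apply/orP; right; apply: leq_expl; rewrite mulSn addnC -addn1 leq_add //.
  by rewrite expn_gt0.
Qed.

Ltac solve_poly := repeat first
  [ exact: poly_id | exact: poly_const | assumption
  | apply: poly_add | apply: poly_mul
  | (apply: poly_comp; [assumption|]) ].

(** * Data *)

Inductive tree := Leaf | Node of tree & tree.

(** This is a prefix code: a program finds the end of a value without a length mark, so values can
    be stacked on one register. *)
Fixpoint ser (t : tree) : seq bool :=
  match t with
  | Leaf => [:: false]
  | Node l r => true :: ser l ++ ser r
  end.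

Class data (T : Type) := code : T -> tree.

Definition dsize (T : Type) {d : data T} (a : T) : nat := size (ser (code a)).

#[export] Instance data_tree : data tree := id.
#[export] Instance data_bool : data bool :=
  fun b : bool => if b then Node Leaf Leaf else Leaf.
#[export] Instance data_prod A B {dA : data A} {dB : data B} : data (A * B) :=
  fun p => Node (code p.1) (code p.2).
#[export] Instance data_seq A {dA : data A} : data (seq A) :=
  fix c (l : seq A) : tree := if l is a :: l' then Node (code a) (c l') else Leaf.
#[export] Instance data_option A {dA : data A} : data (option A) :=
  fun o => if o is Some a then Node Leaf (code a) else Leaf.
#[export] Instance data_nat : data nat := fun n => iter n (Node Leaf) Leaf.

(** * Stack programs *)

Definition runs (c : cmd) (s : store) (T : nat) (s' : store) : Prop :=
  exists2 n, n <= T & exec c s n s'.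

Lemma runs_le c s T T' s' : runs c s T s' -> T <= T' -> runs c s T' s'.
Proof. by case=> n h E h'; exists n => //; apply: leq_trans h h'. Qed.

Lemma runs_seq c1 c2 s T1 s1 T2 s2 :
  runs c1 s T1 s1 -> runs c2 s1 T2 s2 -> runs (Seq c1 c2) s (T1 + T2) s2.
Proof.
by move=> [n1 h1 E1] [n2 h2 E2]; exists (n1 + n2); [apply: leq_add | apply: ESeq E1 E2].
Qed.

Lemma runs_push r b s : runs (Push r b) s 2 (set r (b :: get r s) s).
Proof. by exists 2 => //; apply: EPush. Qed.

Lemma runs_skip s : runs Skip s 1 s.
Proof. by exists 1 => //; apply: ESkip. Qed.

Lemma runs_case r ct cf ce s b l T s' : get r s = b :: l ->
  runs (if b then ct else cf) (set r l s) T s' ->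
  runs (Case r ct cf ce) s T.+1 s'.
Proof.
case: b => E [n h X]; exists n.+1 => //; first exact: ECaseT E X.
exact: ECaseF E X.
Qed.

Lemma runs_caseE r ct cf ce s T s' : get r s = [::] ->
  runs ce s T s' -> runs (Case r ct cf ce) s T.+1 s'.
Proof. by move=> E [n h X]; exists n.+1 => //; apply: ECaseE E X. Qed.

Lemma runs_whileT r c s l T1 s1 T2 s2 : get r s = true :: l ->
  runs c (set r l s) T1 s1 -> runs (While r c) s1 T2 s2 ->
  runs (While r c) s (T1 + T2).+1 s2.
Proof.
move=> E [n1 h1 E1] [n2 h2 E2]; exists (n1 + n2).+1; last exact: EWhileT E E1 E2.
by rewrite ltnS leq_add.
Qed.

Lemma runs_whileF r c s l : get r s = false :: l ->
  runs (While r c) s 1 (set r l s).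
Proof. by move=> E; exists 1 => //; apply: EWhileF. Qed.

(** Each copied bit is stored under a [true], so that a [While] on the register can tell the copy
    from the [false] that was pushed below it. The copy is reversed; [unA] and [unB] restore the
    order. *)
Definition mark (r : reg) (u : bool) (b : bool) : cmd :=
  if u then Seq (Push r b) (Push r true) else Skip.

Definition emit (ua ub b : bool) : cmd := Seq (mark RA ua b) (mark RB ub b).

Definition marked (u : bool) (A l : seq bool) : seq bool :=
  if u then foldl (fun A b => true :: b :: A) A l else A.

Lemma runs_emit ua ub b m A B C :
  runs (emit ua ub b) (Store m A B C) 8
       (Store m (marked ua A [:: b]) (marked ub B [:: b]) C).
Proof.
apply: (@runs_le _ _ (4 + 4)) => //.
apply: (@runs_seq _ _ _ _ (Store m (marked ua A [:: b]) B C)).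
  case: ua => /=; last exact: runs_le (runs_skip _) _.
  exact: (runs_seq (runs_push _ _ _) (runs_push _ _ _)).
case: ub => /=; last exact: runs_le (runs_skip _) _.
exact: (runs_seq (runs_push _ _ _) (runs_push _ _ _)).
Qed.

Lemma marked_cat u A l l' : marked u A (l ++ l') = marked u (marked u A l) l'.
Proof. by case: u => //=; rewrite foldl_cat. Qed.

Definition walk_loop (ua ub : bool) : cmd :=
  While RC (Case RM (Seq (emit ua ub true) (Seq (Push RC true) (Push RC true)))
                    (emit ua ub false) Skip).

(* [C] counts in unary the subtrees still to be read. *)
Lemma runs_walk_loop ua ub t r A B C T s' :
  runs (walk_loop ua ub)
       (Store r (marked ua A (ser t)) (marked ub B (ser t)) C) T s' ->
  runs (walk_loop ua ub) (Store (ser t ++ r) A B (true :: C))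
       (14 * size (ser t) + T) s'.
Proof.
rewrite /walk_loop; elim: t r A B C T s' => [|t1 IH1 t2 IH2] r A B C T s' H /=.
  apply: (@runs_le _ _ (9 + T).+1); last by lia.
  apply: runs_whileT; [exact: erefl| |exact: H] => /=.
  apply: (@runs_case _ _ _ _ _ false); [exact: erefl | exact: runs_emit].
rewrite size_cat -catA.
apply: (@runs_le _ _ (13 + (14 * size (ser t1) + (14 * size (ser t2) + T))).+1);
  last by lia.
apply: (@runs_whileT _ _ _ _ _ (Store (ser t1 ++ ser t2 ++ r)
   (marked ua A [:: true]) (marked ub B [:: true]) [:: true, true & C])); first exact: erefl.
  apply: (@runs_le _ _ (8 + (2 + 2)).+1) => //.
  apply: (@runs_case _ _ _ _ _ true); [exact: erefl|] => /=.
  apply: runs_seq; first exact: runs_emit.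
  exact: (runs_seq (runs_push _ _ _) (runs_push _ _ _)).
apply: IH1; apply: IH2; move: H.
by rewrite -!marked_cat /= -cat1s.
Qed.

Definition walk (ua ub : bool) : cmd :=
  Seq (Push RC false) (Seq (Push RC true) (walk_loop ua ub)).

Lemma runs_walk ua ub t r A B C :
  runs (walk ua ub) (Store (ser t ++ r) A B C) (14 * size (ser t) + 5)
       (Store r (marked ua A (ser t)) (marked ub B (ser t)) C).
Proof.
apply: (@runs_le _ _ (2 + (2 + (14 * size (ser t) + 1)))); last by lia.
apply: runs_seq; first exact: runs_push.
apply: runs_seq; first exact: runs_push.
by apply: runs_walk_loop; apply: runs_whileF.
Qed.

Definition drop_tree : cmd := walk false false.
Definition toA : cmd := Seq (Push RA false) (walk true false).
Definition toB : cmd := Seq (Push RB false) (walk false true).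
Definition toAB : cmd :=
  Seq (Push RA false) (Seq (Push RB false) (walk true true)).
Definition unA : cmd := While RA (Case RA (Push RM true) (Push RM false) Skip).
Definition unB : cmd := While RB (Case RB (Push RM true) (Push RM false) Skip).

Lemma runs_unA l m A B C :
  runs unA (Store m (marked true (false :: A) l) B C) (4 * size l + 1)
       (Store (l ++ m) A B C).
Proof.
elim/last_ind: l m => [|l b IH] m /=; first exact: runs_whileF.
rewrite foldl_rcons size_rcons cat_rcons.
apply: (@runs_le _ _ (3 + (4 * size l + 1)).+1); last by lia.
apply: runs_whileT; [exact: erefl| |exact: IH] => /=.
by apply: (@runs_case _ _ _ _ _ b); [exact: erefl|] => /=; case: b; apply: runs_push.
Qed.

Lemma runs_unB l m A B C :
  runs unB (Store m A (marked true (false :: B) l) C) (4 * size l + 1)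
       (Store (l ++ m) A B C).
Proof.
elim/last_ind: l m => [|l b IH] m /=; first exact: runs_whileF.
rewrite foldl_rcons size_rcons cat_rcons.
apply: (@runs_le _ _ (3 + (4 * size l + 1)).+1); last by lia.
apply: runs_whileT; [exact: erefl| |exact: IH] => /=.
by apply: (@runs_case _ _ _ _ _ b); [exact: erefl|] => /=; case: b; apply: runs_push.
Qed.

Lemma runs_drop t r A B C :
  runs drop_tree (Store (ser t ++ r) A B C) (14 * size (ser t) + 5)
       (Store r A B C).
Proof. exact: runs_walk. Qed.

Definition dup : cmd := Seq toAB (Seq unA unB).

Lemma runs_dup t r A B C :
  runs dup (Store (ser t ++ r) A B C) (22 * size (ser t) + 11)
       (Store (ser t ++ ser t ++ r) A B C).
Proof.
set n := size _.
apply: (@runs_le _ _ ((2 + (2 + (14 * n + 5))) + ((4 * n + 1) + (4 * n + 1))));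
  last by lia.
apply: runs_seq.
  apply: runs_seq; first exact: runs_push.
  apply: runs_seq; first exact: runs_push.
  exact: runs_walk.
by apply: runs_seq; [exact: runs_unA | exact: runs_unB].
Qed.

Definition swap : cmd := Seq toA (Seq toB (Seq unA unB)).

Lemma runs_swap t u r A B C :
  runs swap (Store (ser t ++ ser u ++ r) A B C)
       (18 * (size (ser t) + size (ser u)) + 16)
       (Store (ser u ++ ser t ++ r) A B C).
Proof.
set n := size (ser t); set k := size (ser u).
apply: (@runs_le _ _ ((2 + (14 * n + 5)) + ((2 + (14 * k + 5)) +
   ((4 * n + 1) + (4 * k + 1))))); last by lia.
apply: runs_seq.
  by apply: runs_seq; [exact: runs_push | exact: runs_walk].
apply: runs_seq.
  by apply: runs_seq; [exact: runs_push | exact: runs_walk].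
by apply: runs_seq; [exact: runs_unA | exact: runs_unB].
Qed.

Definition push_bits (l : seq bool) : cmd :=
  foldl (fun c b => Seq (Push RM b) c) Skip l.

Lemma runs_push_bits l m A B C :
  runs (push_bits l) (Store m A B C) (2 * size l + 1) (Store (l ++ m) A B C).
Proof.
elim/last_ind: l m => [|l b IH] m /=; first exact: runs_skip.
rewrite /push_bits foldl_rcons size_rcons cat_rcons -/(push_bits l).
apply: (@runs_le _ _ (2 + (2 * size l + 1))); last by lia.
by apply: runs_seq; [exact: runs_push | exact: IH].
Qed.

(** * Polynomial time functions on data *)

(** The program works on top of arbitrary stacks and leaves what lies below untouched; this is what
    lets programs be composed, paired and iterated. The size bound on the result is carried along to
    bound the time of whatever runs next. *)
Definition PT (A B : Type) {dA : data A} {dB : data B} (f : A -> B) : Prop :=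
  exists p c d, forall a r sa sb sc,
    runs p (Store (ser (code a) ++ r) sa sb sc) (bd c d (dsize a))
           (Store (ser (code (f a)) ++ r) sa sb sc) /\
    dsize (f a) <= bd c d (dsize a).

Definition mono_poly (T : nat -> nat) : Prop :=
  poly T /\ {homo T : m n / m <= n}.

Definition computes (A B : Type) {dA : data A} {dB : data B} (p : cmd)
    (T : nat -> nat) (f : A -> B) : Prop :=
  forall a r sa sb sc,
    runs p (Store (ser (code a) ++ r) sa sb sc) (T (dsize a))
           (Store (ser (code (f a)) ++ r) sa sb sc).

Section PTBounds.
Context {A B : Type} {dA : data A} {dB : data B}.

Lemma PT_intro (f : A -> B) p T K : poly T -> poly K ->
  computes p T f -> (forall a, dsize (f a) <= K (dsize a)) -> PT f.
Proof.
move=> hT hK H H'; have [c [d Hcd]] := poly_add hT hK.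
exists p, c, d => a r sa sb sc; split.
  apply: runs_le (H _ _ _ _ _) _; apply: leq_trans (Hcd _); exact: leq_addr.
apply: leq_trans (H' _) _; apply: leq_trans (Hcd _); exact: leq_addl.
Qed.

Lemma PT_elim (f : A -> B) : PT f -> exists p T, [/\ mono_poly T,
  computes p T f & forall a, dsize (f a) <= T (dsize a)].
Proof.
move=> [p [c [d H]]]; exists p, (bd c d); split.
- by split; [apply: poly_bd | move=> m n h; apply: bd_mono].
- by move=> a r sa sb sc; apply: (H a r sa sb sc).1.
- by move=> a; apply: (H a [::] [::] [::] [::]).2.
Qed.

Lemma PT_size (f : A -> B) : PT f ->
  exists2 T, mono_poly T & forall a, dsize (f a) <= T (dsize a).
Proof. by move=> /PT_elim[p [T [hT _ H]]]; exists T. Qed.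

Lemma pt_eq (f g : A -> B) : f =1 g -> PT f -> PT g.
Proof.
move=> e [p [c [d H]]]; exists p, c, d => a r sa sb sc; rewrite -e; exact: H.
Qed.

End PTBounds.

Lemma dsize_pair (A B : Type) {dA : data A} {dB : data B} (a : A) (b : B) : dsize (a, b) = (dsize a + dsize b).+1.
Proof. by rewrite /dsize /= size_cat. Qed.

Lemma ser_pair (A B : Type) {dA : data A} {dB : data B} (a : A) (b : B) r :
  ser (code (a, b)) ++ r = true :: ser (code a) ++ ser (code b) ++ r.
Proof. by rewrite /= -catA. Qed.

Section PTCombinators.
Context {A B C : Type} {dA : data A} {dB : data B} {dC : data C}.

Lemma pt_comp (f : A -> B) (g : B -> C) : PT f -> PT g -> PT (fun a => g (f a)).
Proof.
move=> /PT_elim[p [T [[hT mT] Ef Sf]]] /PT_elim[q [U [[hU mU] Eg Sg]]].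
apply: (@PT_intro _ _ _ _ _ (Seq p q) (fun n => T n + U (T n)) (fun n => U (T n))).
- by solve_poly.
- by solve_poly.
- move=> a r sa sb sc; apply: runs_seq; first exact: Ef.
  by apply: runs_le (Eg _ _ _ _ _) _; apply: mU.
- by move=> a; apply: leq_trans (Sg _) _; apply: mU.
Qed.

Lemma pt_code (f : A -> B) : (forall a, code a = code (f a)) -> PT f.
Proof.
move=> E; apply: (@PT_intro _ _ _ _ _ Skip (fun=> 1) id) => [|||a].
- exact: poly_const.
- exact: poly_id.
- by move=> a r sa sb sc; rewrite -E; apply: runs_skip.
- by rewrite /dsize E.
Qed.

Lemma pt_const (b : B) : PT (fun _ : A => b).
Proof.
apply: (@PT_intro _ _ _ _ _ (Seq drop_tree (push_bits (ser (code b))))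
  (fun n => (14 * n + 5) + (2 * dsize b + 1)) (fun=> dsize b)).
- by solve_poly.
- by solve_poly.
- move=> a r sa sb sc; apply: runs_seq; first exact: runs_drop.
  exact: runs_push_bits.
- by [].
Qed.

Lemma pt_pair (f : A -> B) (g : A -> C) :
  PT f -> PT g -> PT (fun a => (f a, g a)).
Proof.
move=> /PT_elim[p [T [[hT mT] Ef Sf]]] /PT_elim[q [U [[hU mU] Eg Sg]]].
apply: (@PT_intro _ _ _ _ _ (Seq dup (Seq q (Seq swap (Seq p (Push RM true)))))
  (fun n => (22 * n + 11) + (U n + ((18 * (U n + n) + 16) + (T n + 2))))
  (fun n => T n + U n + 1)).
- by solve_poly.
- by solve_poly.
- move=> a r sa sb sc; apply: runs_seq; first exact: runs_dup.
  apply: runs_seq; first exact: Eg.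
  apply: runs_seq.
    apply: runs_le (runs_swap _ _ _ _ _ _) _.
    rewrite leq_add2r leq_mul2l leq_add2r; exact: Sg.
  apply: runs_seq; first exact: Ef.
  by rewrite ser_pair; apply: runs_push.
- by move=> a; rewrite dsize_pair addn1 ltnS leq_add.
Qed.

Lemma pt_fst : PT (@fst A B).
Proof.
apply: (@PT_intro _ _ _ _ _ (Case RM (Seq swap drop_tree) Skip Skip)
  (fun n => ((18 * n + 16) + (14 * n + 5)) + 1) id).
- by solve_poly.
- by solve_poly.
- move=> [a b] r sa sb sc; rewrite addn1 ser_pair.
  apply: (@runs_case _ _ _ _ _ true); [exact: erefl|] => /=.
  apply: runs_seq.
    apply: runs_le (runs_swap _ _ _ _ _ _) _.
    by rewrite dsize_pair /dsize; lia.
  apply: runs_le (runs_drop _ _ _ _ _) _.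
  by rewrite dsize_pair /dsize /=; lia.
- by move=> [a b]; rewrite dsize_pair /=; lia.
Qed.

Lemma pt_snd : PT (@snd A B).
Proof.
apply: (@PT_intro _ _ _ _ _ (Case RM drop_tree Skip Skip)
  (fun n => (14 * n + 5) + 1) id).
- by solve_poly.
- by solve_poly.
- move=> [a b] r sa sb sc; rewrite addn1 ser_pair.
  apply: (@runs_case _ _ _ _ _ true); [exact: erefl|] => /=.
  apply: runs_le (runs_drop _ _ _ _ _) _.
  by rewrite dsize_pair /dsize /=; lia.
- by move=> [a b]; rewrite dsize_pair /=; lia.
Qed.

End PTCombinators.

Lemma pt_id (A : Type) {dA : data A} : PT (@id A).
Proof. exact: pt_code. Qed.

(* Every type whose code starts with a [Leaf]/[Node] distinction gets its case
   analysis from this lemma; [Y] stands for the contents of the [Node]. *)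
Lemma pt_case (A B X Y : Type) {dA : data A} {dB : data B} {dX : data X}
    {dY : data Y} (h : A -> X) (f : A -> B) (g : A * Y -> B) (k : A -> B) :
  PT h -> PT f -> PT g ->
  (forall a, match code (h a) with
             | Leaf => k a = f a
             | Node l r => exists2 y : Y, code y = Node l r & k a = g (a, y)
             end) -> PT k.
Proof.
move=> /PT_elim[p [T [[hT mT] Eh Sh]]] /PT_elim[q [U [[hU mU] Ef Sf]]].
move=> /PT_elim[q' [U' [[hU' mU'] Eg Sg]]] H.
apply: (@PT_intro _ _ _ _ _ (Seq dup (Seq p (Case RM
   (Seq (Push RM true) (Seq swap (Seq (Push RM true) q'))) q Skip)))
  (fun n => (22 * n + 11) + (T n +
    ((2 + ((18 * (T n + n) + 16) + (2 + U' (n + T n + 1)))) + U n + 1)))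
  (fun n => U n + U' (n + T n + 1))).
- by solve_poly.
- by solve_poly.
- move=> a r sa sb sc; apply: runs_seq; first exact: runs_dup.
  apply: runs_seq; first exact: Eh.
  have := H a; have := Sh a; rewrite addn1 [dsize (h a)]/dsize.
  case: (code (h a)) => [|l t] Sa => [->|[y Ey ->]] /=.
    apply: (@runs_case _ _ _ _ _ false); [exact: erefl|] => /=.
    by apply: runs_le (Ef _ _ _ _ _) _; apply: leq_addl.
  apply: (@runs_case _ _ _ _ _ true); first exact: erefl.
  set T0 := (2 + _); apply: (@runs_le _ _ T0); last exact: leq_addr.
  apply: runs_seq; first exact: runs_push.
  apply: runs_seq.
    have -> : true :: (ser l ++ ser t) ++ ser (code a) ++ r =
              ser (Node l t) ++ ser (code a) ++ r by [].
    apply: runs_le (runs_swap _ _ _ _ _ _) _.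
    by rewrite leq_add2r leq_mul2l leq_add2r.
  apply: runs_seq; first exact: runs_push.
  have -> : true :: ser (code a) ++ ser (Node l t) ++ r =
            ser (code (a, y)) ++ r by rewrite ser_pair Ey.
  apply: runs_le (Eg _ _ _ _ _) _; apply: mU'.
  by rewrite dsize_pair addn1 ltnS leq_add2l /dsize Ey.
- move=> a; have := H a; have := Sh a; rewrite [dsize (h a)]/dsize.
  case: (code (h a)) => [|l t] Sa => [->|[y Ey ->]] /=.
    exact: leq_trans (Sf _) (leq_addr _ _).
  apply: leq_trans (Sg _) _; apply: leq_trans (leq_addl _ _); apply: mU'.
  by rewrite dsize_pair addn1 ltnS leq_add2l /dsize Ey.
Qed.

(** A polynomial step may square the size of the state each time, hence the hypothesis that all
    intermediate states stay below one polynomial in the size of the input. *)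
Lemma pt_iter (A S : Type) {dA : data A} {dS : data S} (n : A -> nat)
    (i : A -> S) (step : S -> S) (K : nat -> nat) :
  PT n -> PT i -> PT step -> poly K ->
  (forall a k, k <= n a -> dsize (iter k step (i a)) <= K (dsize a)) ->
  PT (fun a => iter (n a) step (i a)).
Proof.
move=> /PT_elim[p [T [[hT mT] En Sn]]] /PT_elim[q [U [[hU mU] Ei Si]]].
move=> /PT_elim[q' [U' [[hU' mU'] Es Ss]]] [c [d Hcd]] HK.
pose K' := bd c d; have mK : {homo K' : m n / m <= n} by move=> x y; apply: bd_mono.
have hK : poly K' by apply: poly_bd.
(* A unary counter serializes as [true; false] repeated, then [false]. The [While] pops the [true],
   the first command of the body pops the [false] after it, and the predecessor remains on top. *)
pose body := Seq (Case RM Skip Skip Skip) (Seq swap (Seq q' swap)).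
apply: (@PT_intro _ _ _ _ _
  (Seq dup (Seq q (Seq swap (Seq p (While RM body)))))
  (fun n => (22 * n + 11) + (U n + ((18 * (U n + n) + 16) + (T n +
     (T n * (40 + 36 * T n + 36 * K' n + U' (K' n)) + 1)))))
  K').
- by solve_poly.
- by [].
- move=> a r sa sb sc; apply: runs_seq; first exact: runs_dup.
  apply: runs_seq; first exact: Ei.
  apply: runs_seq.
    apply: runs_le (runs_swap _ _ _ _ _ _) _.
    by rewrite leq_add2r leq_mul2l leq_add2r; apply: Si.
  apply: runs_seq; first exact: En.
  set M := 40 + _ + _ + _.
  have nT (m : nat) : m <= n a -> size (ser (code m)) <= T (dsize a).
    move=> le; apply: leq_trans (Sn a); rewrite /dsize.
    by move: {+}(n a) le => N; elim: m N => [|m IH] [|N] //= h; rewrite !ltnS IH.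
  have loop (m k : nat) : m + k = n a -> runs (While RM body)
      (Store (ser (code m) ++ ser (code (iter k step (i a))) ++ r) sa sb sc)
      (m * M + 1) (Store (ser (code (iter (n a) step (i a))) ++ r) sa sb sc).
    elim: m k => [|m IH] k E; first by rewrite -E; apply: runs_whileF.
    have E' : m + k.+1 = n a by lia.
    apply: (@runs_le _ _ (M.-1 + (m * M + 1)).+1); last by rewrite mulSn; lia.
    apply: runs_whileT; [exact: erefl| |exact: (IH _ E')] => /=.
    set z := iter k step (i a); set z' := step z.
    have sz : size (ser (code z)) <= K' (dsize a).
      by apply: leq_trans (Hcd _); apply: HK; lia.
    have sz' : size (ser (code z')) <= K' (dsize a).
      by apply: leq_trans (Hcd _); apply: (HK _ k.+1); lia.
    have sm : size (ser (code m)) <= T (dsize a) by apply: nT; lia.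
    apply: (@runs_le _ _ (2 + ((18 * (T (dsize a) + K' (dsize a)) + 16) +
       (U' (K' (dsize a)) + (18 * (K' (dsize a) + T (dsize a)) + 16)))));
      last by rewrite /M; lia.
    apply: runs_seq; first by apply: (@runs_case _ _ _ _ _ false); [exact: erefl | exact: runs_skip].
    apply: runs_seq.
      by apply: runs_le (runs_swap _ _ _ _ _ _) _; rewrite leq_add2r leq_mul2l leq_add.
    apply: runs_seq; first by apply: runs_le (Es _ _ _ _ _) _; apply: mU'.
    by apply: runs_le (runs_swap _ _ _ _ _ _) _; rewrite leq_add2r leq_mul2l leq_add.
  apply: (runs_le (loop (n a) 0 (addn0 _))).
  rewrite leq_add2r leq_mul2r (leq_trans _ (Sn a)) ?orbT // /dsize.
  by elim: {+}(n a) => //= m; rewrite !ltnS => IH; apply: leqW.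
- by move=> a; apply: leq_trans (Hcd _); apply: HK.
Qed.

Lemma dsize_cons (T : Type) {dT : data T} (x : T) s :
  dsize (x :: s) = (dsize x + dsize s).+1.
Proof. by rewrite /dsize /= size_cat. Qed.

Lemma dsize_nil (T : Type) {dT : data T} : dsize (@nil T) = 1.
Proof. by []. Qed.

Lemma dsize_some (T : Type) {dT : data T} (x : T) :
  dsize (Some x) = (dsize x).+2.
Proof. by []. Qed.

Lemma dsize_nat (n : nat) : dsize n = n.*2.+1.
Proof. by elim: n => // n; rewrite /dsize /= => ->. Qed.

Lemma dsize_bool (b : bool) : dsize b <= 3.
Proof. by case: b. Qed.

Lemma dsize_gt0 (T : Type) {dT : data T} (x : T) : 0 < dsize x.
Proof. by rewrite /dsize; case: (code x). Qed.

(** * Polynomial time functions on strings *)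

(** The end of the raw input shows only as an empty register, so the loops are driven by a flag on
    [RC] that the branch for the empty register does not renew. The first loop reverses the input
    into [RA]; the second prepends for each bit a [Node] mark and the code of the bit. *)
Definition read_input : cmd :=
  Seq (Seq (Push RC true) (While RC (Case RM
         (Seq (Push RA true) (Push RC true))
         (Seq (Push RA false) (Push RC true)) Skip)))
      (Seq (Push RM false) (Seq (Push RC true) (While RC (Case RA
         (Seq (push_bits [:: true; true; false; false]) (Push RC true))
         (Seq (push_bits [:: true; false]) (Push RC true)) Skip)))).

Definition write_output : cmd :=
  Seq (While RM (Case RM
         (Seq (Push RA true) (Case RM Skip (Case RM Skip Skip Skip) Skip))
         (Push RA false) Skip))
      (Seq (Push RC true) (While RC (Case RA
         (Seq (Push RM true) (Push RC true))
         (Seq (Push RM false) (Push RC true)) Skip))).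

Lemma runs_whileE r c s : get r s = [::] -> runs (While r c) s 1 s.
Proof. by move=> E; exists 1 => //; apply: EWhileE. Qed.

Lemma runs_read_loop s A :
  runs (While RC (Case RM (Seq (Push RA true) (Push RC true))
                          (Seq (Push RA false) (Push RC true)) Skip))
    (Store s A [::] [:: true]) (6 * size s + 4)
    (Store [::] (catrev s A) [::] [::]).
Proof.
elim: s A => [|b s IH] A /=.
  apply: (@runs_le _ _ (2 + 1).+1) => //.
  apply: runs_whileT; [exact: erefl| |by apply: runs_whileE].
  by apply: runs_caseE; [exact: erefl | exact: runs_skip].
apply: (@runs_le _ _ (5 + (6 * size s + 4)).+1); last by lia.
apply: runs_whileT; [exact: erefl| |exact: IH] => /=.
apply: (@runs_case _ _ _ _ _ b); [exact: erefl|] => /=.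
by case: b; apply: (@runs_seq _ _ _ 2 _ 2); apply: runs_push.
Qed.

Lemma runs_encode_loop A s :
  runs (While RC (Case RA
         (Seq (push_bits [:: true; true; false; false]) (Push RC true))
         (Seq (push_bits [:: true; false]) (Push RC true)) Skip))
    (Store (ser (code s)) A [::] [:: true]) (13 * size A + 4)
    (Store (ser (code (catrev A s))) [::] [::] [::]).
Proof.
elim: A s => [|b A IH] s /=.
  apply: (@runs_le _ _ (2 + 1).+1) => //.
  apply: runs_whileT; [exact: erefl| |by apply: runs_whileE].
  by apply: runs_caseE; [exact: erefl | exact: runs_skip].
apply: (@runs_le _ _ (12 + (13 * size A + 4)).+1); last by lia.
apply: runs_whileT; [exact: erefl| |exact: IH] => /=.
apply: (@runs_case _ _ _ _ _ b); [exact: erefl|] => /=.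
case: b.
  apply: (@runs_seq _ _ _ 9 _ 2).
    exact: (runs_push_bits [:: true; true; false; false]).
  exact: runs_push.
apply: (@runs_le _ _ (5 + 2)) => //; apply: runs_seq.
  exact: (runs_push_bits [:: true; false]).
exact: runs_push.
Qed.

Lemma runs_read_input s :
  runs read_input (Store s [::] [::] [::]) (19 * size s + 14)
       (Store (ser (code s)) [::] [::] [::]).
Proof.
apply: (@runs_le _ _ ((2 + (6 * size s + 4)) +
   (2 + (2 + (13 * size (rev s) + 4))))); last by rewrite size_rev; lia.
apply: runs_seq.
  by apply: runs_seq; [exact: runs_push | exact: runs_read_loop].
apply: runs_seq; first exact: runs_push.
apply: runs_seq; first exact: runs_push.
by have := runs_encode_loop (rev s) [::]; rewrite -/(rev (rev s)) revK.
Qed.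

Lemma runs_decode_loop s A :
  runs (While RM (Case RM
         (Seq (Push RA true) (Case RM Skip (Case RM Skip Skip Skip) Skip))
         (Push RA false) Skip))
    (Store (ser (code s)) A [::] [::]) (8 * size s + 1)
    (Store [::] (catrev s A) [::] [::]).
Proof.
elim: s A => [|b s IH] A; first by apply: runs_whileF.
apply: (@runs_le _ _ (7 + (8 * size s + 1)).+1); last by rewrite /=; lia.
apply: runs_whileT; [exact: erefl| |exact: IH] => /=.
apply: (@runs_le _ _ 6.+1) => //; case: b; last first.
  apply: (@runs_case _ _ _ _ _ false); [exact: erefl|] => /=.
  by apply: runs_le (runs_push _ _ _) _.
apply: (@runs_case _ _ _ _ _ true); [exact: erefl|] => /=.
apply: (@runs_le _ _ (2 + 1.+1.+1)) => //; apply: runs_seq; first exact: runs_push.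
apply: (@runs_case _ _ _ _ _ false); [exact: erefl|] => /=.
by apply: (@runs_case _ _ _ _ _ false); [exact: erefl|exact: runs_skip].
Qed.

Lemma runs_write_loop A m :
  runs (While RC (Case RA (Seq (Push RM true) (Push RC true))
                          (Seq (Push RM false) (Push RC true)) Skip))
    (Store m A [::] [:: true]) (6 * size A + 4)
    (Store (catrev A m) [::] [::] [::]).
Proof.
elim: A m => [|b A IH] m /=.
  apply: (@runs_le _ _ (2 + 1).+1) => //.
  apply: runs_whileT; [exact: erefl| |by apply: runs_whileE].
  by apply: runs_caseE; [exact: erefl | exact: runs_skip].
apply: (@runs_le _ _ (5 + (6 * size A + 4)).+1); last by lia.
apply: runs_whileT; [exact: erefl| |exact: IH] => /=.
apply: (@runs_case _ _ _ _ _ b); [exact: erefl|] => /=.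
by case: b; apply: (@runs_seq _ _ _ 2 _ 2); apply: runs_push.
Qed.

Lemma runs_write_output s :
  runs write_output (Store (ser (code s)) [::] [::] [::]) (14 * size s + 7)
       (Store s [::] [::] [::]).
Proof.
apply: (@runs_le _ _ ((8 * size s + 1) + (2 + (6 * size (rev s) + 4))));
  last by rewrite size_rev; lia.
apply: runs_seq; first exact: runs_decode_loop.
apply: runs_seq; first exact: runs_push.
by have := runs_write_loop (rev s) [::]; rewrite -/(rev (rev s)) revK.
Qed.

Lemma dsize_bits_le (s : seq bool) : dsize s <= 4 * size s + 1.
Proof.
elim: s => //= b s IH; rewrite dsize_cons.
by have := dsize_bool b; lia.
Qed.

Lemma size_le_dsize (T : Type) {dT : data T} (s : seq T) : size s <= dsize s.
Proof. by elim: s => //= b s IH; rewrite dsize_cons; lia. Qed.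

Lemma PT_computes (f : seq bool -> seq bool) : PT f ->
  exists M c d, forall s, exists2 t, t <= c * (size s) ^ d + c &
    computes_within M s t (f s).
Proof.
move=> /PT_elim[p [T [[hT mT] Ef Sf]]].
have [c [d Hcd]] : poly (fun n => (19 * n + 14) + (T (4 * n + 1) +
    (14 * T (4 * n + 1) + 7))).
  have h : poly (fun n => T (4 * n + 1)) by apply: poly_comp => //; solve_poly.
  by solve_poly.
(* The factor [2 ^ d] absorbs the successor in [bd] for nonempty inputs; the additive constant
   covers the empty one. *)
exists (machine (Seq read_input (Seq p write_output))), (c * 2 ^ d), d => s.
have [n hn E] : runs (Seq read_input (Seq p write_output))
    (Store s [::] [::] [::]) (bd c d (size s)) (Store (f s) [::] [::] [::]).
  apply: runs_le (Hcd _).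
  apply: runs_seq; first exact: runs_read_input.
  apply: runs_seq.
    have := Ef s [::] [::] [::] [::]; rewrite !cats0 => /runs_le; apply.
    by apply: mT; apply: dsize_bits_le.
  apply: runs_le (runs_write_output _) _; rewrite leq_add2r leq_mul2l.
  apply: leq_trans (size_le_dsize _) _; apply: leq_trans (Sf s) _.
  by apply: mT; apply: dsize_bits_le.
exists n; last exact: machine_computes.
apply: leq_trans hn _; rewrite /bd.
case: (size s) => [|k].
  by rewrite exp1n muln1 -[X in X <= _]muln1 (leq_trans _ (leq_addl _ _)) //
    leq_mul2l expn_gt0 orbT.
apply: (leq_trans _ (leq_addr _ _)); rewrite -mulnA leq_mul2l -expnMn.
by apply/orP; right; apply: leq_expl; lia.
Qed.

(** * Closure properties *)

Create HintDb pt.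

Lemma PT_fst (A B C : Type) {dA : data A} {dB : data B} {dC : data C}
  (f : A -> B * C) : PT f -> PT (fun a => (f a).1).
Proof. by move=> h; apply: (pt_comp h (@pt_fst _ _ _ _)). Qed.

Lemma PT_snd (A B C : Type) {dA : data A} {dB : data B} {dC : data C}
  (f : A -> B * C) : PT f -> PT (fun a => (f a).2).
Proof. by move=> h; apply: (pt_comp h (@pt_snd _ _ _ _)). Qed.

Lemma pt_comp2 (A X Y Z : Type) {dA : data A} {dX : data X} {dY : data Y}
    {dZ : data Z} (F : X -> Y -> Z) (f : A -> X) (g : A -> Y) :
  PT (fun p : X * Y => F p.1 p.2) -> PT f -> PT g -> PT (fun a => F (f a) (g a)).
Proof. by move=> hF hf hg; apply: (pt_comp (pt_pair hf hg) hF). Qed.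

Lemma pt_comp3 (A X Y Z W : Type) {dA : data A} {dX : data X} {dY : data Y}
    {dZ : data Z} {dW : data W} (F : X -> Y -> Z -> W) (f : A -> X) (g : A -> Y)
    (h : A -> Z) :
  PT (fun p : X * (Y * Z) => F p.1 p.2.1 p.2.2) -> PT f -> PT g -> PT h ->
  PT (fun a => F (f a) (g a) (h a)).
Proof.
by move=> hF hf hg hh; apply: (pt_comp (pt_pair hf (pt_pair hg hh)) hF).
Qed.

Lemma pt_recode (A B C : Type) {dA : data A} {dB : data B} {dC : data C}
    (f : A -> B) (g : A -> C) :
  PT f -> (forall a, code (f a) = code (g a)) -> PT g.
Proof.
move=> [p [c [d H]]] E; exists p, c, d => a r sa sb sc.
by rewrite /dsize -E; apply: H.
Qed.

#[export] Hint Extern 0 (PT fst) => apply: pt_fst : pt.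
#[export] Hint Extern 0 (PT snd) => apply: pt_snd : pt.
#[export] Hint Extern 0 (PT (fun x => x)) => apply: pt_id : pt.
#[export] Hint Extern 0 (PT (fun _ => ?c)) => apply: pt_const : pt.
#[export] Hint Extern 1 (PT (fun _ => (_, _))) => apply: pt_pair : pt.
#[export] Hint Extern 1 (PT (fun _ => fst _)) => apply: PT_fst : pt.
#[export] Hint Extern 1 (PT (fun _ => snd _)) => apply: PT_snd : pt.
#[export] Hint Extern 0 (PT _) => eassumption : pt.
#[export] Hint Extern 0 (poly _) => solve [solve_poly] : pt.

Ltac pt := auto 200 with pt nocore.

Section Cases.
Context {A B X Y Z : Type} {dA : data A} {dB : data B} {dX : data X} {dY : data Y}
  {dZ : data Z}.

Lemma pt_if (b : A -> bool) (f g : A -> B) :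
  PT b -> PT f -> PT g -> PT (fun a => if b a then f a else g a).
Proof.
move=> hb hf hg; apply: (pt_case (Y := tree * tree) (g := fun p => f p.1) hb hg).
  by apply: (pt_comp (@pt_fst _ _ _ _) hf).
by move=> a; case: (b a) => //; exists (Leaf, Leaf).
Qed.

Lemma pt_seq_case (l : A -> seq X) (f : A -> B) (g : A -> X -> seq X -> B) :
  PT l -> PT f -> PT (fun p : A * (X * seq X) => g p.1 p.2.1 p.2.2) ->
  PT (fun a => if l a is x :: s then g a x s else f a).
Proof.
move=> hl hf hg; apply: (pt_case (Y := X * seq X) hl hf hg).
by move=> a; case: (l a) => // x s; exists (x, s).
Qed.

Lemma pt_option_case (o : A -> option X) (f : A -> B) (g : A -> X -> B) :
  PT o -> PT f -> PT (fun p : A * X => g p.1 p.2) ->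
  PT (fun a => if o a is Some x then g a x else f a).
Proof.
move=> ho hf hg.
apply: (pt_case (Y := tree * X) (g := fun p => g p.1 p.2.2) ho hf).
  by apply: (pt_comp2 hg); pt.
by move=> a; case: (o a) => // x; exists (Leaf, x).
Qed.

Lemma pt_nat_case (n : A -> nat) (f : A -> B) (g : A -> nat -> B) :
  PT n -> PT f -> PT (fun p : A * nat => g p.1 p.2) ->
  PT (fun a => if n a is m.+1 then g a m else f a).
Proof.
move=> hn hf hg.
apply: (pt_case (Y := tree * nat) (g := fun p => g p.1 p.2.2) hn hf).
  by apply: (pt_comp2 hg); pt.
by move=> a; case: (n a) => // m; exists (Leaf, m).
Qed.

Lemma pt_tree_case (t : A -> tree) (f : A -> B) (g : A -> tree -> tree -> B) :
  PT t -> PT f -> PT (fun p : A * (tree * tree) => g p.1 p.2.1 p.2.2) ->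
  PT (fun a => if t a is Node x s then g a x s else f a).
Proof.
move=> hl hf hg; apply: (pt_case (Y := tree * tree) hl hf hg).
by move=> a; case: (t a) => // x s; exists (x, s).
Qed.

Lemma pt_node (f g : A -> tree) : PT f -> PT g -> PT (fun a => Node (f a) (g a)).
Proof. by move=> hf hg; apply: (pt_recode (pt_pair hf hg)). Qed.

Lemma pt_cons (f : A -> X) (g : A -> seq X) :
  PT f -> PT g -> PT (fun a => f a :: g a).
Proof. by move=> hf hg; apply: (pt_recode (pt_pair hf hg)). Qed.

Lemma pt_some (f : A -> X) : PT f -> PT (fun a => Some (f a)).
Proof. by move=> hf; apply: (pt_recode (pt_pair (pt_const Leaf) hf)). Qed.

Lemma pt_succ (n : A -> nat) : PT n -> PT (fun a => (n a).+1).
Proof. by move=> hn; apply: (pt_recode (pt_pair (pt_const Leaf) hn)). Qed.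

End Cases.

#[export] Hint Extern 1 (PT (fun _ => if _ then _ else _)) => apply: pt_if : pt.
#[export] Hint Extern 1 (PT (fun _ => Node _ _)) => apply: pt_node : pt.
#[export] Hint Extern 1 (PT (fun _ => _ :: _)) => apply: pt_cons : pt.
#[export] Hint Extern 1 (PT (fun _ => Some _)) => apply: pt_some : pt.
#[export] Hint Extern 1 (PT (fun _ => S _)) => apply: pt_succ : pt.

Section Bool.
Context {A : Type} {dA : data A}.
Implicit Types f g : A -> bool.

Lemma pt_negb f : PT f -> PT (fun a => ~~ f a).
Proof. by move=> hf; apply: (@pt_eq _ _ _ _ (fun a => if f a then false else true)); pt. Qed.

Lemma pt_andb f g : PT f -> PT g -> PT (fun a => f a && g a).
Proof. by move=> hf hg; apply: (@pt_eq _ _ _ _ (fun a => if f a then g a else false)); pt. Qed.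

Lemma pt_orb f g : PT f -> PT g -> PT (fun a => f a || g a).
Proof. by move=> hf hg; apply: (@pt_eq _ _ _ _ (fun a => if f a then true else g a)); pt. Qed.
End Bool.
#[export] Hint Extern 1 (PT (fun _ => ~~ _)) => apply: pt_negb : pt.
#[export] Hint Extern 1 (PT (fun _ => _ && _)) => apply: pt_andb : pt.
#[export] Hint Extern 1 (PT (fun _ => _ || _)) => apply: pt_orb : pt.

Section Lists.
Context {A X : Type} {dA : data A} {dX : data X}.

Lemma pt_head (x0 : X) (l : A -> seq X) : PT l -> PT (fun a => head x0 (l a)).
Proof.
move=> hl; apply: (@pt_eq _ _ _ _ (fun a => if l a is x :: _ then x else x0)).
  by move=> a; case: (l a).
by apply: pt_seq_case; pt.
Qed.

Lemma pt_behead (l : A -> seq X) : PT l -> PT (fun a => behead (l a)).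
Proof.
move=> hl; apply: (@pt_eq _ _ _ _ (fun a => if l a is _ :: s then s else [::])).
  by move=> a; case: (l a).
by apply: pt_seq_case; pt.
Qed.
End Lists.
#[export] Hint Extern 1 (PT (fun _ => head _ _)) => apply: pt_head : pt.
#[export] Hint Extern 1 (PT (fun _ => behead _)) => apply: pt_behead : pt.

Lemma pt_pred (A : Type) {dA : data A} (n : A -> nat) :
  PT n -> PT (fun a => (n a).-1).
Proof.
move=> hn; apply: (@pt_eq _ _ _ _ (fun a => if n a is m.+1 then m else 0)).
  by move=> a; case: (n a).
by apply: pt_nat_case; pt.
Qed.
#[export] Hint Extern 1 (PT (fun _ => predn _)) => apply: pt_pred : pt.

(* The only way to obtain an iteration count from non-numeric data. *)
Lemma pt_dsize (A B : Type) {dA : data A} {dB : data B} (f : A -> B) :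
  PT f -> PT (fun a => dsize (f a)).
Proof.
move=> hf; apply: (pt_comp hf) => {A dA f hf}.
apply: (@PT_intro _ _ _ _ _
  (Seq toA (Seq (Push RM false)
    (While RA (Case RA (Seq (Push RM false) (Push RM true))
                       (Seq (Push RM false) (Push RM true)) Skip))))
  (fun n => (2 + (14 * n + 5)) + (2 + (6 * n + 1))) (fun n => 2 * n + 1)).
- by solve_poly.
- by solve_poly.
- move=> b r sa sb sc; apply: runs_seq.
    by apply: runs_seq; [exact: runs_push | exact: runs_walk].
  apply: runs_seq; first exact: runs_push.
  have loop l (m : nat) : runs
      (While RA (Case RA (Seq (Push RM false) (Push RM true))
                         (Seq (Push RM false) (Push RM true)) Skip))
      (Store (ser (code m) ++ r) (marked true (false :: sa) l) sb sc)
      (6 * size l + 1) (Store (ser (code (size l + m)) ++ r) sa sb sc).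
    elim/last_ind: l m => [|l x IH] m; first by apply: runs_whileF.
    rewrite size_rcons addSnnS /= foldl_rcons.
    apply: (@runs_le _ _ (5 + (6 * size l + 1)).+1); last by lia.
    apply: runs_whileT; [exact: erefl| |exact: IH] => /=.
    by apply: (@runs_case _ _ _ _ _ x); [exact: erefl|] => /=;
      case: x; apply: (@runs_seq _ _ _ 2 _ 2); apply: runs_push.
 by have := loop (ser (@code _ dB b)) 0; rewrite addn0.
- by move=> b; rewrite dsize_nat; lia.
Qed.

Section Iter.
Context {A S : Type} {dA : data A} {dS : data S}.

Lemma pt_iterK (n : A -> nat) (i : A -> S) (step : A -> S -> S) K :
  PT n -> PT i -> PT (fun p : A * S => step p.1 p.2) -> poly K ->
  (forall a k, k <= n a -> dsize (iter k (step a) (i a)) <= K (dsize a)) ->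
  PT (fun a => iter (n a) (step a) (i a)).
Proof.
move=> hn hi hs hK H.
(* The loop body of [pt_iter] sees only the state, so the parameter travels with it. *)
pose step' p := (p.1, step p.1 p.2).
have E k a : iter k step' (a, i a) = (a, iter k (step a) (i a)).
  by elim: k => //= k ->.
apply: (@pt_eq _ _ _ _ (fun a => (iter (n a) step' (a, i a)).2)).
  by move=> a; rewrite E.
apply: PT_snd; apply: (@pt_iter _ _ _ _ n (fun a => (a, i a)) step'
   (fun n => n + K n + 1)); [pt|pt|rewrite /step'; pt|pt|].
by move=> a k hk; rewrite E dsize_pair addn1 ltnS leq_add2l; apply: H.
Qed.

(** If a step adds at most an amount that depends on the input alone, polynomially many steps add
    polynomially much. This is the usual way to meet the size hypothesis of [pt_iterK]. *)
Lemma pt_iter_lin (n : A -> nat) (i : A -> S) (step : A -> S -> S) G :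
  PT n -> PT i -> PT (fun p : A * S => step p.1 p.2) -> poly G ->
  (forall a s, dsize (step a s) <= dsize s + G (dsize a)) ->
  PT (fun a => iter (n a) (step a) (i a)).
Proof.
move=> hn hi hs hG H.
have [I [pI mI] HI] := PT_size hi; have [N [pN mN] HN] := PT_size hn.
apply: (@pt_iterK _ _ _ (fun m => I m + N m * G m)) => // [|a k hk]; first by pt.
have {hk} : k <= N (dsize a).
  by apply: leq_trans hk _; apply: leq_trans (HN a); rewrite dsize_nat; lia.
elim: k => [|k IH] hk /=.
  by apply: leq_trans (HI a) _; apply: leq_addr.
have {IH} : dsize (iter k (step a) (i a)) <= I (dsize a) + k * G (dsize a).
  elim: k {IH hk} => [|k IH] /=; first by rewrite addn0.
  by apply: leq_trans (H _ _) _; rewrite mulSn; lia.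
move=> IH; apply: leq_trans (H _ _) _.
apply: (@leq_trans (I (dsize a) + k.+1 * G (dsize a))); first by rewrite mulSn; lia.
by rewrite leq_add2l leq_mul2r hk orbT.
Qed.

End Iter.

Section Fold.
Context {A S X : Type} {dA : data A} {dS : data S} {dX : data X}.

Definition fold_step (f : S -> X -> S) (p : seq X * S) : seq X * S :=
  if p.1 is x :: s then (s, f p.2 x) else p.

Lemma iter_fold_step f k l acc :
  iter k (fold_step f) (l, acc) = (drop k l, foldl f acc (take k l)).
Proof.
elim: k l acc => [|k IH] l acc; first by rewrite drop0 take0.
by rewrite iterSr; case: l => [|x l] /=; rewrite IH.
Qed.

Lemma dsize_drop (l : seq X) k : dsize (drop k l) <= dsize l.
Proof.
elim: k l => [|k IH] [|x l] //=; rewrite dsize_cons.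
by apply: leq_trans (IH l) _; lia.
Qed.

Lemma pt_foldlK (f : A -> S -> X -> S) (i : A -> S) (l : A -> seq X) K :
  PT (fun p : A * (S * X) => f p.1 p.2.1 p.2.2) -> PT i -> PT l -> poly K ->
  (forall a k, dsize (foldl (f a) (i a) (take k (l a))) <= K (dsize a)) ->
  PT (fun a => foldl (f a) (i a) (l a)).
Proof.
move=> hf hi hl hK H.
have [L [pL mL] HL] := PT_size hl.
apply: (@pt_eq _ _ _ _ (fun a =>
   (iter (dsize (l a)) (fold_step (f a)) (l a, i a)).2)).
  by move=> a; rewrite iter_fold_step take_oversize //; apply: size_le_dsize.
apply: PT_snd; apply: (@pt_iterK _ _ _ _ (fun a => dsize (l a))
  (fun a => (l a, i a)) (fun a => fold_step (f a)) (fun n => L n + K n + 1)).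
- exact: pt_dsize.
- by pt.
- apply: pt_seq_case; [by pt|by pt|].
  by apply: pt_pair; [pt | apply: (pt_comp3 hf); pt].
- by pt.
- move=> a k _; rewrite iter_fold_step dsize_pair addn1 ltnS leq_add //.
  by apply: leq_trans (dsize_drop _ _) (HL _).
Qed.

Lemma pt_foldl (f : A -> S -> X -> S) (i : A -> S) (l : A -> seq X) G :
  PT (fun p : A * (S * X) => f p.1 p.2.1 p.2.2) -> PT i -> PT l -> poly G ->
  (forall a acc x, dsize x <= dsize (l a) ->
     dsize (f a acc x) <= dsize acc + G (dsize a)) ->
  PT (fun a => foldl (f a) (i a) (l a)).
Proof.
move=> hf hi hl hG H.
have [I [pI mI] HI] := PT_size hi; have [L [pL mL] HL] := PT_size hl.
apply: (@pt_foldlK _ _ _ (fun m => I m + L m * G m)) => // [|a k]; first by pt.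
apply: (@leq_trans (dsize (i a) + size (take k (l a)) * G (dsize a))).
  have : {subset take k (map (fun x => dsize x) (l a)) <= map (fun x => dsize x) (l a)} by apply: mem_take.
  rewrite -map_take; set s := take k _.
  have : forall x, x \in map (fun x => dsize x) (l a) -> x <= dsize (l a).
    elim: (l a) => //= y m IH x; rewrite inE dsize_cons => /orP[/eqP->|/IH h].
      by apply: leqW; apply: leq_addr.
    by apply: leqW; apply: leq_trans h (leq_addl _ _).
  move=> Hl; elim/last_ind: s => [|s x IH] Hs; first by rewrite addn0.
  rewrite foldl_rcons size_rcons mulSn.
  apply: leq_trans (H _ _ _ _) _.
    by apply: Hl; apply: Hs; rewrite map_rcons mem_rcons mem_head.
  rewrite addnCA addnC leq_add2l; apply: IH => y hy; apply: Hs.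
  by rewrite map_rcons mem_rcons inE hy orbT.
apply: leq_add; first exact: HI.
apply: leq_mul => //; apply: leq_trans (HL a); apply: leq_trans (size_le_dsize _).
by rewrite size_take_min geq_minr.
Qed.
End Fold.

#[export] Hint Extern 0 (PT S) => apply: (pt_succ (@pt_id _ _)) : pt.
#[export] Hint Extern 0 (PT predn) => apply: (pt_pred (@pt_id _ _)) : pt.
#[export] Hint Extern 0 (PT negb) => apply: (pt_negb (@pt_id _ _)) : pt.

Lemma pt_catrev (A X : Type) {dA : data A} {dX : data X}
    (l s : A -> seq X) :
  PT l -> PT s -> PT (fun a => catrev (l a) (s a)).
Proof.
move=> hl hs; have [L [pL mL] HL] := PT_size hl.
apply: (@pt_eq _ _ _ _ (fun a => foldl (fun acc x => x :: acc) (s a) (l a))).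
  by move=> a; elim: (l a) (s a) => //= x m IH acc; rewrite IH.
apply: (pt_foldl (G := fun n => L n + 1)); [pt|pt|pt|pt|] => a acc x hx.
by rewrite dsize_cons; have := HL a; lia.
Qed.

Lemma pt_rev (A X : Type) {dA : data A} {dX : data X}
    (l : A -> seq X) : PT l -> PT (fun a => rev (l a)).
Proof. by move=> hl; apply: pt_catrev; pt. Qed.
#[export] Hint Extern 1 (PT (fun _ => rev _)) => apply: pt_rev : pt.

Lemma pt_cat (A X : Type) {dA : data A} {dX : data X}
    (l s : A -> seq X) : PT l -> PT s -> PT (fun a => l a ++ s a).
Proof.
move=> hl hs; apply: (@pt_eq _ _ _ _ (fun a => catrev (rev (l a)) (s a))).
  by move=> a; rewrite catrevE revK.
by apply: pt_catrev => //; apply: pt_rev.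
Qed.
#[export] Hint Extern 1 (PT (fun _ => _ ++ _)) => apply: pt_cat : pt.

Lemma pt_map (A X Y : Type) {dA : data A} {dX : data X} {dY : data Y}
    (f : A -> X -> Y) (l : A -> seq X) :
  PT (fun p : A * X => f p.1 p.2) -> PT l -> PT (fun a => map (f a) (l a)).
Proof.
move=> hf hl; have [L [pL mL] HL] := PT_size hl; have [F [pF mF] HF] := PT_size hf.
apply: (@pt_eq _ _ _ _ (fun a =>
   rev (foldl (fun acc x => f a x :: acc) [::] (l a)))).
  move=> a; rewrite -[RHS]revK; congr rev; rewrite /rev.
  by elim: (l a) [::] => //= x s IH acc; rewrite IH.
apply: pt_rev; apply: (pt_foldl (G := fun n => F (n + L n + 1) + 1)); [|pt|pt| |].
- by apply: pt_cons; [apply: (pt_comp2 hf); pt | pt].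
- have h : poly (fun n => F (n + L n + 1)) by apply: poly_comp => //; solve_poly.
  by solve_poly.
- move=> a acc x hx; rewrite dsize_cons.
  have : dsize (f a x) <= F (dsize a + L (dsize a) + 1).
    apply: leq_trans (HF (a, x)) _; apply: mF; rewrite dsize_pair addn1 ltnS leq_add2l.
    exact: leq_trans hx (HL a).
  by lia.
Qed.

Lemma dsize_cat (X : Type) {dX : data X}
    (s t : seq X) : (dsize (s ++ t)).+1 = dsize s + dsize t.
Proof. by elim: s => [|x s IH] //=; rewrite !dsize_cons; lia. Qed.

Lemma pt_flatten (A X : Type) {dA : data A} {dX : data X}
    (l : A -> seq (seq X)) : PT l -> PT (fun a => flatten (l a)).
Proof.
move=> hl; have [L [pL mL] HL] := PT_size hl.
apply: (@pt_eq _ _ _ _ (fun a => foldl (fun acc x => acc ++ x) [::] (l a))).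
  move=> a; rewrite -[RHS]cat0s; elim: (l a) [::] => [|x s IH] acc /=.
    by rewrite cats0.
  by rewrite IH catA.
apply: (pt_foldl (G := L)); [|pt|pt|pt|].
  by apply: pt_cat; pt.
move=> a acc x hx; have := HL a.
have : (dsize (acc ++ x)).+1 = dsize acc + dsize x by apply: dsize_cat.
by lia.
Qed.

Lemma pt_size (A X : Type) {dA : data A} {dX : data X}
    (l : A -> seq X) : PT l -> PT (fun a => size (l a)).
Proof.
move=> hl.
apply: (@pt_eq _ _ _ _ (fun a => foldl (fun n _ => n.+1) 0 (l a))).
  move=> a; rewrite -[RHS]addn0; elim: (l a) 0 => [|x s IH] n //=.
  by rewrite IH addnS.
apply: (pt_foldl (G := fun=> 2)); [pt|pt|pt|pt|].
by move=> a n x _; rewrite !dsize_nat; lia.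
Qed.

Lemma pt_iter_id (A X : Type) {dA : data A} {dX : data X}
    (n : A -> nat) (x : A -> X) (f : X -> X) k :
  PT f -> PT n -> PT x -> (forall x, dsize (f x) <= dsize x + k) ->
  PT (fun a => iter (n a) f (x a)).
Proof.
move=> hf hn hx H; apply: (pt_iter_lin (G := fun=> k)); try by pt.
by apply: (pt_comp _ hf); pt.
Qed.
#[export] Hint Extern 1 (PT (fun _ => flatten _)) => apply: pt_flatten : pt.
#[export] Hint Extern 1 (PT (fun _ => size _)) => apply: pt_size : pt.
#[export] Hint Extern 1 (PT (fun _ => map _ _)) => apply: pt_map : pt.

Lemma pt_addn (A : Type) {dA : data A}
    (m n : A -> nat) : PT m -> PT n -> PT (fun a => m a + n a).
Proof.
move=> hm hn; apply: (@pt_eq _ _ _ _ (fun a => iter (m a) S (n a))).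
  by move=> a; rewrite iter_succn addnC.
apply: (pt_iter_id (k := 2)) => //; [pt|].
by move=> x; rewrite !dsize_nat; lia.
Qed.
#[export] Hint Extern 1 (PT (fun _ => _ + _)) => apply: pt_addn : pt.

Lemma pt_subn (A : Type) {dA : data A}
    (m n : A -> nat) : PT m -> PT n -> PT (fun a => m a - n a).
Proof.
move=> hm hn; apply: (@pt_eq _ _ _ _ (fun a => iter (n a) predn (m a))).
  by move=> a; rewrite iter_predn.
apply: (pt_iter_id (k := 2)) => //; [pt|].
by move=> x; rewrite !dsize_nat; lia.
Qed.

Lemma pt_muln (A : Type) {dA : data A}
    (m n : A -> nat) : PT m -> PT n -> PT (fun a => m a * n a).
Proof.
move=> hm hn; have [L [pL mL] HL] := PT_size hn.
apply: (@pt_eq _ _ _ _ (fun a => iter (m a) (addn (n a)) 0)).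
  by move=> a; rewrite iter_addn_0 mulnC.
apply: (pt_iter_lin (G := L)); [pt|pt| |pt|].
  by apply: pt_addn; pt; apply: (pt_comp _ hn); pt.
by move=> a s; have := HL a; rewrite !dsize_nat; lia.
Qed.
#[export] Hint Extern 1 (PT (fun _ => _ * _)) => apply: pt_muln : pt.

Lemma pt_expn (A : Type) {dA : data A}
    (m : A -> nat) (d : nat) : PT m -> PT (fun a => m a ^ d).
Proof.
move=> hm; elim: d => [|d IH]; first exact: (pt_const 1).
apply: (@pt_eq _ _ _ _ (fun a => m a * m a ^ d)); first by move=> a; rewrite expnS.
exact: pt_muln.
Qed.

Lemma pt_eq0 (A : Type) {dA : data A}
    (m : A -> nat) : PT m -> PT (fun a => m a == 0).
Proof.
move=> hm; apply: (@pt_eq _ _ _ _ (fun a => if m a is _.+1 then false else true)).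
  by move=> a; case: (m a).
by apply: pt_nat_case; pt.
Qed.
#[export] Hint Extern 1 (PT (fun _ => _ == 0)) => apply: pt_eq0 : pt.

Lemma pt_leq (A : Type) {dA : data A}
    (m n : A -> nat) : PT m -> PT n -> PT (fun a => m a <= n a).
Proof. by move=> hm hn; apply: (pt_eq0 (pt_subn hm hn)). Qed.

(** Numbers are unary here, so division by counting is polynomial. The divisor 3 is the base of the
    orders. *)
Definition div3_step (p : nat * nat) : nat * nat :=
  if p.2 == 0 then (p.1, 1) else if p.2 == 1 then (p.1, 2) else (p.1.+1, 0).

Lemma iter_div3_step (k : nat) : iter k div3_step (0, 0) = (k %/ 3, k %% 3).
Proof.
elim: k => // n; rewrite iterS => ->; rewrite /div3_step /=.
case E: (n %% 3) => [|[|[|k]]] /=; congr (_, _); have := ltn_pmod n (isT : 0 < 3); lia.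
Qed.

Lemma pt_eq1 (A : Type) {dA : data A}
    (m : A -> nat) : PT m -> PT (fun a => m a == 1).
Proof.
move=> hm; apply: (@pt_eq _ _ _ _ (fun a => if m a is k.+1 then k == 0 else false)).
  by move=> a; case: (m a).
by apply: pt_nat_case; pt; apply: pt_eq0; pt.
Qed.
#[export] Hint Extern 1 (PT (fun _ => _ == 1)) => apply: pt_eq1 : pt.

Lemma pt_edivn3 (A : Type) {dA : data A}
    (m : A -> nat) : PT m -> PT (fun a => (m a %/ 3, m a %% 3)).
Proof.
move=> hm; apply: (@pt_eq _ _ _ _ (fun a => iter (m a) div3_step (0, 0))).
  by move=> a; rewrite iter_div3_step.
apply: (pt_iter_id (k := 6)) => //; [|pt|].
  rewrite /div3_step; apply: pt_if; [apply: pt_eq0; pt|pt|].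
  by apply: pt_if; [apply: pt_eq1; pt|pt|pt].
case=> q r; rewrite /div3_step /=; do 2?case: ifP => _;
  rewrite !dsize_pair !dsize_nat; lia.
Qed.

Lemma pt_divn3 (A : Type) {dA : data A}
    (m : A -> nat) : PT m -> PT (fun a => m a %/ 3).
Proof. by move=> /pt_edivn3/PT_fst. Qed.

Lemma pt_modn3 (A : Type) {dA : data A}
    (m : A -> nat) : PT m -> PT (fun a => m a %% 3).
Proof. by move=> /pt_edivn3/PT_snd. Qed.
#[export] Hint Extern 1 (PT (fun _ => _ - _)) => apply: pt_subn : pt.
#[export] Hint Extern 1 (PT (fun _ => _ ^ _)) => apply: pt_expn : pt.
#[export] Hint Extern 1 (PT (fun _ => _ <= _)) => apply: pt_leq : pt.
#[export] Hint Extern 1 (PT (fun _ => _ %/ 3)) => apply: pt_divn3 : pt.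
#[export] Hint Extern 1 (PT (fun _ => _ %% 3)) => apply: pt_modn3 : pt.

(** * Equality, serialization and parsing of trees *)

Fixpoint tree_eqb (t u : tree) : bool :=
  match t, u with
  | Leaf, Leaf => true
  | Node l r, Node l' r' => tree_eqb l l' && tree_eqb r r'
  | _, _ => false
  end.

Lemma tree_eqP : Equality.axiom tree_eqb.
Proof.
elim=> [|l IHl r IHr] [|l' r'] /=; try by constructor.
by apply: (iffP andP) => [[/IHl-> /IHr->]|[<- <-]] //; split; [apply/IHl|apply/IHr].
Qed.

Lemma dsize_node (l r : tree) : dsize (Node l r) = (dsize l + dsize r).+1.
Proof. by rewrite /dsize /= size_cat. Qed.

Lemma dsize_leaf : dsize Leaf = 1. Proof. by []. Qed.

(** Recursion on trees is turned into iteration by a work list of pairs still to be compared. Each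
    step consumes one node, and [dsize t] is the number of nodes of [t]; a mismatch empties the list
    and thereby freezes the answer. *)
Definition eq_step (p : seq (tree * tree) * bool) : seq (tree * tree) * bool :=
  if p.1 is tu :: w then
    if tu.1 is Node l r then
      if tu.2 is Node l' r' then ((l, l') :: (r, r') :: w, p.2) else ([::], false)
    else if tu.2 is Node _ _ then ([::], false) else (w, p.2)
  else p.

Lemma iter_eq_step t u w ok :
  iter (dsize t) eq_step ((t, u) :: w, ok) =
  if tree_eqb t u then (w, ok) else ([::], false).
Proof.
rewrite /dsize [code t]/=; elim: t u w => [|l IHl r IHr] [|l' r'] w //.
  by rewrite [size _]/= iterSr [eq_step _]/= [RHS]/=; elim: (size _) => //= n ->.
rewrite [size _]/= iterSr [eq_step _]/= size_cat addnC iterD IHl /=.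
by case: tree_eqb => //=; elim: (size _) => //= n ->.
Qed.

Lemma pt_tree_eqb (A : Type) {dA : data A} (f g : A -> tree) :
  PT f -> PT g -> PT (fun a => tree_eqb (f a) (g a)).
Proof.
move=> hf hg; have [F [pF mF] HF] := PT_size hf; have [G [pG mG] HG] := PT_size hg.
apply: (@pt_eq _ _ _ _ (fun a =>
   (iter (dsize (f a)) eq_step ([:: (f a, g a)], true)).2)).
  by move=> a; rewrite iter_eq_step; case: tree_eqb.
apply: PT_snd; apply: (pt_iterK (step := fun=> eq_step)
  (K := fun n => F n + G n + 10)); [exact: pt_dsize|pt| |pt|].
- rewrite /eq_step; apply: pt_seq_case; [pt|pt|].
  apply: pt_tree_case; [pt| |].
    by apply: pt_tree_case; pt.
  by apply: pt_tree_case; pt.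
- move=> a k _.
  have : dsize (iter k eq_step ([:: (f a, g a)], true)).1 <=
         F (dsize a) + G (dsize a) + 3; last first.
    case: (iter _ _ _) => w ok; rewrite dsize_pair [(_, _).1]/=.
    by have := dsize_bool ok; lia.
  elim: k => [|k].
    rewrite /= dsize_cons dsize_nil dsize_pair.
    by have := HF a; have := HG a; lia.
  case E: (iter k _ _) => [w ok]; rewrite iterS E [(_, _).1]/=.
  apply: leq_trans; case: w {E} => [|[t u] w] //.
  case: t u => [|l r] [|l' r'];
    rewrite /eq_step /= ?dsize_cons ?dsize_nil ?dsize_pair ?dsize_node ?dsize_leaf; lia.
Qed.

Class injdata (T : Type) {d : data T} := code_inj : injective (@code T d).
Arguments injdata T {d}.

#[export] Instance injdata_bool : injdata bool.
Proof. by case=> -[]. Qed.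
#[export] Instance injdata_prod A B {dA : data A} {dB : data B}
  {iA : injdata A} {iB : injdata B} : injdata (A * B).
Proof. by move=> [a b] [a' b'] [/iA-> /iB->]. Qed.
#[export] Instance injdata_seq A {dA : data A} {iA : injdata A} : injdata (seq A).
Proof. by elim=> [|a s IH] [|a' s'] //= [/iA-> /IH->]. Qed.
#[export] Instance injdata_option A {dA : data A} {iA : injdata A} :
  injdata (option A).
Proof. by move=> [a|] [a'|] //= [/iA->]. Qed.
#[export] Instance injdata_nat : injdata nat.
Proof. by elim=> [|m IH] [|n] //= [/IH->]. Qed.

Lemma pt_eq_op (A : Type) {dA : data A} (T : eqType) {dT : data T}
    {iT : injdata T} (f g : A -> T) :
  PT f -> PT g -> PT (fun a => f a == g a).
Proof.
move=> hf hg; apply: (@pt_eq _ _ _ _ (fun a => tree_eqb (code (f a)) (code (g a)))).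
  by move=> a; apply/tree_eqP/eqP => [h|->] //; apply: iT.
by apply: pt_tree_eqb; [apply: (pt_recode hf)|apply: (pt_recode hg)].
Qed.
#[export] Hint Extern 2 (PT (fun _ => _ == _)) => apply: pt_eq_op : pt.

Definition ser_step (p : seq tree * seq bool) : seq tree * seq bool :=
  if p.1 is t :: w then
    if t is Node l r then (l :: r :: w, true :: p.2) else (w, false :: p.2)
  else p.

Lemma iter_ser_step t w o :
  iter (dsize t) ser_step (t :: w, o) = (w, catrev (ser t) o).
Proof.
rewrite /dsize [code t]/=; elim: t w o => [|l IHl r IHr] w o //.
rewrite [size _]/= iterSr [ser_step _]/= size_cat addnC iterD IHl IHr /=.
by rewrite !catrevE rev_cat catA.
Qed.

Lemma pt_ser (A : Type) {dA : data A} (f : A -> tree) :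
  PT f -> PT (fun a => ser (f a)).
Proof.
move=> hf; have [F [pF mF] HF] := PT_size hf.
apply: (@pt_eq _ _ _ _ (fun a =>
   rev (iter (dsize (f a)) ser_step ([:: f a], [::])).2)).
  by move=> a; rewrite iter_ser_step /= catrevE cats0 revK.
apply: pt_rev; apply: PT_snd; apply: (pt_iter_lin (step := fun=> ser_step)
  (G := fun=> 4)); [exact: pt_dsize|pt| |pt|].
- rewrite /ser_step; apply: pt_seq_case; [pt|pt|].
  by apply: pt_tree_case; pt.
- move=> a [[|[|l r] w] o]; rewrite /ser_step /= !dsize_pair
    ?dsize_cons ?dsize_node ?dsize_leaf; try lia.
  + by have : dsize false = 1 by []; lia.
  + by have : dsize true = 3 by []; lia.
Qed.

(** Read from the right, the prefix code becomes a postfix code: a leaf is pushed, and a node joins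
    the two topmost trees, the left one being on top. *)
Definition parse_step (w : seq tree) (b : bool) : seq tree :=
  if b then
    if w is l :: w' then if w' is r :: w'' then Node l r :: w'' else [::] else [::]
  else Leaf :: w.

Definition parse (s : seq bool) : tree := head Leaf (foldl parse_step [::] (rev s)).

Lemma parse_ser t : parse (ser t) = t.
Proof.
rewrite /parse; suff -> w : foldl parse_step w (rev (ser t)) = t :: w by [].
elim: t w => [|l IHl r IHr] w //=.
by rewrite rev_cons rev_cat -cats1 !foldl_cat IHr IHl.
Qed.

Lemma pt_parse (A : Type) {dA : data A} (f : A -> seq bool) :
  PT f -> PT (fun a => parse (f a)).
Proof.
move=> hf; unfold parse; apply: pt_head.
apply: (pt_foldl (f := fun=> parse_step) (G := fun=> 2)); [|pt|pt|pt|].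
- rewrite /parse_step; apply: pt_if; [pt| |pt].
  by apply: pt_seq_case; [pt|pt|]; apply: pt_seq_case; pt.
- move=> a w [] _; rewrite /parse_step; last by rewrite dsize_cons dsize_leaf; lia.
  case: w => [|l [|r w]]; rewrite ?dsize_cons ?dsize_node ?dsize_nil; lia.
Qed.

(** * Decoding data *)

Definition subl (t : tree) : tree := if t is Node l _ then l else Leaf.
Definition subr (t : tree) : tree := if t is Node _ r then r else Leaf.
Fixpoint spine (t : tree) : seq tree := if t is Node l r then l :: spine r else [::].

Lemma pt_subl (A : Type) {dA : data A} (t : A -> tree) : PT t -> PT (fun a => subl (t a)).
Proof. by move=> h; apply: pt_tree_case; pt. Qed.
Lemma pt_subr (A : Type) {dA : data A} (t : A -> tree) : PT t -> PT (fun a => subr (t a)).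
Proof. by move=> h; apply: pt_tree_case; pt. Qed.
Lemma pt_spine (A : Type) {dA : data A} (t : A -> tree) : PT t -> PT (fun a => spine (t a)).
Proof.
move=> h; apply: (pt_recode h) => a; elim: (t a) => // l _ r IH.
by congr Node; exact: IH.
Qed.

(** The decoder is total because the label strings are arbitrary: [check] must make sense of each of
    them as an instance. *)
Class decodable (T : Type) {d : data T} := Decodable {
  decode : tree -> T;
  decodeK : forall x, decode (code x) = x;
  pt_decode : PT decode
}.
Arguments decodable T {d}.

#[export] Instance decodable_bool : decodable bool.
Proof.
exists (fun t => if t is Node _ _ then true else false); first by case.
by apply: pt_tree_case; pt.
Defined.

#[export] Instance decodable_nat : decodable nat.
Proof.
exists (fun t => size (spine t)); first by elim=> //= n ->.
by apply: pt_size; apply: pt_spine; pt.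
Defined.

#[export] Instance decodable_prod A B {dA : data A} {dB : data B}
  {iA : decodable A} {iB : decodable B} : decodable (A * B).
Proof.
exists (fun t => (decode (subl t), decode (subr t))).
  by case=> a b /=; rewrite !decodeK.
by apply: pt_pair; apply: pt_comp pt_decode; [apply: pt_subl|apply: pt_subr]; pt.
Defined.

#[export] Instance decodable_seq A {dA : data A} {iA : decodable A} :
  decodable (seq A).
Proof.
exists (fun t => map decode (spine t)); first by elim=> //= a s ->; rewrite decodeK.
apply: (pt_map (f := fun=> decode)); last by apply: pt_spine; pt.
by apply: pt_comp pt_decode; pt.
Defined.

#[export] Instance decodable_option A {dA : data A} {iA : decodable A} :
  decodable (option A).
Proof.
exists (fun t => if t is Node _ r then Some (decode r) else None).
  by case=> //= a; rewrite decodeK.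
apply: pt_tree_case; [pt|pt|]; apply: pt_some; apply: pt_comp pt_decode; pt.
Defined.

(** * Simulation of Turing machines *)

Notation utape := (seq (option bool) * seq (option bool))%type.
Notation uact := (seq (option bool * option bool))%type.
Notation uentry := ((nat * seq (option bool)) * (nat * uact))%type.
Notation utable := (seq uentry).
Notation uconf := (nat * seq utape)%type.

(* Moves are [Some false] (left), [None] and [Some true] (right). *)
Definition umove (a : option bool * option bool) (tp : utape) : utape :=
  if a.2 is Some d then
    if d then (a.1 :: tp.1, behead tp.2)
    else (behead tp.1, head None tp.1 :: a.1 :: behead tp.2)
  else (tp.1, a.1 :: behead tp.2).

Definition lookup (tb : utable) (k : nat * seq (option bool)) : option (nat * uact) :=
  foldl (fun o (e : uentry) => if e.1 == k then Some e.2 else o) None tb.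

Definition ukey (c : uconf) : nat * seq (option bool) :=
  (c.1, [seq head None tp.2 | tp <- c.2]).

Definition uapply (x : nat * uact) (ts : seq utape) : uconf :=
  (x.1, [seq umove p.1 p.2 | p <- zip x.2 ts]).

Definition ustep (tb : utable) (c : uconf) : uconf :=
  if lookup tb (ukey c) is Some x then uapply x c.2 else c.

(** A certificate is a padded witness: what follows the first [true] is the witness proper, and the
    length of the whole is the number of simulated steps. Padding with [false] thus buys running
    time, while the simulation stays polynomial in the certificate. *)
Definition after_true (z : seq bool) : seq bool :=
  rev (foldl (fun st b => if st.1 then (true, b :: st.2) else (b, st.2))
             (false, [::]) z).2.

(** The components are the transition table, the start state, the initial tapes other than tape 0,
    the encoded input that precedes the witness on tape 0, and the bound on the size of the
    witness. *)
Notation inst := (utable * (nat * (seq utape * (seq bool * nat))))%type.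

Definition uinit (i : inst) (z : seq bool) : uconf :=
  (i.2.1, ([::], map some (i.2.2.2.1 ++ after_true z)) :: i.2.2.1).

Definition ufinal (i : inst) (z : seq bool) : uconf :=
  iter (size z) (ustep i.1) (uinit i z).

Definition accepts (i : inst) (z : seq bool) : bool :=
  [&& size (after_true z) <= i.2.2.2.2,
      lookup i.1 (ukey (ufinal i z)) == None
    & head None (head ([::], [::]) (ufinal i z).2).2 == Some true].

Lemma pt_zip (A X Y : Type) {dA : data A} {dX : data X} {dY : data Y}
    (s : A -> seq X) (t : A -> seq Y) :
  PT s -> PT t -> PT (fun a => zip (s a) (t a)).
Proof.
move=> hs ht; have [S [pS mS] HS] := PT_size hs.
pose f (st : seq Y * seq (X * Y)) x :=
  if st.1 is y :: t' then (t', (x, y) :: st.2) else st.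
apply: (@pt_eq _ _ _ _ (fun a => rev (foldl f (t a, [::]) (s a)).2)).
  move=> a; suff H acc : (foldl f (t a, acc) (s a)).2 = catrev (zip (s a) (t a)) acc.
    by rewrite H -/(rev _) revK.
  elim: (s a) (t a) acc => [|x s' IH] [|y t'] acc //=.
    by elim: s' {IH}.
  exact: IH.
apply: pt_rev; apply: PT_snd.
apply: (pt_foldl (f := fun=> f) (G := fun n => S n + 2)); [|pt|pt|pt|].
  by apply: pt_seq_case; pt.
move=> a [[|y t'] acc] x hx; rewrite /f ?dsize_pair /= ?dsize_cons ?dsize_pair;
  have := HS a; lia.
Qed.
#[export] Hint Extern 1 (PT (fun _ => zip _ _)) => apply: pt_zip : pt.

Lemma pt_umove (A : Type) {dA : data A} (a : A -> option bool * option bool)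
  (tp : A -> utape) : PT a -> PT tp -> PT (fun x => umove (a x) (tp x)).
Proof.
move=> ha ht; apply: (pt_option_case (g := fun x d => if d then
  ((a x).1 :: (tp x).1, behead (tp x).2) else
  (behead (tp x).1, head None (tp x).1 :: (a x).1 :: behead (tp x).2))); [pt|pt|].
have ha' : PT (fun p : A * bool => a p.1) by apply: pt_comp ha; pt.
have ht' : PT (fun p : A * bool => tp p.1) by apply: pt_comp ht; pt.
by pt.
Qed.

Lemma dsize_sym (s : option bool) : dsize s <= 5.
Proof. by case: s => [[]|]. Qed.

Lemma dsize_behead (T : Type) {dT : data T} (s : seq T) : dsize (behead s) <= dsize s.
Proof. by case: s => //= x s; rewrite dsize_cons; lia. Qed.

Lemma dsize_umove a tp : dsize (umove a tp) <= dsize tp + 20.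
Proof.
case: a tp => [s d] [l r]; have hr : dsize (behead r) <= dsize r by apply: dsize_behead.
have hl : dsize (behead l) <= dsize l by apply: dsize_behead.
rewrite /umove /=; have := dsize_sym s; have := dsize_sym (head None l).
by case: d => [[]|] /=; rewrite !dsize_pair ?dsize_cons; lia.
Qed.

Lemma pt_lookup (A : Type) {dA : data A} (tb : A -> utable)
    (k : A -> nat * seq (option bool)) :
  PT tb -> PT k -> PT (fun a => lookup (tb a) (k a)).
Proof.
move=> ht hk; have [L [pL mL] HL] := PT_size ht.
apply: (pt_foldl (f := fun a o (e : uentry) => if e.1 == k a then Some e.2 else o)
  (G := fun n => L n + 2)); [|pt|pt|pt|].
  have hk' : PT (fun p : A * (option (nat * uact) * uentry) => k p.1).
    by apply: pt_comp hk; pt.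
  by pt.
move=> a o [e x] he; rewrite dsize_pair in he; case: ifP => _ /=.
  by rewrite dsize_some; have := HL a; lia.
by lia.
Qed.
#[export] Hint Extern 1 (PT (fun _ => lookup _ _)) => apply: pt_lookup : pt.

Lemma pt_ukey (A : Type) {dA : data A} (c : A -> uconf) :
  PT c -> PT (fun a => ukey (c a)).
Proof. by move=> hc; apply: pt_pair; pt. Qed.
#[export] Hint Extern 1 (PT (fun _ => ukey _)) => apply: pt_ukey : pt.

Lemma pt_ustep (A : Type) {dA : data A} (tb : A -> utable) (c : A -> uconf) :
  PT tb -> PT c -> PT (fun a => ustep (tb a) (c a)).
Proof.
move=> ht hc; apply: (pt_option_case (g := fun a x => uapply x (c a).2)); [pt|pt|].
have hc' : PT (fun p : A * (nat * uact) => c p.1) by apply: pt_comp hc; pt.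
by apply: pt_pair; [pt|]; apply: pt_map; [apply: pt_umove; pt|pt].
Qed.

Lemma dsize_lookup tb k x : lookup tb k = Some x -> dsize x <= dsize tb.
Proof.
rewrite /lookup; set f := fun o e => _.
have H o : foldl f o tb = Some x -> o = Some x \/ dsize x <= dsize tb; last by case/H.
elim: tb o => [|e tb IH] o /=; first by left.
rewrite dsize_cons; case/IH => [|h]; last by right; lia.
rewrite /f; case: ifP => _ E; [right|by left].
by case: E => <-; case: e {IH} => e1 e2; rewrite dsize_pair /=; lia.
Qed.

Lemma dsize_umoves (x : uact) ts :
  dsize [seq umove p.1 p.2 | p <- zip x ts] <= dsize ts + 20 * size x.
Proof.
elim: x ts => [|a x IH] [|tp ts] //=; try by have := dsize_gt0 (@nil utape); rewrite ?dsize_nil ?dsize_cons; lia.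
by rewrite !dsize_cons; have := IH ts; have := dsize_umove a tp; lia.
Qed.

Lemma dsize_ustep tb c : dsize (ustep tb c) <= dsize c + 21 * dsize tb.
Proof.
rewrite /ustep; case E: lookup => [[q x]|]; last by lia.
have := dsize_lookup E; rewrite /uapply; case: c {E} => q0 ts.
rewrite !dsize_pair /=.
have hx : size x <= dsize x by apply: size_le_dsize.
by have := dsize_umoves x ts; lia.
Qed.

Lemma pt_after_true (A : Type) {dA : data A} (z : A -> seq bool) :
  PT z -> PT (fun a => after_true (z a)).
Proof.
move=> hz; apply: pt_rev; apply: PT_snd.
apply: (pt_foldl (f := fun _ st b => if st.1 then (true, b :: st.2) else (b, st.2))
  (G := fun=> 10)); [pt|pt|pt|pt|].
move=> a [f acc] b _; have := dsize_bool b; have : 0 < dsize f by apply: dsize_gt0.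
by case: f => /=; rewrite !dsize_pair ?dsize_cons; lia.
Qed.
#[export] Hint Extern 1 (PT (fun _ => after_true _)) => apply: pt_after_true : pt.

Lemma pt_ufinal (A : Type) {dA : data A} (i : A -> inst) (z : A -> seq bool) :
  PT i -> PT z -> PT (fun a => ufinal (i a) (z a)).
Proof.
move=> hi hz; have [I [pI mI] HI] := PT_size hi.
apply: (pt_iter_lin (step := fun a => ustep (i a).1) (G := fun n => 21 * I n));
  [pt| | |pt|].
- apply: pt_pair; [pt|]; apply: pt_cons; [|pt]; apply: pt_pair; [pt|].
  by apply: (pt_map (f := fun=> some)); pt.
- have hi' : PT (fun p : A * uconf => i p.1) by apply: pt_comp hi; pt.
  by apply: pt_ustep; pt.
- move=> a c; apply: leq_trans (dsize_ustep _ _) _; rewrite leq_add2l leq_mul2l.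
  by apply: leq_trans (HI a); case: (i a) => tb r; rewrite dsize_pair /=; lia.
Qed.
#[export] Hint Extern 1 (PT (fun _ => ufinal _ _)) => apply: pt_ufinal : pt.

Lemma pt_accepts (A : Type) {dA : data A} (i : A -> inst) (z : A -> seq bool) :
  PT i -> PT z -> PT (fun a => accepts (i a) (z a)).
Proof.
move=> hi hz; apply: pt_andb; [pt|]; apply: pt_andb; [pt|].
by pt.
Qed.

(** * The orders *)

(* Bijective binary numeration, least significant digit first. *)
Fixpoint incr (z : seq bool) : seq bool :=
  match z with
  | [::] => [:: false]
  | false :: z' => true :: z'
  | true :: z' => false :: incr z'
  end.

Definition string_of_nat (n : nat) : seq bool := iter n incr [::].

Lemma string_of_nat_surj z : exists n, string_of_nat n = z.
Proof.
elim: z => [|b z [n <-]]; first by exists 0.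
(* The digits [false] and [true] have the values 1 and 2, so prefixing them takes n to 2n+1 and
   2n+2. *)
have H : string_of_nat (n.*2.+1) = false :: string_of_nat n.
  by elim: n => // n IH; rewrite doubleS /string_of_nat 2!iterS -/(string_of_nat _) IH.
by case: b; [exists n.*2.+2; rewrite /string_of_nat iterS -/(string_of_nat _) H
            |exists n.*2.+1].
Qed.

Definition incr_step (s : bool * seq bool) (b : bool) : bool * seq bool :=
  if s.1 then (b, ~~ b :: s.2) else (false, b :: s.2).

Lemma incrE z : let s := foldl incr_step (true, [::]) z in
  incr z = if s.1 then rev (false :: s.2) else rev s.2.
Proof.
rewrite /=; set F := fun s : bool * seq bool => if s.1 then rev (false :: s.2) else rev s.2.
suff H acc : F (foldl incr_step (true, acc) z) = catrev acc (incr z) by rewrite -/(F _) H.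
have H0 z' acc' : foldl incr_step (false, acc') z' = (false, catrev z' acc').
  by elim: z' acc' => //= b z' IH acc'; rewrite IH.
elim: z acc => [|b z IH] acc; first by [].
case: b => /=; first by rewrite IH.
by rewrite /incr_step /= H0 /F /= !catrevE rev_cat revK rev_cons cat_rcons.
Qed.

Lemma dsize_incr z : dsize (incr z) <= dsize z + 2.
Proof.
elim: z => // b z IH; case: b; rewrite [incr _]/= !dsize_cons.
  by have -> : dsize false = 1 by []; have -> : dsize true = 3 by []; lia.
by have -> : dsize false = 1 by []; have -> : dsize true = 3 by []; lia.
Qed.

Lemma pt_incr (A : Type) {dA : data A} (z : A -> seq bool) :
  PT z -> PT (fun a => incr (z a)).
Proof.
move=> hz; pose F a := foldl incr_step (true, [::]) (z a).
apply: (@pt_eq _ _ _ _ (fun a => if (F a).1 then rev (false :: (F a).2) else rev (F a).2)).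
  by move=> a; rewrite incrE.
have hF : PT F.
  apply: (pt_foldl (f := fun=> incr_step) (G := fun=> 10)); [|pt|pt|pt|].
    by rewrite /incr_step; pt.
  move=> a [c acc] b _; rewrite /incr_step /=; have := dsize_bool b.
  have := dsize_bool (~~ b); have : 0 < dsize c by apply: dsize_gt0.
  by case: c; rewrite !dsize_pair ?dsize_cons /=; have : dsize false = 1 by []; lia.
by pt.
Qed.
#[export] Hint Extern 1 (PT (fun _ => incr _)) => apply: pt_incr : pt.

(* Instances are encoded as [false :: ser t]. Such a string ends with [false], so
   that [rev (map negb q)] starts with [true] and is accepted at once. *)
Definition check (q z : seq bool) : bool :=
  if q is b :: r then b || accepts (decode (parse r)) z else true.

Lemma pt_check (A : Type) {dA : data A} (q z : A -> seq bool) :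
  PT q -> PT z -> PT (fun a => check (q a) (z a)).
Proof.
move=> hq hz; apply: (pt_seq_case (g := fun a b r => b || accepts (decode (parse r)) (z a)));
  [pt|pt|].
have hz' : PT (fun p : A * (bool * seq bool) => z p.1) by apply: pt_comp hz; pt.
apply: pt_orb; [pt|]; apply: pt_accepts; [|pt].
by apply: pt_comp pt_decode; apply: pt_parse; pt.
Qed.

Definition accepted (q : seq bool) : Prop := exists n, check q (string_of_nat n).

(** The case distinction is classical, by [pselect], and [ord] itself is never evaluated by a
    machine; only divisibility by it is. *)
Definition ord (q : seq bool) : nat :=
  if pselect (accepted q) is left ex then 3 ^ (ex_minn ex).+1 else 0.

Lemma ord_gt2 q : ord q = 0 \/ 2 < ord q.
Proof.
rewrite /ord; case: pselect => [ex|_]; [right|by left].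
by rewrite expnS (leq_trans (_ : _ <= 3 * 1)) // leq_mul2l expn_gt0.
Qed.

Lemma odd_ord q : accepted q -> odd (ord q).
Proof. by rewrite /ord; case: pselect => // ex _; rewrite oddX. Qed.

Lemma ord_not_accepted q : ~ accepted q -> ord q = 0.
Proof. by rewrite /ord; case: pselect. Qed.

(** Any accepted number can replace the least one, since the power of 3 of the least divides that of
    the other. Conversely a divisor of [e > 0] is at most [e], so its exponent lies in the range
    searched. *)
Lemma ord_dvdn q e : 0 < e ->
  (ord q %| e) = has (fun n => check q (string_of_nat n) && (3 ^ n.+1 %| e)) (iota 0 e).
Proof.
move=> e0; apply/idP/hasP => [|[n _ /andP[hn d]]].
  rewrite /ord; case: pselect => [ex|_]; last by rewrite dvd0n => /eqP E; rewrite E in e0.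
  case: ex_minnP => n hn _ d; exists n; last by rewrite hn.
  rewrite mem_iota /= add0n; apply: leq_trans (dvdn_leq e0 d).
  by apply: leq_trans (ltn_expl n (isT : 1 < 3)) _; rewrite leq_exp2l.
rewrite /ord; case: pselect => [ex|[]]; last by exists n.
by case: ex_minnP => m hm /(_ n hn) le; apply: dvdn_trans d; apply: dvdn_exp2l.
Qed.

(** After n steps the first component is e / 3^n, so no power of 3 is ever formed. A further
    certificate is tried only while 3 divides the quotient, which keeps their number logarithmic;
    the quotient 0 marks the end. *)
Definition ord_step (q : seq bool) (s : nat * (seq bool * bool)) :
    nat * (seq bool * bool) :=
  if (s.1 != 0) && (s.1 %% 3 == 0) then
    (s.1 %/ 3, (incr s.2.1, s.2.2 || check q s.2.1))
  else (0, s.2).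

Lemma iter_ord_step q k e n f :
  (iter k (ord_step q) (e, (string_of_nat n, f))).2.2 =
  f || (e != 0) && has (fun j => check q (string_of_nat (n + j)) && (3 ^ j.+1 %| e)) (iota 0 k).
Proof.
elim: k e n f => [|k IH] e n f; first by rewrite andbF orbF.
rewrite iterSr {2}/ord_step /=; case: ifP => [/andP[e0 /eqP e3]|h].
  have d3 : 3 %| e by apply/eqP.
  have -> : incr (string_of_nat n) = string_of_nat n.+1 by [].
  rewrite IH e0 -orbA; congr (_ || _).
  have -> : e %/ 3 != 0 by rewrite -lt0n divn_gt0 // dvdn_leq // lt0n.
  rewrite addn0 expn1 d3 andbT /=; congr (_ || _).
  rewrite -[1]/(1 + 0) iotaDl has_map; apply: eq_has => j /=.
  rewrite addnS addSn add1n; congr (_ && _).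
  by rewrite [in RHS]expnS mulnC dvdn_divRL.
have -> : iter k (ord_step q) (0, (string_of_nat n, f)) = (0, (string_of_nat n, f)).
  by elim: k {IH} => //= k ->.
case e0: (e == 0); first by rewrite orbF.
have nd j : (3 ^ j.+1 %| e) = false.
  apply/negP => d; move: h; rewrite e0 /= -/(3 %| e) (dvdn_trans _ d) //.
  by rewrite expnS dvdn_mulr.
rewrite nd andbF (@eq_has _ _ pred0) ?has_pred0 ?orbF // => j.
by rewrite nd andbF.
Qed.

Lemma pt_ord_dvdn (A : Type) {dA : data A} (q : A -> seq bool) (e : A -> nat) :
  PT q -> PT e -> PT (fun a => ord (q a) %| e a).
Proof.
move=> hq he; pose F a := iter (e a) (ord_step (q a)) (e a, ([::], false)).
apply: (@pt_eq _ _ _ _ (fun a => (e a == 0) || (F a).2.2)).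
  move=> a; have [->|e0] := eqVneq (e a) 0; first by rewrite dvdn0.
  by rewrite /F -[[::]]/(string_of_nat 0) iter_ord_step e0 ord_dvdn // lt0n.
have hF : PT F.
  apply: (pt_iter_lin (step := fun a => ord_step (q a)) (G := fun=> 10)); [pt|pt| |pt|].
    have hq' : PT (fun p : A * (nat * (seq bool * bool)) => q p.1) by apply: pt_comp hq; pt.
    have hc : PT (fun p : A * (nat * (seq bool * bool)) => check (q p.1) p.2.2.1).
      by apply: pt_check; pt.
    by rewrite /ord_step; pt.
  move=> a [m [z f]]; rewrite /ord_step /=; case: ifP => _; rewrite !dsize_pair !dsize_nat /=.
    have := dsize_incr z; have := dsize_bool (f || check (q a) z); have := leq_div m 3.
    have : 0 < dsize f by apply: dsize_gt0.
    by lia.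
  by lia.
by pt.
Qed.

(** * The length of a word bounds the size of its encoding *)

Section Lengths.
Local Open Scope R_scope.

Lemma ln_mono_le x y : 0 < x -> x <= y -> ln x <= ln y.
Proof.
move=> x0 [lt|->]; last exact: Rle_refl.
by apply: Rlt_le; apply: ln_increasing.
Qed.

Lemma ln_3_2 : / 4 < ln (3 / 2).
Proof.
have h : ln 2 <= ln (3 / 2 * (3 / 2)) by apply: ln_mono_le; lra.
rewrite ln_mult in h; [|lra|lra]; have := ln_lt_2; lra.
Qed.

Lemma size_positive_bits p :
  INR (size (positive_bits p)) <= 4 * ln (IZR (Zpos p) + 1).
Proof.
(* One more bit raises the value y >= 1 to at least 2y, and 2y + 1 >= (3/2)(y + 1), so the right
   side grows by at least 4 ln (3/2) > 1. *)
have step q x : INR (size (positive_bits q)) <= 4 * ln (IZR (Zpos q) + 1) ->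
    2 * IZR (Zpos q) <= x -> INR (size (positive_bits q)).+1 <= 4 * ln (x + 1).
  rewrite S_INR; have : 1 <= IZR (Zpos q) by apply: IZR_le; lia.
  move: (IZR (Zpos q)) => y y1 IH hx.
  have : ln ((y + 1) * (3 / 2)) <= ln (x + 1) by apply: ln_mono_le; lra.
  by rewrite ln_mult; [|lra|lra]; have := ln_3_2; lra.
elim: p => [q IH|q IH|] /=.
- by apply: step => //; rewrite (Pos2Z.inj_xI q) plus_IZR mult_IZR; lra.
- by apply: step => //; rewrite (Pos2Z.inj_xO q) mult_IZR; apply: Rle_refl.
- have := ln_lt_2; have -> : 1 + 1 = 2 by lra. lra.
Qed.

Lemma size_encode_string l : size (encode_string l) = (2 * size l).+1.
Proof.
rewrite /encode_string /encode_seq size_cat /= addn1.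
by elim: l => //= b l [IH]; rewrite IH; lia.
Qed.

Lemma ln_ge0 (k : Z) : 0 <= ln (IZR (Z.abs k) + 1).
Proof.
rewrite -ln_1; apply: ln_mono_le; first lra.
by have := IZR_le 0 (Z.abs k) (Z.abs_nonneg k); lra.
Qed.

Lemma size_encode_Z k :
  INR (size (encode_Z k)) <= 8 * ln (IZR (Z.abs k) + 1) + 2.
Proof.
have := ln_ge0 k; case: k => [|p|p] /=; rewrite ?size_encode_string;
  first by rewrite /=; lra.
all: rewrite !S_INR mult_INR /=; have := size_positive_bits p; lra.
Qed.

(** For a, b >= 1 one has (a+1)(b+1) <= (ab+1)^2, so the two logarithms cost 16 ln (ab+1). The
    remaining constant 5 is at most 10 ln (ab+1), because ln 2 > 1/2; together 26. *)
Lemma size_encode_syllable l k : l <> Z0 -> k <> Z0 ->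
  INR (size (encode_Z l) + size (encode_Z k)).+1 <=
  26 * ln (IZR (Z.abs (k * l)) + 1).
Proof.
move=> l0 k0; have hl := size_encode_Z l; have hk := size_encode_Z k.
rewrite S_INR plus_INR; rewrite Z.abs_mul mult_IZR.
move: hl hk; set a := IZR (Z.abs l); set b := IZR (Z.abs k) => hl hk.
have a1 : 1 <= a by apply: IZR_le; lia.
have b1 : 1 <= b by apply: IZR_le; lia.
have ab : 1 <= b * a by nra.
have h : ln ((a + 1) * (b + 1)) <= ln ((b * a + 1) * (b * a + 1)).
  by apply: ln_mono_le; nra.
rewrite !ln_mult in h; try nra.
have h2 : ln 2 <= ln (b * a + 1) by apply: ln_mono_le; lra.
by have := ln_lt_2; lra.
Qed.

Lemma word_length_ge0 w : 0 <= word_length w.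
Proof.
rewrite /word_length; have := ln_ge0 (w_head w); have := ln_ge0 (w_last w).
suff : 0 <= foldr (fun p r => ln (IZR (Z.abs (p.2 * p.1)) + 1) + r) 0 (w_mid w) by lra.
elim: (w_mid w) => [|p m IH] /=; first exact: Rle_refl.
by have := ln_ge0 (p.2 * p.1)%Z; lra.
Qed.

Lemma size_encode_word w :
  INR (size (encode_word w)) <= 26 * word_length w + 5.
Proof.
rewrite /encode_word 2!size_cat /word_length /encode_seq size_cat !plus_INR /=.
have := size_encode_Z (w_head w); have := size_encode_Z (w_last w).
have := ln_ge0 (w_head w); have := ln_ge0 (w_last w).
suff : INR (size (flatten [seq true :: encode_Z a.1 ++ encode_Z a.2 | a <- w_mid w]))
  <= 26 * foldr (fun p r => ln (IZR (Z.abs (p.2 * p.1)) + 1) + r) 0 (w_mid w) by lra.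
elim: (w_mid w) (w_midP w) => [|[l k] m IH]; first by move=> _ /=; lra.
move=> /andP[/andP[nl nk] /IH {}IH].
have -> : size (flatten [seq true :: encode_Z a.1 ++ encode_Z a.2 | a <- (l, k) :: m])
  = ((size (encode_Z l) + size (encode_Z k)).+1 +
     size (flatten [seq true :: encode_Z a.1 ++ encode_Z a.2 | a <- m]))%N.
  by rewrite -[flatten _]/((true :: encode_Z l ++ encode_Z k) ++ _) size_cat /= size_cat.
rewrite plus_INR [foldr _ _ _]/=.
have hl : l <> Z0 by move=> E; rewrite E in nl.
have hk : k <> Z0 by move=> E; rewrite E in nk.
by have := size_encode_syllable hl hk; lra.
Qed.

Lemma INR_expn m d : INR (m ^ d)%N = INR m ^ d.
Proof. by elim: d => //= d IH; rewrite expnS mult_INR IH. Qed.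

Lemma pow_le_max (x : R) d : 0 <= x -> (x + 1) ^ d <= 2 ^ d * (x ^ d + 1).
Proof.
move=> x0; have [x1|x1] := Rle_lt_dec x 1.
  have : (x + 1) ^ d <= 2 ^ d by apply: pow_incr; lra.
  have : 0 <= x ^ d by apply: pow_le.
  have : 0 <= 2 ^ d by apply: pow_le; lra.
  by nra.
have : (x + 1) ^ d <= (2 * x) ^ d by apply: pow_incr; lra.
rewrite Rpow_mult_distr; have : 0 <= 2 ^ d by apply: pow_le; lra.
by lra.
Qed.

(** The constant is 62 = 31 * 2: 26 l + 5 <= 31 (l + 1), and (l + 1)^d <= 2^d (l^d + 1). *)
Lemma poly_of_length (c d n : nat) (l : R) : 0 <= l -> INR n <= 26 * l + 5 ->
  INR (c * n ^ d + c)%N <=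
  INR (c * 62 ^ d + c)%N * l ^ d + INR (c * 62 ^ d + c)%N.
Proof.
move=> l0 hn; rewrite !plus_INR !mult_INR !INR_expn.
have -> : INR 62 = 31 * 2 by rewrite INR_IZR_INZ /=; lra.
have h1 : INR n ^ d <= (31 * (l + 1)) ^ d.
  by apply: pow_incr; split; [exact: pos_INR | lra].
have h2 := pow_le_max d l0; rewrite Rpow_mult_distr in h1.
rewrite Rpow_mult_distr; set C := INR c; have C0 : 0 <= C by apply: pos_INR.
have p31 : 0 <= 31 ^ d by apply: pow_le; lra.
have p2 : 0 <= 2 ^ d by apply: pow_le; lra.
have pl : 0 <= l ^ d by apply: pow_le.
have h3 : INR n ^ d <= 31 ^ d * (2 ^ d * (l ^ d + 1)).
  by apply: Rle_trans h1 _; apply: Rmult_le_compat_l.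
have h4 : C * INR n ^ d <= C * (31 ^ d * (2 ^ d * (l ^ d + 1))).
  exact: Rmult_le_compat_l.
have : 0 <= C * l ^ d by apply: Rmult_le_pos.
by nra.
Qed.
End Lengths.

From mathcomp Require Import all_order all_algebra ring.
Import Order.TTheory GRing.Theory Num.Theory.

(** * The moving point *)

Notation point := (bool * seq bool)%type (only parsing).

(* [None] is the lamp, [sigma] and [tau] move the point. *)
Notation letter := (option bool) (only parsing).
Notation lamp := None (only parsing).
Notation sigma := (Some true) (only parsing).
Notation tau := (Some false) (only parsing).

(** This is the tree of Z/2 * Z/3 seen from [base]. The points [(true, e)], [(false, false :: e)]
    and [(false, true :: e)] form a 3-cycle of [tau], entered at the first; [sigma] leads from an
    exit to the entrance of the next cycle. The only fixed point of [tau] is [base]. *)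
Definition mv1 (c : letter) (p : point) : point :=
  match c with
  | lamp => p
  | sigma => (~~ p.1, p.2)
  | tau => if p.1 then (false, false :: p.2)
           else if p.2 is b :: e then (if b then (true, e) else (false, true :: e))
           else p
  end.

Definition base : point := (false, [::]).

(* Two points have the same label iff they are in the same orbit of [tau];
   only [base] has the label [None]. *)
Definition label (p : point) : option (seq bool) :=
  if p.1 then Some p.2 else if p.2 is _ :: e then Some e else None.

Definition mv (w : seq letter) (p : point) : point := foldl (fun p c => mv1 c p) p w.

Lemma mv_cat w w' p : mv (w ++ w') p = mv w' (mv w p).
Proof. exact: foldl_cat. Qed.

Lemma mv_rcons w c p : mv (rcons w c) p = mv1 c (mv w p).
Proof. exact: foldl_rcons. Qed.

Lemma mv_sigmaK p : mv1 sigma (mv1 sigma p) = p.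
Proof. by case: p => f e /=; rewrite negbK. Qed.

Lemma mv_tauK p : mv1 tau (mv1 tau (mv1 tau p)) = p.
Proof. by case: p => -[] [|[] e]. Qed.

Lemma label_tau p : label (mv1 tau p) = label p.
Proof. by case: p => -[] [|[] e]. Qed.

Lemma label_base p : (label p == None) = (p == base).
Proof. by case: p => -[] [|b e]. Qed.

Definition linv (c : letter) : seq letter :=
  if c is tau then [:: tau; tau] else [:: c].

Definition winv (w : seq letter) : seq letter := flatten (rev (map linv w)).

Lemma winv_cons c w : winv (c :: w) = winv w ++ linv c.
Proof. by rewrite /winv /= rev_cons -cats1 flatten_cat /= cats0. Qed.

Lemma mv_linvK c p : mv (linv c) (mv1 c p) = p.
Proof. by case: c => [[]|]; [exact: mv_sigmaK|exact: mv_tauK|]. Qed.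

Lemma mv_linvVK c p : mv1 c (mv (linv c) p) = p.
Proof. by case: c => [[]|]; [exact: mv_sigmaK|exact: mv_tauK|]. Qed.

Lemma mv_winvK w p : mv (winv w) (mv w p) = p.
Proof.
by elim: w p => //= c w IH p; rewrite winv_cons mv_cat IH mv_linvK.
Qed.

Lemma mv_winvVK w p : mv w (mv (winv w) p) = p.
Proof.
by elim: w p => //= c w IH p; rewrite winv_cons mv_cat /= mv_linvVK IH.
Qed.

Fixpoint path_to (e : seq bool) : seq letter :=
  if e is b :: e' then path_to e' ++ nseq b.+1 tau ++ [:: sigma] else [:: sigma].

Definition path_pt (p : point) : seq letter :=
  if p.1 then path_to p.2
  else if p.2 is b :: e then path_to e ++ nseq b.+1 tau else [::].

Lemma path_to_sigma e : path_to e = path_pt (false, e) ++ [:: sigma].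
Proof. by case: e => //= b e; rewrite -catA. Qed.

(** The canonical words multiply as the points move, as permutations of all points [u]. The excluded
    case is [tau] at [base], where the point stays but the permutation changes. *)
Lemma path_step c p u : (c != tau) || (p != base) ->
  mv1 c (mv (path_pt p) u) = mv (path_pt (mv1 c p)) u.
Proof.
have pathT e : path_pt (true, e) = path_pt (false, e) ++ [:: sigma].
  exact: path_to_sigma.
have pathF b e : path_pt (false, b :: e) = path_pt (true, e) ++ nseq b.+1 tau.
  by [].
case: c p => [[]|] [[] e] // h.
- by rewrite [mv1 sigma (_, _)]/= pathT mv_cat; apply: mv_sigmaK.
- by rewrite [mv1 sigma (_, _)]/= pathT mv_cat.
- by rewrite [mv1 tau (_, _)]/= pathF mv_cat.
case: e h => [|[] e] // _.
- by rewrite [mv1 tau (_, _)]/= pathF mv_cat; apply: mv_tauK.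
- by rewrite [mv1 tau (_, _)]/= !pathF !mv_cat.
Qed.

Lemma mv_nseq_tau i p : mv (nseq i tau) p = iter i (mv1 tau) p.
Proof. by elim: i p => //= i IH p; rewrite IH -iterSr. Qed.

(** This says that the points are the cosets of the subgroup generated by [tau]: up to a power of
    [tau] in front, a word acts as the canonical path to its image of [base]. *)
Lemma mv_canonical w : exists i,
  mv w =1 mv (nseq i tau ++ path_pt (mv w base)).
Proof.
elim/last_ind: w => [|w c [i IH]]; first by exists 0.
have [/andP[/eqP-> /eqP Eb]|h] := boolP ((c == tau) && (mv w base == base)).
  exists i.+1 => u; rewrite !mv_rcons IH Eb [path_pt base]/=.
  by rewrite ?cats0 !mv_nseq_tau.
exists i => u; rewrite !mv_rcons IH !mv_cat path_step //.
by rewrite -negb_and.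
Qed.

Lemma mv_stab_base w : mv w base = base ->
  exists i, mv w =1 iter i (mv1 tau).
Proof.
have [i H] := mv_canonical w => Eb; exists i => u.
by rewrite H Eb cats0 mv_nseq_tau.
Qed.

Lemma label_iter_tau i p : label (iter i (mv1 tau) p) = label p.
Proof. by elim: i => //= i IH; rewrite label_tau. Qed.

(** Fixing [base] leaves only a power of [tau], and [(true, [::])] lies in a genuine 3-cycle of
    [tau]. Hence two points suffice to test the action on all of them. *)
Lemma mv_trivial w : mv w base = base -> mv w (true, [::]) = (true, [::]) ->
  mv w =1 id.
Proof.
move=> /mv_stab_base[i Hi]; rewrite Hi => E u; rewrite Hi.
have H3 k v : iter (k * 3) (mv1 tau) v = v.
  by elim: k => // k IH; rewrite mulSn iterD IH; apply: mv_tauK.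
move: E; rewrite (divn_eq i 3) iterD !H3 addnC iterD H3.
by case: (i %% 3) (ltn_pmod i (isT : 0 < 3)) => [|[|[]]].
Qed.

(** * Reflections of Z/m *)

Section Kicks.
Local Open Scope ring_scope.
Local Open Scope int_scope.

(* A reflection of the residues modulo [m], or of Z if [m = 0]; integers that are
   not reduced modulo [m] are fixed. *)
Definition kick (m : nat) (k : bool) (n : int) : int :=
  if n == (n %% m)%Z then ((k%:Z - n) %% m)%Z else n.

Lemma kickK m k : involutive (kick m k).
Proof.
move=> n; rewrite {2}/kick; case: ifP => [/eqP E|h]; last by rewrite /kick h.
rewrite /kick modz_mod eqxx -modzDmr modzNm modzDmr.
by rewrite opprB addrCA subrr addr0 -E.
Qed.

Definition kicks (m : nat) (D : seq bool) (n : int) : int :=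
  foldl (fun n k => kick m k n) n D.

(* The composition of the reflections [D] is [n -> (-1) ^ size D * n + t], and
   [dih D] is the parity of [size D] together with [t], as a difference. *)
Definition dih_step (s : bool * (nat * nat)) (k : bool) : bool * (nat * nat) :=
  (~~ s.1, (s.2.2 + k, s.2.1)%N).

Definition dih (D : seq bool) : bool * (nat * nat) :=
  foldl dih_step (false, (0%N, 0%N)) D.

Definition distn (p : nat * nat) : nat := (p.1 - p.2 + (p.2 - p.1))%N.

Lemma dih_odd D : (dih D).1 = odd (size D).
Proof.
by elim/last_ind: D => // D k IH; rewrite /dih foldl_rcons size_rcons /= -IH.
Qed.

Lemma kicks_canon (m : nat) D (n : int) : n = (n %% m)%Z ->
  kicks m D n = (((-1) ^+ size D * n + ((dih D).2.1%:Z - (dih D).2.2%:Z)) %% m)%Z.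
Proof.
move=> En; elim/last_ind: D => [|D k IH] /=.
  by rewrite /kicks /= mul1r subrr addr0.
rewrite /kicks foldl_rcons -/(kicks m D n) IH /kick modz_mod eqxx.
rewrite -modzDmr modzNm modzDmr /dih foldl_rcons -/(dih D) size_rcons exprS.
case: (dih D) => _ [P N] /=; congr (_ %% _)%Z; rewrite PoszD; ring.
Qed.

Lemma kicks_noncanon (m : nat) D (n : int) : n <> (n %% m)%Z -> kicks m D n = n.
Proof.
by move=> /eqP/negbTE h; elim: D => //= k D IH; rewrite /kicks /= /kick h -/(kicks m D n).
Qed.

Lemma distnE p : distn p = `|p.1%:Z - p.2%:Z|%N.
Proof. rewrite /distn; lia. Qed.

(** The composition is n -> +-n + t. Its value at 0 forces m to divide t; with sign -1 its value at
    1 would then force m to divide 2. *)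
Lemma kicks_id (m : nat) D : (m = 0 \/ 2 < m)%N ->
  (forall n, kicks m D n = n) <-> ~~ odd (size D) /\ (m %| distn (dih D).2)%N.
Proof.
move=> hm; have -> : (m %| distn (dih D).2)%N =
    (m %| (dih D).2.1%:Z - (dih D).2.2%:Z)%Z.
  by rewrite distnE /dvdz.
set t := _ - _; split=> [H|[ev /dvdzP[q E]] n].
  have h0 : ((t %% m)%Z = 0).
    by have := H 0; rewrite kicks_canon ?mod0z // mulr0 add0r.
  split; last by apply/dvdz_mod0P.
  apply/negP => od; have E1 : (1 = (1 %% m)%Z).
    by case: hm => [->|hm]; [rewrite modz0 | rewrite modz_small //; lia].
  have := H 1; rewrite kicks_canon // -signr_odd od -/t -modzDmr h0 addr0 mulr1 => E.
  have : (m %| 2)%Z.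
    have -> : 2 = 1 - -1 :> int by [].
    by rewrite -eqz_mod_dvd -E1 -[X in X == _]E expr1.
  case: hm => [->|hm]; first by rewrite dvd0z.
  by rewrite dvdzE => /dvdn_leq => /(_ isT) /= h; lia.
have [En|ne] := eqVneq n (n %% m)%Z; last by apply: kicks_noncanon; apply/eqP.
rewrite kicks_canon // -signr_odd (negbTE ev) mul1r -/t E.
by rewrite addrC modzMDl -En.
Qed.
End Kicks.

(** * The action and its kernel *)

Definition hit (oq : option (seq bool)) (p : point) : seq bool :=
  if label p == None then [:: false] else if label p == oq then [:: true] else [::].

Fixpoint hits (oq : option (seq bool)) (w : seq letter) (p : point) : seq bool :=
  if w is c :: w' then
    (if c is lamp then hit oq p else [::]) ++ hits oq w' (mv1 c p)
  else [::].

Definition state : Type := (point * (seq bool * int))%type.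

Section Action.
(* [ord q] is the order of the rotation attached to [q], [0] meaning infinite. *)
Variable ord : seq bool -> nat.

Definition step (c : letter) (s : state) : state :=
  (mv1 c s.1, (s.2.1,
     if c is lamp then kicks (ord s.2.1) (hit (Some s.2.1) s.1) s.2.2 else s.2.2)).

Definition act (w : seq letter) (s : state) : state := foldl (fun s c => step c s) s w.

Lemma act_cat w w' s : act (w ++ w') s = act w' (act w s).
Proof. exact: foldl_cat. Qed.

Lemma actE w p q n :
  act w (p, (q, n)) = (mv w p, (q, kicks (ord q) (hits (Some q) w p) n)).
Proof.
elim: w p n => //= c w IH p n; rewrite IH /=; congr (_, (_, _)).
by rewrite /kicks foldl_cat; case: c.
Qed.

Lemma act_lampK : act [:: lamp; lamp] =1 id.
Proof.
case=> p [q n]; rewrite /act /= /step /=; congr (_, (_, _)).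
by rewrite /hit; do 2?case: ifP => _ //=; rewrite /kicks /= kickK.
Qed.

Lemma act_sigmaK : act [:: sigma; sigma] =1 id.
Proof. by case=> p [q n]; rewrite /act [foldl _ _ _]/= /step [RHS]/= mv_sigmaK. Qed.

Lemma act_tauK : act [:: tau; tau; tau] =1 id.
Proof. by case=> p [q n]; rewrite /act [foldl _ _ _]/= /step; rewrite mv_tauK. Qed.

(** A reflection depends on the point only through its label, which is constant on orbits of [tau].
    The commutation lets [gy] split into its two factors. *)
Lemma act_lamp_tau : act [:: lamp; tau] =1 act [:: tau; lamp].
Proof.
case=> p [q n]; rewrite !actE /=; congr (_, (_, kicks _ _ _)).
by rewrite /hit (label_tau p).
Qed.

Lemma act_winvK w s : act (winv w) (act w s) = s.
Proof.
elim: w s => // c w IH s; rewrite winv_cons -cat1s !act_cat IH -act_cat.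
by case: c => [[]|]; [exact: act_sigmaK|exact: act_tauK|exact: act_lampK].
Qed.

Lemma act_winvVK w s : act w (act (winv w) s) = s.
Proof.
elim: w s => // c w IH s; rewrite winv_cons -cat1s !act_cat -[act [:: c] _]act_cat.
rewrite act_cat.
have -> x : act [:: c] (act (linv c) x) = x.
  rewrite -act_cat.
  by case: c => [[]|]; [exact: act_sigmaK|exact: act_tauK|exact: act_lampK].
exact: IH.
Qed.

Hypothesis ord_gt2 : forall q, ord q = 0 \/ 2 < ord q.

(** * A finite test for acting trivially *)

Definition divides_ord (oq : option (seq bool)) (e : nat) : bool :=
  if oq is Some q then ord q %| e else true.

(* Whether [hits oq w p] acts trivially on the residues attached to [oq]; [None]
   stands for any string that is not a label of the trajectory of [p]. *)
Definition test (w : seq letter) (p : point) (oq : option (seq bool)) : bool :=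
  let d := dih (hits oq w p) in ~~ d.1 && divides_ord oq (distn d.2).

Definition visits (w : seq letter) (p : point) : bool :=
  (foldl (fun s c => (mv1 c s.1, s.2 && test w p (label s.1))) (p, true) w).2.

Fixpoint all_tails (P : pred (seq letter)) (w : seq letter) : bool :=
  P w && (if w is _ :: w' then all_tails P w' else true).

Definition decide (w : seq letter) : bool :=
  [&& mv w base == base, mv w (true, [::]) == (true, [::]) &
      all_tails (fun t => visits w (mv t base)) w].

Lemma all_tailsP (P : pred (seq letter)) w :
  reflect (forall w1 w2, w = w1 ++ w2 -> P w2) (all_tails P w).
Proof.
elim: w => [|c w IH] /=.
  by rewrite andbT; apply: (iffP idP) => [h [|//] w2 /= <- //|/(_ [::] [::])->].
apply: (iffP andP) => [[h /IH H] [|c' w1] w2 /=|H].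
- by move<-.
- by case=> _ /H.
split; first exact: (H [::]).
by apply/IH => w1 w2 E; apply: (H (c :: w1)); rewrite E.
Qed.

Lemma visitsP w p :
  reflect (forall w1 c w2, w = w1 ++ c :: w2 -> test w p (label (mv w1 p)))
          (visits w p).
Proof.
rewrite /visits; set f := fun s c => _.
suff H v x (b : bool) : reflect (b /\ forall w1 c w2, v = w1 ++ c :: w2 ->
    test w p (label (mv w1 x))) (foldl f (x, b) v).2.
  by apply: (iffP (H w p true)) => [[]|].
elim: v x b => [|c v IH] x b /=.
  by apply: (iffP idP) => [h|[h _]] //; split=> // -[].
apply: (iffP (IH _ _)) => [[/andP[/= hb h] H]|[/= hb H]]; split=> //.
- by case=> [|c' w1] c'' w2 // [<- E]; apply: H E.
- by rewrite hb; apply: (H [::] c v).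
- by move=> w1 c' w2 E; apply: (H (c :: w1) c' w2); rewrite E.
Qed.

Lemma testP w p q : test w p (Some q) <->
  forall n, kicks (ord q) (hits (Some q) w p) n = n.
Proof.
rewrite kicks_id // -dih_odd /test; split=> [/andP[]//|[??]]; exact/andP.
Qed.

Lemma hits_None w p : hits None w p = nseq (size (hits None w p)) false.
Proof.
elim: w p => //= c w IH p; case: c => [d|]; first exact: IH.
by rewrite /hit; case: eqP => //= _; congr cons; apply: IH.
Qed.

Lemma hits_unvisited q w p :
  (forall w1 c w2, w = w1 ++ c :: w2 -> label (mv w1 p) <> Some q) ->
  hits (Some q) w p = hits None w p.
Proof.
elim: w p => //= c w IH p H; congr (_ ++ _).
  rewrite /hit; case: eqP => // _; case: eqP => [E|_]; last by case: c {H}.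
  by case: (H [::] c w).
by apply: IH => w1 c' w2 E; apply: (H (c :: w1) c' w2); rewrite E.
Qed.

Lemma visited_dec q w p :
  (exists w1 c w2, w = w1 ++ c :: w2 /\ label (mv w1 p) = Some q) \/
  (forall w1 c w2, w = w1 ++ c :: w2 -> label (mv w1 p) <> Some q).
Proof.
elim: w p => [|c w IH] p; first by right=> -[].
have [E|ne] := eqVneq (label p) (Some q).
  by left; exists [::], c, w.
case: (IH (mv1 c p)) => [[w1 [c' [w2 [E h]]]]|H].
  by left; exists (c :: w1), c', w2; rewrite E.
right=> -[|c1 w1] c' w2; first by move=> _; apply/eqP.
by case=> <- E; apply: H E.
Qed.

(** A trajectory meets finitely many labels, so any string longer than all of them is avoided. *)
Lemma exists_unvisited w p :
  exists q, forall w1 c w2, w = w1 ++ c :: w2 -> label (mv w1 p) <> Some q.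
Proof.
suff [k H] : exists k, forall w1 c w2, w = w1 ++ c :: w2 ->
    forall q, label (mv w1 p) = Some q -> size q < k.
  exists (nseq k true) => w1 c w2 E Eq.
  by have := H _ _ _ E _ Eq; rewrite size_nseq ltnn.
elim: w p => [|c w IH] p; first by exists 0 => -[].
have [k H] := IH (mv1 c p).
exists (maxn k (size (odflt [::] (label p))).+1) => -[|c1 w1] c' w2.
  by move=> _ q h; rewrite leq_max h /= ltnS leqnn orbT.
case=> <- E q h; by rewrite leq_max (H _ _ _ E _ h).
Qed.

Lemma test_None w p : test w p None = ~~ odd (size (hits None w p)).
Proof. by rewrite /test dih_odd andbT. Qed.

Lemma decide_complete w : (forall s, act w s = s) -> decide w.
Proof.
move=> H; have Hm p : mv w p = p by have := H (p, ([::], 0%R)); rewrite actE => -[].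
have Hk p q n : kicks (ord q) (hits (Some q) w p) n = n.
  by have := H (p, (q, n)); rewrite actE => -[].
rewrite /decide !Hm !eqxx /=; apply/all_tailsP => w1 t _; apply/visitsP => v1 c v2 _.
case: (label _) => [q|]; first exact/testP.
(* The test for [None] is read off the action on an actual string that the trajectory misses. *)
have [q Hq] := exists_unvisited w (mv t base).
rewrite test_None -(hits_unvisited Hq).
by have [] := (kicks_id (hits (Some q) w (mv t base)) (ord_gt2 q)).1 (Hk _ _).
Qed.

(* The positions of the lamps, as prefixes. *)
Fixpoint lamps (w : seq letter) : seq (seq letter) :=
  if w is c :: w' then
    (if c is lamp then [:: [::]] else [::]) ++ [seq c :: w1 | w1 <- lamps w']
  else [::].

Lemma lamps_split w w1 : w1 \in lamps w -> exists w2, w = w1 ++ lamp :: w2.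
Proof.
elim: w w1 => //= c w IH w1; rewrite mem_cat => /orP[].
  by case: c => // /[!inE]/eqP->; exists w.
by move=> /mapP[w1' /IH[w2 ->] ->]; exists w2.
Qed.

Lemma size_hits_None w p :
  size (hits None w p) = count (fun w1 => mv w1 p == base) (lamps w).
Proof.
elim: w p => //= c w IH p; rewrite size_cat count_cat count_map IH; congr (_ + _).
by case: c => //=; rewrite addn0 /hit label_base; case: eqP => //= /eqP; case: ifP.
Qed.

Lemma hits_no_base q w p :
  (forall w1 c w2, w = w1 ++ c :: w2 -> mv w1 p <> base) ->
  hits (Some q) w p = nseq (count (fun w1 => label (mv w1 p) == Some q) (lamps w)) true.
Proof.
elim: w p => //= c w IH p H; rewrite count_cat count_map nseqD; congr (_ ++ _).
  case: c H => //= H; rewrite addn0 /hit label_base; case: eqP => [E|_].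
    by case: (H [::] lamp w).
  by case: eqP.
by apply: IH => w1 c' w2 E; apply: (H (c :: w1) c' w2); rewrite E.
Qed.

(** [P] selects a union of fibres of [f], and every fibre that meets [s] has even size. The
    induction removes the whole fibre of the first element at once. *)
Lemma even_count (I T : eqType) (f : I -> T) (P : pred I) (s : seq I) :
  (forall i j, f i = f j -> P i = P j) ->
  {in s, forall i, ~~ odd (count (fun j => f j == f i) s)} ->
  ~~ odd (count P s).
Proof.
move=> HP; have [n] := ubnP (size s); elim: n s => // n IH [|i s] // hs H.
pose Q j := f j == f i; set s' := i :: s in H *.
have -> : count P s' = count P (filter (predC Q) s') + count (predI P Q) s'.
  rewrite count_filter; elim: s' {H} => //= j s' ->.
  by case: (P j) => //=; case: (Q j) => //=; lia.
rewrite oddD negb_add.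
have -> : odd (count (predI P Q) s') = false.
  case Pi: (P i).
    have -> : count (predI P Q) s' = count Q s'.
      apply: eq_count => j /=; rewrite /Q; case: eqP => [/HP|]; last by rewrite andbF.
      by rewrite Pi => ->.
    by apply/negbTE; apply: H; rewrite mem_head.
  rewrite (eq_count (a2 := pred0)) ?count_pred0 // => j /=; rewrite /Q.
  by case: eqP => [/HP|]; rewrite ?andbF // Pi => ->.
apply/eqP/negbTE; apply: IH.
  rewrite /= /Q eqxx /= ltnS in hs *; apply: leq_trans hs.
  by rewrite ltnS size_filter count_size.
move=> j; rewrite mem_filter => /andP[nj js].
rewrite count_filter (eq_count (a2 := fun k => f k == f j)); first exact: H.
move=> k /=; case: eqP => //= E; rewrite /Q E; exact: nj.
Qed.

(* A point whose trajectory visits [base] is its image under a suffix of [w] and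
   was tested. For the other points, only the parity of the visits to each label
   matters: the prefixes [w1] of [w] that carry [p] to a given label form a union
   of classes [mv w1 p' = base], and each class has even size, since [p'] was
   tested. *)
Lemma decide_sound w : decide w -> forall s, act w s = s.
Proof.
case/and3P => /eqP m0 /eqP m1 /all_tailsP Hv.
have Hm := mv_trivial m0 m1.
have Hbase w1 w2 p : w = w1 ++ w2 -> mv w1 p = base -> visits w p.
  move=> E Eb; have <- : mv w2 base = p by rewrite -Eb -mv_cat -E Hm.
  exact: (Hv w1).
have Heven w1 c w2 p : w = w1 ++ c :: w2 -> mv w1 p = base ->
    ~~ odd (size (hits None w p)).
  move=> E Eb; rewrite -test_None; have /eqP := Eb; rewrite -label_base => /eqP <-.
  by move/visitsP: (Hbase _ _ _ E Eb); apply; exact: E.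
case=> p [q n]; rewrite actE Hm; congr (_, (_, _)); move: n.
have [[w1 [c [w2 [E Eb]]]]|Hnb] : (exists w1 c w2, w = w1 ++ c :: w2 /\ mv w1 p = base)
   \/ (forall w1 c w2, w = w1 ++ c :: w2 -> mv w1 p <> base).
- elim: {m0 m1 Hv Hm Hbase Heven} w p => [|c w IH] p; first by right=> -[].
  have [E|/eqP ne] := eqVneq p base; first by left; exists [::], c, w.
  case: (IH (mv1 c p)) => [[w1 [c' [w2 [E h]]]]|H].
    by left; exists (c :: w1), c', w2; rewrite E.
  by right=> -[|c1 w1] c' w2 // [<- E]; apply: H E.
- have /visitsP Hp := Hbase _ _ _ E Eb; apply/testP.
  have [[v1 [d [v2 [Ev Eq]]]]|Hq] := visited_dec q w p.
    by rewrite -Eq; apply: Hp Ev.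
  (* Off the visited labels only the reflections n -> -n at [base] remain, and an even number of
     them is the identity for every order. *)
  rewrite /test (hits_unvisited Hq) dih_odd (Heven _ _ _ _ E Eb) /=.
  rewrite hits_None; set k := size _; suff -> : distn (dih (nseq k false)).2 = 0 by apply: dvdn0.
  suff H b : (foldl dih_step (b, (0, 0)) (nseq k false)).2 = (0, 0) by rewrite /dih H.
  by elim: k b => //= k IH b; apply: IH.
apply/testP; rewrite /test dih_odd (hits_no_base q Hnb) size_nseq.
set k := count _ _.
have ek : ~~ odd k.
  (* [f] sends a prefix to the point that it carries to [base]. Prefixes with the same such point
     differ by a final power of [tau], which preserves labels. *)
  apply: (even_count (f := fun w1 => mv (winv w1) base)) => [v v' Ev|v].
    have [i Hi] : exists i, mv (winv v ++ v') =1 iter i (mv1 tau).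
      by apply: mv_stab_base; rewrite mv_cat Ev mv_winvVK.
    have := Hi (mv v p); rewrite mv_cat mv_winvK => ->.
    by rewrite label_iter_tau.
  move=> /lamps_split[v2 E].
  have := Heven _ _ _ (mv (winv v) base) E (mv_winvVK _ _).
  rewrite size_hits_None (eq_count (a2 := fun v' => mv (winv v') base ==
    mv (winv v) base)) // => v'.
  by apply/eqP/eqP => Ev; [rewrite -[in LHS]Ev mv_winvK | rewrite -Ev mv_winvVK].
rewrite ek /=; suff -> : distn (dih (nseq k true)).2 = 0 by apply: dvdn0.
have -> : k = k./2.*2 by rewrite -[LHS]odd_double_half (negbTE ek).
suff H j P N : foldl dih_step (false, (P, N)) (nseq j.*2 true) = (false, (j + P, j + N)).
  by rewrite /dih H /distn /= subnn.
elim: j P N => [P N|j IH P N]; first by rewrite !add0n.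
by rewrite doubleS /= IH /dih_step /= !addn1 !addnS.
Qed.

Lemma decideP w : reflect (forall s, act w s = s) (decide w).
Proof. by apply: (iffP idP) => [/decide_sound|/decide_complete]. Qed.
End Action.

(** * The group *)

(** Elements are the functions induced by words, so that equality is equality of actions and no
    quotient is taken. Products and inverses are formed on chosen words, with inverses written
    positively by [winv]. *)
Record elt (ord : seq bool -> nat) := Elt {
  fn : state -> state;
  fnP : exists w, fn = act ord w
}.

Section Group.
Variable ord : seq bool -> nat.
Local Notation G := (elt ord).

HB.instance Definition _ := gen_eqMixin G.
HB.instance Definition _ := gen_choiceMixin G.

Definition wact (w : seq letter) : G := Elt (ex_intro _ w erefl).

Definition wrd (g : G) : seq letter := projT1 (cid (fnP g)).

Lemma wact_eq w w' : act ord w =1 act ord w' -> wact w = wact w'.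
Proof.
move=> /funext E; rewrite /wact; move: (ex_intro _ w _) (ex_intro _ w' _) => /=.
by rewrite E => p p'; rewrite (Prop_irrelevance p p').
Qed.

Lemma wact_eq1 w w' : wact w = wact w' -> act ord w =1 act ord w'.
Proof. by move=> /(congr1 (@fn ord)) /= ->. Qed.

Lemma wrdK g : wact (wrd g) = g.
Proof.
case: g => f p; rewrite /wact /wrd; case: cid => w /= E; subst f.
by rewrite (Prop_irrelevance p (ex_intro _ w erefl)).
Qed.

Definition elt_mul (g h : G) : G := wact (wrd g ++ wrd h).
Definition elt_inv (g : G) : G := wact (winv (wrd g)).

Lemma elt_mulE w w' : elt_mul (wact w) (wact w') = wact (w ++ w').
Proof.
apply: wact_eq => s; rewrite !act_cat.
by rewrite (wact_eq1 (wrdK (wact w))) (wact_eq1 (wrdK (wact w'))).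
Qed.

Lemma elt_mulA : associative elt_mul.
Proof.
move=> f g h; rewrite -(wrdK f) -(wrdK g) -(wrdK h) !elt_mulE.
by rewrite catA.
Qed.

Lemma elt_mul1 : left_id (wact [::]) elt_mul.
Proof. by move=> g; rewrite -(wrdK g) elt_mulE. Qed.

Lemma elt_1mul : right_id (wact [::]) elt_mul.
Proof. by move=> g; rewrite -(wrdK g) elt_mulE cats0. Qed.

Lemma elt_mulV : left_inverse (wact [::]) elt_inv elt_mul.
Proof.
move=> g; rewrite -{2}(wrdK g) elt_mulE; apply: wact_eq => s.
by rewrite act_cat act_winvVK.
Qed.

Lemma elt_Vmul : right_inverse (wact [::]) elt_inv elt_mul.
Proof.
move=> g; rewrite -{1}(wrdK g) elt_mulE; apply: wact_eq => s.
by rewrite act_cat act_winvK.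
Qed.

HB.instance Definition _ :=
  isGroup.Build G elt_mulA elt_mul1 elt_1mul elt_mulV elt_Vmul.

Local Open Scope group_scope.

Lemma wact_cat w w' : wact (w ++ w') = wact w * wact w'.
Proof. by rewrite -elt_mulE. Qed.

Lemma wact_is1 w : wact w = 1 <-> forall s, act ord w s = s.
Proof. by split=> [/wact_eq1|] H; [exact: H | apply: wact_eq]. Qed.

Lemma wact_nseq n w : wact (flatten (nseq n w)) = wact w ^+ n.
Proof. by elim: n => //= n IH; rewrite wact_cat IH expgS. Qed.

Definition gx : G := wact [:: sigma].
Definition gy : G := wact [:: lamp; tau].

Lemma expg_modn (g : G) m n : g ^+ m = 1 -> g ^+ (n %% m) = g ^+ n.
Proof.
by move=> E; rewrite {2}(divn_eq n m) expgnDr mulnC expgnA E expg1n mul1g.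
Qed.

Lemma expg_sigma n : wact [:: sigma] ^+ n = wact (nseq (odd n) sigma).
Proof.
rewrite -(@expg_modn _ 2) ?modn2; first by case: odd.
by rewrite -wact_nseq; apply/wact_is1; apply: act_sigmaK.
Qed.

Lemma expg_lamp n : wact [:: lamp] ^+ n = wact (nseq (odd n) lamp).
Proof.
rewrite -(@expg_modn _ 2) ?modn2; first by case: odd.
by rewrite -wact_nseq; apply/wact_is1; apply: act_lampK.
Qed.

Lemma wact_nseq1 c n : wact (nseq n c) = wact [:: c] ^+ n.
Proof. by rewrite -wact_nseq; elim: n => //= n IH; rewrite -cat1s wact_cat IH -wact_cat. Qed.

Lemma expg_tau n : wact [:: tau] ^+ n = wact (nseq (n %% 3) tau).
Proof.
rewrite wact_nseq1 expg_modn // -wact_nseq; apply/wact_is1; exact: act_tauK.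
Qed.

Lemma expg_gy n : gy ^+ n = wact (nseq (odd n) lamp ++ nseq (n %% 3) tau).
Proof.
rewrite /gy -cat1s wact_cat expgMn ?expg_lamp ?expg_tau -?wact_cat //.
by rewrite /commute -!wact_cat; apply: wact_eq; apply: act_lamp_tau.
Qed.

(** * Words *)

Definition zbits (k : Z) : bool * seq bool :=
  match k with
  | Z0 => (false, [::])
  | Zpos p => (false, positive_bits p)
  | Zneg p => (true, positive_bits p)
  end.

Definition bits_mod3 (s : seq bool) : nat := foldr (fun (b : bool) r => (b + 2 * r) %% 3) 0 s.

Definition xletters (d : bool * seq bool) : seq letter :=
  if head false d.2 then [:: sigma] else [::].

(** The exponent matters modulo 2 for the lamp and modulo 3 for [tau]. A sign is invisible modulo 2
    and is multiplication by 2 modulo 3. *)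
Definition yletters (d : bool * seq bool) : seq letter :=
  (if head false d.2 then [:: lamp] else [::]) ++
  nseq (if d.1 then (2 * bits_mod3 d.2) %% 3 else bits_mod3 d.2) tau.

Lemma odd_positive p : odd (Pos.to_nat p) = head false (positive_bits p).
Proof.
case: p => [p|p|] //.
  by rewrite Pos2Nat.inj_xI [positive_bits _]/= multE mul2n oddS odd_double.
by rewrite Pos2Nat.inj_xO multE mul2n odd_double.
Qed.

Lemma positive_mod3 p : Pos.to_nat p %% 3 = bits_mod3 (positive_bits p).
Proof.
elim: p => [p IH|p IH|] //; rewrite [bits_mod3 _]/= -/(bits_mod3 _) -IH.
  by rewrite Pos2Nat.inj_xI multE -add1n -[LHS]modnDmr -modnMmr modnDmr.
by rewrite Pos2Nat.inj_xO multE add0n modnMmr.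
Qed.

Lemma wact_xletters k : wact (xletters (zbits k)) = zpow gx k.
Proof.
case: k => [|p|p] //=.
  by rewrite /gx expg_sigma odd_positive /xletters /=; case: head.
rewrite /gx expg_sigma odd_positive /xletters /=; case: head; last by rewrite invg1.
by apply: (mulIg (wact [:: sigma])); rewrite mulVg -wact_cat; apply/wact_is1;
  apply: act_sigmaK.
Qed.

Lemma wact_yletters k : wact (yletters (zbits k)) = zpow gy k.
Proof.
have E6 : gy ^+ 6 = 1 by rewrite expg_gy.
have pos p : wact (yletters (false, positive_bits p)) = gy ^+ Pos.to_nat p.
  by rewrite expg_gy odd_positive positive_mod3 /yletters /=; case: head.
case: k => [|p|p] //=.
(* 5 is -1 modulo 6; it is odd and 2 modulo 3, in agreement with [yletters]. *)
have -> : gy ^- Pos.to_nat p = gy ^+ (5 * Pos.to_nat p).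
  apply: (mulIg (gy ^+ Pos.to_nat p)); rewrite mulVg -expgnDr.
  have -> : (5 * Pos.to_nat p + Pos.to_nat p = 6 * Pos.to_nat p)%N by lia.
  by rewrite expgnA E6 expg1n.
rewrite expg_gy oddM odd_positive -modnMm positive_mod3.
by rewrite /yletters /=; case: head.
Qed.

Definition word_letters (w : word) : seq letter :=
  xletters (zbits (w_head w)) ++
  flatten [seq yletters (zbits p.1) ++ xletters (zbits p.2) | p <- w_mid w] ++
  yletters (zbits (w_last w)).

Lemma word_evalE w : word_eval gx gy w = wact (word_letters w).
Proof.
rewrite /word_eval /word_letters 2!wact_cat wact_xletters wact_yletters mulgA.
congr (_ * _ * _); elim: (w_mid w) => //= p s IH.
by rewrite 2!wact_cat wact_xletters wact_yletters IH.
Qed.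

Lemma zpow_succ (g : G) k : zpow g (Z.succ k) = g * zpow g k.
Proof.
case: k => [|p|p].
- by rewrite mulg1.
- by rewrite -expgS /=; congr (_ ^+ _); lia.
- case: (Pos.eq_dec p xH) => [->|ne]; first by rewrite /= expg1 mulgV.
  have -> : Z.succ (Z.neg p) = Z.neg (Pos.pred p) by lia.
  have -> : Z.neg p = Z.neg (Pos.succ (Pos.pred p)) by rewrite Pos.succ_pred.
  rewrite /= Pos2Nat.inj_succ; apply: (mulIg (g ^+ (Pos.to_nat (Pos.pred p)).+1)).
  by rewrite mulgVK expgSr mulKg.
Qed.

Definition reached (g : G) : Prop := exists w, word_eval gx gy w = g.

Lemma reached_x g : reached g -> reached (gx * g).
Proof.
case=> -[h m l mP] <-; exists (Word (Z.succ h) l mP).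
by rewrite /word_eval /= zpow_succ !mulgA.
Qed.

(** Inner exponents must be nonzero. If the head is nonzero, a new syllable is opened; otherwise
    [gy] merges with the next power of [gy], and if that cancels, the exponent of [gx] behind it
    becomes the head. *)
Lemma reached_y g : reached g -> reached (gy * g).
Proof.
case=> -[h m l mP] <-; rewrite /word_eval /=.
case: (Z.eqb_spec h Z0) => [->|nh]; last first.
  have mP' : all (fun p => ~~ Z.eqb p.1 Z0 && ~~ Z.eqb p.2 Z0) ((Zpos xH, h) :: m).
    by apply/andP; split=> //; apply/andP; split=> //; apply/negP => /Z.eqb_eq.
  by exists (Word Z0 l mP'); rewrite /word_eval /= mul1g !mulgA expg1.
case: m mP => [|[b k] m] mP.
  exists (@Word Z0 [::] (Z.succ l) isT); rewrite /word_eval /= zpow_succ.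
  by rewrite !mul1g.
have /andP[/andP[/= nb nk] mP'] := mP.
case: (Z.eqb_spec (Z.succ b) Z0) => [E|nE].
  exists (Word k l mP'); rewrite /word_eval /= mul1g !mulgA -zpow_succ E /= mul1g.
  by [].
have mP2 : all (fun p => ~~ Z.eqb p.1 Z0 && ~~ Z.eqb p.2 Z0) ((Z.succ b, k) :: m).
  by apply/andP; split=> //; apply/andP; split=> //; apply/negP => /Z.eqb_eq.
by exists (Word Z0 l mP2); rewrite /word_eval /= zpow_succ !mul1g !mulgA.
Qed.

Lemma reached_all g : reached g.
Proof.
rewrite -(wrdK g); elim: (wrd g) => [|c w IH].
  by exists (@Word Z0 [::] Z0 isT); rewrite /word_eval /= !mulg1.
have reach_pow n h : reached h -> reached (gy ^+ n * h).
  elim: n => [|n IHn] hh; first by rewrite mul1g.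
  by rewrite expgS -mulgA; apply: reached_y; apply: IHn.
rewrite -cat1s wact_cat; case: c => [[]|]; first exact: reached_x.
  (* 4 is even and 1 modulo 3, while 3 is odd and 0 modulo 3. *)
  have -> : wact [:: tau] = gy ^+ 4 by rewrite expg_gy.
  exact: reach_pow.
have -> : wact [:: lamp] = gy ^+ 3 by rewrite expg_gy.
exact: reach_pow.
Qed.

Lemma generated_elt : generated_by gx gy.
Proof. exact: reached_all. Qed.

(** * Discrete logarithms *)

(** The inverse of [path_to q] as a positive word: the exponents [b.+1] and [(~~ b).+1] add up to
    3. *)
Definition back_to (q : seq bool) : seq letter :=
  sigma :: flatten [seq nseq (~~ b).+1 tau ++ [:: sigma] | b <- q].

Lemma mv_tau_inv (b : bool) p :
  mv (nseq (~~ b).+1 tau) (mv (nseq b.+1 tau) p) = p.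
Proof. by rewrite -mv_cat; case: b; apply: mv_tauK. Qed.

Lemma mv_back_to q p : mv (back_to q) (mv (path_to q) p) = p.
Proof.
elim: q p => [|b q IH] p; first exact: mv_sigmaK.
have -> : back_to (b :: q) = [:: sigma] ++ nseq (~~ b).+1 tau ++ back_to q.
  by rewrite /back_to [map _ _]/= [flatten _]/= -catA.
have -> : path_to (b :: q) = path_to q ++ nseq b.+1 tau ++ [:: sigma] by [].
rewrite !mv_cat; set y := mv (nseq _ _) (mv (path_to q) p).
have -> : mv [:: sigma] (mv [:: sigma] y) = y by apply: mv_sigmaK.
by rewrite mv_tau_inv IH.
Qed.

Lemma mv_path_to q : mv (path_to q) base = (true, q).
Proof. by elim: q => //= b q IH; rewrite mv_cat IH; case: b. Qed.

(** Walking back meets the turns in the opposite order and orientation. The image is the point that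
    [path_to q] carries to [base]. *)
Lemma mv_back_to_base q : mv (back_to q) base = (true, rev (map negb q)).
Proof.
suff H e : mv (flatten [seq nseq (~~ b).+1 tau ++ [:: sigma] | b <- q]) (true, e) =
    (true, catrev (map negb q) e) by apply: (H [::]).
by elim: q e => //= b q IH e; rewrite -IH; case: b.
Qed.

(** The lamp times its conjugate by [path_to q]. At [base], on the residues attached to [q], the two
    lamps act as n -> -n and n -> 1 - n, so that the product is the rotation n -> n + 1, of order
    [ord q]. *)
Definition twist (q : seq bool) : seq letter :=
  lamp :: path_to q ++ lamp :: back_to q.

Lemma hits_cat oq w w' p : hits oq (w ++ w') p = hits oq w p ++ hits oq w' (mv w p).
Proof. by elim: w p => //= c w IH p; rewrite IH catA. Qed.

Lemma hits_no_lamp oq w p : lamp \notin w -> hits oq w p = [::].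
Proof. by elim: w p => //= c w IH p; rewrite inE negb_or => /andP[+ /IH ->]; case: c. Qed.

Lemma lamp_path_to q : lamp \notin path_to q.
Proof.
by elim: q => // b q IH; rewrite [path_to _]/= mem_cat negb_or IH; case: b.
Qed.

Lemma lamp_back_to q : lamp \notin back_to q.
Proof.
rewrite /back_to; set F := fun b : bool => _.
suff H : lamp \notin flatten (map F q) by rewrite inE (negbTE H).
elim: q => // b q IH; rewrite -[flatten _]/(F b ++ flatten (map F q)).
by rewrite mem_cat negb_or IH andbT /F; case: b.
Qed.

Lemma mv_twist q p : mv (twist q) p = p.
Proof. by rewrite /twist -cat1s !mv_cat -cat1s mv_cat mv_back_to. Qed.

Lemma hits_twist oq q p :
  hits oq (twist q) p = hit oq p ++ hit oq (mv (path_to q) p).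
Proof.
rewrite /twist [LHS]/= hits_cat hits_no_lamp ?lamp_path_to // [hits _ (_ :: _) _]/=.
by rewrite hits_no_lamp ?lamp_back_to // cats0.
Qed.

Lemma twist_pow q k : wact (twist q) ^+ k = 1 <->
  forall p q' n, kicks (ord q')
    (flatten (nseq k (hit (Some q') p ++ hit (Some q') (mv (path_to q) p)))) n = n.
Proof.
have E p q' : hits (Some q') (flatten (nseq k (twist q))) p =
    flatten (nseq k (hit (Some q') p ++ hit (Some q') (mv (path_to q) p))).
  elim: k => // k IH.
  rewrite -[flatten (nseq k.+1 (twist q))]/(twist q ++ flatten (nseq k (twist q))).
  by rewrite hits_cat mv_twist IH hits_twist.
have M p : mv (flatten (nseq k (twist q))) p = p.
  elim: k {E} => // k IH.
  rewrite -[flatten _]/(twist q ++ flatten (nseq k (twist q))).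
  by rewrite mv_cat mv_twist.
rewrite -wact_nseq wact_is1; split=> [H p q' n|H [p [q' n]]].
  by have := H (p, (q', n)); rewrite actE E => -[].
by rewrite actE E M H.
Qed.

Hypothesis ord_gt2 : forall q, ord q = 0%N \/ (2 < ord q)%N.

Lemma dih_alternate (b : bool) k :
  dih (flatten (nseq k [:: b; ~~ b])) = (false, if b then (0%N, k) else (k, 0%N)).
Proof.
rewrite /dih; suff H P N : foldl dih_step (false, (P, N)) (flatten (nseq k [:: b; ~~ b]))
    = (false, if b then (P, N + k)%N else (P + k, N)%N) by rewrite H !add0n.
by case: b; elim: k P N => [|k IH] P N; rewrite ?addn0 // [LHS]/= IH
  /dih_step /= ?addn0 ?addn1 addSnnS.
Qed.

(* The two lamps of [twist q] interact at two points only: [base], with the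
   string [q], and the point that [path_to q] carries to [base], with the string
   [rev (map negb q)]. *)
Lemma twist_order q k : (ord q %| k)%N -> (ord (rev (map negb q)) %| k)%N ->
  wact (twist q) ^+ (2 * k) = 1.
Proof.
move=> d d'; apply/twist_pow => p q' n.
have alt b : (ord q' %| k)%N ->
    kicks (ord q') (flatten (nseq (2 * k) [:: b; ~~ b])) n = n.
  move=> dk; move: n; apply/kicks_id => //; rewrite -dih_odd dih_alternate.
  by split=> //; case: b; rewrite /distn /= subn0 ?sub0n ?add0n ?addn0 dvdn_mull.
(* Outside the two rotations, one pass of the twist is empty, a single reflection, or the same
   reflection twice. Its square is trivial, which is the origin of the factor 2. *)
have same X : (forall m n, kicks m (X ++ X) n = n) ->
    kicks (ord q') (flatten (nseq (2 * k) X)) n = n.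
  move=> HX; rewrite mul2n -addnn; elim: k {d d' alt} => // k IH.
  rewrite addSn addnS [flatten _]/= catA /kicks foldl_cat -/(kicks _ _ _).
  by rewrite -/(kicks _ _ _) HX.
rewrite /hit !label_base; have [Ep|np] := eqVneq p base.
  rewrite Ep mv_path_to /=; case: eqP => [[Eq]|_]; last first.
    by apply: same => m z; rewrite /kicks /= kickK.
  by apply: (alt false); rewrite -Eq.
have [Em|nm] := eqVneq (mv (path_to q) p) base.
  have Ep : p = (true, rev (map negb q)) by rewrite -mv_back_to_base -Em mv_back_to.
  rewrite Ep /=; case: eqP => [[Eq]|_]; last first.
    by apply: same => m z; rewrite /kicks /= kickK.
  by apply: (alt true); rewrite -Eq.
by case: ifP => _; case: ifP => _; apply: same => m z; rewrite /kicks /= ?kickK.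
Qed.

Lemma twist_infinite q k : ord q = 0%N -> wact (twist q) ^+ k = 1 -> k = 0%N.
Proof.
move=> E0 /twist_pow /(_ base q) H.
have /kicks_id [] : forall n, kicks (ord q) (flatten (nseq k [:: false; true])) n = n.
- by move=> n; rewrite -[RHS]H mv_path_to /hit !label_base /= eqxx.
- exact: ord_gt2.
by move=> _; rewrite (dih_alternate false) E0 /distn /= subn0 sub0n addn0 dvd0n => /eqP.
Qed.

Lemma zpow_nat (g : G) n : zpow g (Z.of_nat n) = g ^+ n.
Proof. by case: n => // n; rewrite /= SuccNat2Pos.id_succ. Qed.

Lemma dlog_solvable q : odd (ord q) -> odd (ord (rev (map negb q))) ->
  exists k : Z, zpow (wact (twist q) ^+ 4) k = wact (twist q) ^+ 2.
Proof.
move=> o o'; set N := (ord q * ord (rev (map negb q)))%N.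
have oN : odd N by rewrite oddM o o'.
(* [N] is odd, so 4 (N + 1) / 2 = 2 N + 2, and [twist_order] removes the 2 N. *)
exists (Z.of_nat (uphalf N)); rewrite zpow_nat -expgnA.
have -> : (4 * uphalf N = 2 * N + 2)%N.
  by rewrite -{2}(odd_double_half N) oN uphalf_half oN; lia.
by rewrite expgnDr (twist_order (dvdn_mulr _ (dvdnn _)) (dvdn_mull _ (dvdnn _))) mul1g.
Qed.

Lemma dlog_unsolvable q k : ord q = 0%N ->
  zpow (wact (twist q) ^+ 4) k <> wact (twist q) ^+ 2.
Proof.
move=> E0; set t := wact (twist q).
have H n : t ^+ n = 1 -> n = 0%N by apply: twist_infinite.
case: k => [|p|p] /=; first by move=> /esym/H.
  rewrite -expgnA => /esym E; have lt := Pos2Nat.is_pos p.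
  have := H (4 * Pos.to_nat p - 2)%N; rewrite expgnFr; last by lia.
  by rewrite -E mulgV => /(_ erefl); lia.
rewrite -expgnA => E; have := H (2 + 4 * Pos.to_nat p)%N.
by rewrite expgnDr -E mulVg => /(_ erefl); lia.
Qed.
End Group.

(** * The decision procedure in polynomial time *)

Lemma pt_mv1 (A : Type) {dA : data A}
    (c : A -> letter) (p : A -> point) :
  PT c -> PT p -> PT (fun a => mv1 (c a) (p a)).
Proof.
move=> hc hp.
apply: (pt_option_case (g := fun a (b : bool) => if b then (~~ (p a).1, (p a).2)
  else if (p a).1 then (false, false :: (p a).2)
  else if (p a).2 is b' :: e then (if b' then (true, e) else (false, true :: e))
  else p a)); [pt|pt|].
have hp' : PT (fun x : A * bool => p x.1) by apply: pt_comp hp; pt.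
apply: pt_if; [pt|pt|]; apply: pt_if; [pt|pt|]; apply: pt_seq_case; [pt|pt|].
by pt.
Qed.

Lemma pt_label (A : Type) {dA : data A}
    (p : A -> point) : PT p -> PT (fun a => label (p a)).
Proof.
by move=> hp; apply: pt_if; [pt|pt|]; apply: pt_seq_case; pt.
Qed.

Lemma dsize_mv1 c p : dsize (mv1 c p) <= dsize p + 5.
Proof.
case: p => f e; have := dsize_bool (~~ f); have : 0 < dsize f by apply: dsize_gt0.
have F : dsize false = 1 by []; have T : dsize true = 3 by [].
case: c => [[]|]; rewrite [mv1 _ _]/=; last by lia.
  by rewrite !dsize_pair; lia.
case: f => /=; first by rewrite !dsize_pair dsize_cons; lia.
by case: e => [|[] e]; rewrite !dsize_pair ?dsize_cons; lia.
Qed.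
#[export] Hint Extern 1 (PT (fun _ => mv1 _ _)) => apply: pt_mv1 : pt.
#[export] Hint Extern 1 (PT (fun _ => label _)) => apply: pt_label : pt.

Lemma pt_mv (A : Type) {dA : data A}
    (w : A -> seq letter) (p : A -> point) :
  PT w -> PT p -> PT (fun a => mv (w a) (p a)).
Proof.
move=> hw hp; apply: (pt_foldl (f := fun _ p c => mv1 c p) (G := fun=> 5)); try by pt.
by move=> a q c _; apply: dsize_mv1.
Qed.

Lemma pt_hit (A : Type) {dA : data A}
    (oq : A -> option (seq bool)) (p : A -> point) :
  PT oq -> PT p -> PT (fun a => hit (oq a) (p a)).
Proof. by move=> ho hp; rewrite /hit; pt. Qed.
#[export] Hint Extern 1 (PT (fun _ => mv _ _)) => apply: pt_mv : pt.
#[export] Hint Extern 1 (PT (fun _ => hit _ _)) => apply: pt_hit : pt.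

Lemma dsize_hit oq p : dsize (hit oq p) <= 5.
Proof. by rewrite /hit; do 2?case: ifP => _. Qed.

Lemma pt_hits (A : Type) {dA : data A}
    (oq : A -> option (seq bool)) (w : A -> seq letter) (p : A -> point) :
  PT oq -> PT w -> PT p -> PT (fun a => hits (oq a) (w a) (p a)).
Proof.
move=> ho hw hp.
pose f a (s : point * seq bool) (c : letter) :=
  (mv1 c s.1, if c == lamp then s.2 ++ hit (oq a) s.1 else s.2).
apply: (@pt_eq _ _ _ _ (fun a => (foldl (f a) (p a, [::]) (w a)).2)).
  move=> a; suff H acc x : (foldl (f a) (x, acc) (w a)).2 = acc ++ hits (oq a) (w a) x.
    exact: H.
  elim: (w a) acc x => [|c v IH] acc x; first by rewrite cats0.
  rewrite [LHS]/= IH /f /=; case: c => //=; by rewrite catA.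
apply: PT_snd; apply: (pt_foldl (f := f) (G := fun=> 20)); [|pt|pt|pt|].
  have ho' : PT (fun x : A * ((point * seq bool) * letter) => oq x.1) by apply: pt_comp ho; pt.
  by rewrite /f; pt.
move=> a [x acc] c _; rewrite /f !dsize_pair; have := dsize_mv1 c x.
case: eqP => _ /=; last by lia.
have : (dsize (acc ++ hit (oq a) x)).+1 = dsize acc + dsize (hit (oq a) x) by apply: dsize_cat.
by have := dsize_hit (oq a) x; lia.
Qed.

Lemma pt_dih (A : Type) {dA : data A}
    (D : A -> seq bool) : PT D -> PT (fun a => dih (D a)).
Proof.
move=> hD; apply: (pt_foldl (f := fun=> dih_step) (G := fun=> 10)); [|pt|pt|pt|].
  apply: pt_pair; [pt|]; apply: pt_pair; [|pt]; apply: pt_addn; [pt|].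
  by apply: (@pt_eq _ _ _ _ (fun p : A * ((bool * (nat * nat)) * bool) => if p.2.2 then 1 else 0)); pt.
move=> a [b [P N]] k _; rewrite /dih_step !dsize_pair !dsize_nat /=.
by have := dsize_bool (~~ b); have : 0 < dsize b by [apply: dsize_gt0]; case: k; lia.
Qed.
#[export] Hint Extern 1 (PT (fun _ => hits _ _ _)) => apply: pt_hits : pt.
#[export] Hint Extern 1 (PT (fun _ => dih _)) => apply: pt_dih : pt.

Lemma pt_test (A : Type) {dA : data A}
    (w : A -> seq letter) (p : A -> point) (oq : A -> option (seq bool)) :
  PT w -> PT p -> PT oq -> PT (fun a => test ord (w a) (p a) (oq a)).
Proof.
move=> hw hp ho; apply: pt_andb; [pt|].
apply: (pt_option_case (g := fun a q => ord q %| distn (dih (hits (oq a) (w a) (p a))).2));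
  [pt|pt|].
have h : PT (fun a => dih (hits (oq a) (w a) (p a))) by pt.
have h' : PT (fun x : A * seq bool => dih (hits (oq x.1) (w x.1) (p x.1))).
  by apply: (pt_comp _ h); pt.
by apply: pt_ord_dvdn; [pt|]; rewrite /distn; pt.
Qed.
#[export] Hint Extern 1 (PT (fun _ => test _ _ _ _)) => apply: pt_test : pt.

Lemma pt_visits (A : Type) {dA : data A}
    (w : A -> seq letter) (p : A -> point) :
  PT w -> PT p -> PT (fun a => visits ord (w a) (p a)).
Proof.
move=> hw hp; apply: PT_snd.
apply: (pt_foldl (f := fun a (s : point * bool) c =>
  (mv1 c s.1, s.2 && test ord (w a) (p a) (label s.1))) (G := fun=> 10)); [|pt|pt|pt|].
  have hw' : PT (fun x : A * ((point * bool) * letter) => w x.1) by apply: pt_comp hw; pt.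
  have hp' : PT (fun x : A * ((point * bool) * letter) => p x.1) by apply: pt_comp hp; pt.
  by pt.
move=> a [x b] c _; rewrite !dsize_pair /=; have := dsize_mv1 c x.
by have := dsize_bool (b && test ord (w a) (p a) (label x)); lia.
Qed.

Lemma pt_all_tails (A : Type) {dA : data A}
    (P : A -> seq letter -> bool) (w : A -> seq letter) :
  PT (fun x : A * seq letter => P x.1 x.2) -> PT w ->
  PT (fun a => all_tails (P a) (w a)).
Proof.
move=> hP hw.
pose f a (s : seq letter * bool) := (behead s.1, s.2 && P a s.1).
apply: (@pt_eq _ _ _ _ (fun a => (iter (size (w a)).+1 (f a) (w a, true)).2)).
  move=> a; suff H b v : (iter (size v).+1 (f a) (v, b)).2 = b && all_tails (P a) v.
    exact: H.
  elim: v b => [|c v IH] b; first by rewrite /= andbT.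
  by rewrite [size _]/= iterSr [f a _]/f [(_, _).1]/= [(_, _).2]/= IH /= andbA.
apply: PT_snd; apply: (pt_iter_lin (step := f) (G := fun=> 5)); [pt|pt| |pt|].
  have h : PT (fun p : A * (seq letter * bool) => P p.1 p.2.1).
    by apply: (pt_comp2 hP); pt.
  by rewrite /f; pt.
move=> a [v b]; rewrite /f !dsize_pair /=.
have hv : dsize (behead v) <= dsize v by apply: dsize_behead.
by have := dsize_bool (b && P a v); lia.
Qed.
#[export] Hint Extern 1 (PT (fun _ => visits _ _ _)) => apply: pt_visits : pt.

Lemma pt_decide (A : Type) {dA : data A} (w : A -> seq letter) :
  PT w -> PT (fun a => decide ord (w a)).
Proof.
move=> hw; rewrite /decide; apply: pt_andb; [pt|]; apply: pt_andb; [pt|].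
apply: (pt_all_tails (P := fun a t => visits ord (w a) (mv t base))); [|pt].
have hw' : PT (fun x : A * seq letter => w x.1) by apply: pt_comp hw; pt.
by pt.
Qed.

(** * Parsing words *)

(* State: end of string reached, rest of the input, bits read so far (reversed). *)
Definition bits_step (st : bool * (seq bool * seq bool)) : bool * (seq bool * seq bool) :=
  if st.1 then st
  else if head false st.2.1 then
    (false, (behead (behead st.2.1), head false (behead st.2.1) :: st.2.2))
  else (true, (behead st.2.1, st.2.2)).

Definition read_bits (s : seq bool) : seq bool * seq bool :=
  let st := iter (size s) bits_step (false, (s, [::])) in (rev st.2.2, st.2.1).

Definition read_Z (s : seq bool) : (bool * seq bool) * seq bool :=
  let p := read_bits (behead s) in ((head false s, p.1), p.2).

(** The step is idle at the [false] that ends the sequence, so the input size can serve as number of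
    iterations. That [false] is still there afterwards and is dropped in [read_word]. *)
Definition syllable_step (st : seq bool * seq letter) : seq bool * seq letter :=
  if head false st.1 then
    let a := read_Z (behead st.1) in
    let b := read_Z a.2 in
    (b.2, st.2 ++ yletters a.1 ++ xletters b.1)
  else st.

Definition read_word (s : seq bool) : seq letter :=
  let a := read_Z s in
  let st := iter (size s) syllable_step (a.2, [::]) in
  xletters a.1 ++ st.2 ++ yletters (read_Z (behead st.1)).1.

Lemma encode_string_cons b l : encode_string (b :: l) = [:: true, b & encode_string l].
Proof. by []. Qed.

Lemma iter_bits_step l r acc n : size l < n ->
  iter n bits_step (false, (encode_string l ++ r, acc)) = (true, (r, catrev l acc)).
Proof.
have stop k s a : iter k bits_step (true, (s, a)) = (true, (s, a)).
  by elim: k => //= k ->.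
elim: l acc n => [|b l IH] acc [|n] // h; rewrite iterSr; first exact: stop.
by rewrite encode_string_cons; apply: IH.
Qed.

Lemma read_bits_encode l r : read_bits (encode_string l ++ r) = (l, r).
Proof.
rewrite /read_bits iter_bits_step; first by rewrite /= -/(rev l) revK.
by rewrite size_cat size_encode_string; lia.
Qed.

Lemma read_Z_encode k r : read_Z (encode_Z k ++ r) = (zbits k, r).
Proof.
have E b l : read_Z (b :: encode_string l ++ r) = ((b, l), r).
  by rewrite /read_Z -[behead _]/(encode_string l ++ r) read_bits_encode.
by case: k => [|p|p]; [exact: (E false [::])|exact: (E false)|exact: (E true)].
Qed.

Lemma encode_seq_cons (T : Type) (enc : T -> seq bool) a s :
  encode_seq enc (a :: s) = true :: enc a ++ encode_seq enc s.
Proof. by rewrite /encode_seq /= -catA. Qed.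

Lemma size_encode_seq (T : Type) (enc : T -> seq bool) s : size s < size (encode_seq enc s).
Proof.
elim: s => // a s IH; rewrite encode_seq_cons /= size_cat ltnS.
by apply: leq_trans IH _; apply: leq_addl.
Qed.

Lemma syllable_step_encode b k r out :
  syllable_step (true :: encode_Z b ++ encode_Z k ++ r, out) =
  (r, out ++ yletters (zbits b) ++ xletters (zbits k)).
Proof.
rewrite /syllable_step; set s := encode_Z b ++ _.
by rewrite -[behead _]/s -[head _ _]/true read_Z_encode read_Z_encode.
Qed.

Lemma iter_syllable_step m r out n : size m <= n ->
  iter n syllable_step
    (encode_seq (fun p => encode_Z p.1 ++ encode_Z p.2) m ++ r, out) =
  (false :: r, out ++ flatten [seq yletters (zbits p.1) ++ xletters (zbits p.2) | p <- m]).
Proof.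
elim: m out n => [|[b k] m IH] out n.
  by move=> _; rewrite cats0; elim: n => //= n ->.
case: n => // n h; rewrite iterSr encode_seq_cons.
have -> : (true :: (encode_Z (b, k).1 ++ encode_Z (b, k).2) ++
    encode_seq (fun p => encode_Z p.1 ++ encode_Z p.2) m) ++ r =
  true :: encode_Z b ++ encode_Z k ++
    (encode_seq (fun p => encode_Z p.1 ++ encode_Z p.2) m ++ r).
  by rewrite cat_cons -!catA.
by rewrite syllable_step_encode IH // -[in LHS]catA.
Qed.

Lemma read_word_encode w : read_word (encode_word w) = word_letters w.
Proof.
rewrite /read_word /encode_word read_Z_encode [(_, _).1]/= [(_, _).2]/=.
rewrite iter_syllable_step; last first.
  rewrite 2!size_cat.
  by have := size_encode_seq (fun p => encode_Z p.1 ++ encode_Z p.2) (w_mid w); lia.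
by rewrite -[behead _]/(encode_Z (w_last w)) -[encode_Z (w_last w)]cats0 read_Z_encode.
Qed.

Lemma dsize_bits_step st :
  dsize (bits_step st).2.1 <= dsize st.2.1 /\ dsize (bits_step st) <= dsize st + 5.
Proof.
case: st => d [s acc]; rewrite /bits_step /=.
have F : dsize false = 1 by []; have T : dsize true = 3 by [].
case: d; first by split=> //; lia.
case: s => [|[] [|c s]] /=;
  rewrite ?dsize_pair ?dsize_cons ?dsize_nil ?F ?T; split; lia.
Qed.

Lemma dsize_read_bits s : dsize (read_bits s).2 <= dsize s.
Proof.
rewrite /read_bits /=; elim: (size s) => //= n IH.
exact: leq_trans (dsize_bits_step _).1 IH.
Qed.

Lemma pt_read_bits (A : Type) {dA : data A} (s : A -> seq bool) :
  PT s -> PT (fun a => read_bits (s a)).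
Proof.
move=> hs; have h : PT (fun a => iter (size (s a)) bits_step (false, (s a, [::]))).
  apply: (pt_iter_lin (step := fun=> bits_step) (G := fun=> 5)); [pt|pt| |pt|].
    by rewrite /bits_step; pt.
  by move=> a st; apply: (dsize_bits_step st).2.
by rewrite /read_bits; pt.
Qed.
#[export] Hint Extern 1 (PT (fun _ => read_bits _)) => apply: pt_read_bits : pt.

Lemma pt_read_Z (A : Type) {dA : data A} (s : A -> seq bool) :
  PT s -> PT (fun a => read_Z (s a)).
Proof. by move=> hs; rewrite /read_Z; pt. Qed.
#[export] Hint Extern 1 (PT (fun _ => read_Z _)) => apply: pt_read_Z : pt.

Lemma dsize_read_Z s : dsize (read_Z s).2 <= dsize s.
Proof.
apply: leq_trans (dsize_read_bits _) _.
by have h : dsize (behead s) <= dsize s by apply: dsize_behead.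
Qed.

Lemma bits_mod3_lt s : bits_mod3 s < 3.
Proof. by case: s => //= b s; apply: ltn_pmod. Qed.

Definition mod3_step (r : nat) (b : bool) : nat := (b + 2 * r) %% 3.

Lemma pt_bits_mod3 (A : Type) {dA : data A} (s : A -> seq bool) :
  PT s -> PT (fun a => bits_mod3 (s a)).
Proof.
move=> hs; apply: (@pt_eq _ _ _ _ (fun a => foldl mod3_step 0 (rev (s a)))).
  by move=> a; rewrite foldl_rev.
apply: (pt_foldl (f := fun=> mod3_step) (G := fun=> 10)); [|pt|pt|pt|].
  apply: pt_modn3; apply: pt_addn; [|pt].
  by apply: (@pt_eq _ _ _ _ (fun p : A * (nat * bool) => if p.2.2 then 1 else 0)); pt.
move=> a r b _; rewrite /mod3_step !dsize_nat.
by have := ltn_pmod (b + 2 * r) (isT : 0 < 3); lia.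
Qed.
#[export] Hint Extern 1 (PT (fun _ => bits_mod3 _)) => apply: pt_bits_mod3 : pt.

Lemma pt_nseq (A X : Type) {dA : data A} {dX : data X} (n : A -> nat) (x : X) :
  PT n -> PT (fun a => nseq (n a) x).
Proof.
move=> hn; apply: (pt_iter_lin (step := fun _ s => x :: s) (G := fun=> (dsize x).+1));
  [pt|pt|pt|pt|].
by move=> a s; rewrite dsize_cons; lia.
Qed.
#[export] Hint Extern 1 (PT (fun _ => nseq _ _)) => apply: pt_nseq : pt.

Lemma pt_xletters (A : Type) {dA : data A}
    (d : A -> bool * seq bool) :
  PT d -> PT (fun a => xletters (d a)).
Proof. by move=> hd; rewrite /xletters; pt. Qed.

Lemma pt_yletters (A : Type) {dA : data A}
    (d : A -> bool * seq bool) :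
  PT d -> PT (fun a => yletters (d a)).
Proof. by move=> hd; rewrite /yletters; pt. Qed.
#[export] Hint Extern 1 (PT (fun _ => xletters _)) => apply: pt_xletters : pt.
#[export] Hint Extern 1 (PT (fun _ => yletters _)) => apply: pt_yletters : pt.

Lemma dsize_xletters d : dsize (xletters d) <= 7.
Proof. by rewrite /xletters; case: ifP. Qed.

Lemma dsize_yletters d : dsize (yletters d) <= 20.
Proof.
rewrite /yletters; set r := (if d.1 then _ else _).
have : r < 3 by rewrite /r; case: ifP => _; [apply: ltn_pmod | apply: bits_mod3_lt].
by case: r => [|[|[]]] //= _; case: ifP.
Qed.

Lemma dsize_syllable_step st : dsize (syllable_step st) <= dsize st + 30.
Proof.
case: st => s out; rewrite /syllable_step [(_, _).1]/= [(_, _).2]/=.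
case: ifP => _; last by lia.
set a := read_Z (behead s); set b := read_Z a.2.
rewrite !dsize_pair.
have h1 : (dsize (out ++ yletters a.1 ++ xletters b.1)).+1 =
          dsize out + dsize (yletters a.1 ++ xletters b.1) by apply: dsize_cat.
have h2 : (dsize (yletters a.1 ++ xletters b.1)).+1 =
          dsize (yletters a.1) + dsize (xletters b.1) by apply: dsize_cat.
have h3 : dsize (behead s) <= dsize s by apply: dsize_behead.
have h4 : dsize a.2 <= dsize (behead s) by apply: dsize_read_Z.
have h5 : dsize b.2 <= dsize a.2 by apply: dsize_read_Z.
by have := dsize_yletters a.1; have := dsize_xletters b.1; lia.
Qed.

Lemma pt_read_word (A : Type) {dA : data A} (s : A -> seq bool) :
  PT s -> PT (fun a => read_word (s a)).
Proof.
move=> hs.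
have h : PT (fun a => iter (size (s a)) syllable_step ((read_Z (s a)).2, [::])).
  apply: (pt_iter_lin (step := fun=> syllable_step) (G := fun=> 30)); [pt|pt| |pt|].
    by rewrite /syllable_step; pt.
  by move=> a st; apply: dsize_syllable_step.
by rewrite /read_word; pt.
Qed.

(** * Universality of the simulation *)

Section Universal.
Variable M : TM.
Local Notation k := (tm_tapes M).
Local Notation rds := {ffun 'I_k.+1 -> symbol}.

Definition code_move (m : move) : option bool :=
  match m with MoveL => Some false | Stay => None | MoveR => Some true end.

Definition code_state (q : tm_state M) : nat := enum_rank q.

Definition code_fun (T : Type) (r : 'I_k.+1 -> T) : seq T := [seq r i | i <- enum 'I_k.+1].

Definition key_of (p : tm_state M * rds) : nat * seq (option bool) :=
  (code_state p.1, code_fun p.2).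

Definition action_of (p : tm_state M * rds) : option (nat * uact) :=
  if tm_delta p.1 p.2 is Some (q, a)
  then Some (code_state q, code_fun (fun i => ((a i).1, code_move (a i).2)))
  else None.

(** A pair on which the machine halts gets no entry, so that a failing [lookup] means halting. *)
Definition table_of : utable :=
  pmap (fun p => omap (pair (key_of p)) (action_of p)) (enum {: tm_state M * rds}).

Lemma code_fun_inj (T : Type) (r r' : 'I_k.+1 -> T) :
  code_fun r = code_fun r' -> r =1 r'.
Proof.
move=> E i; have : i \in enum 'I_k.+1 by rewrite mem_enum.
move: E; rewrite /code_fun; elim: (enum _) => //= j s IH [Ej /IH H].
by rewrite inE => /orP[/eqP->|].
Qed.

Lemma key_of_inj : injective key_of.
Proof.
move=> [q r] [q' r'] [/ord_inj/enum_rank_inj /= -> /code_fun_inj H].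
by congr (_, _); apply/ffunP.
Qed.

Lemma lookup_table p : lookup table_of (key_of p) = action_of p.
Proof.
rewrite /table_of; have : p \in enum {: tm_state M * rds} by rewrite mem_enum.
pose f o (e : uentry) := if e.1 == key_of p then Some e.2 else o.
rewrite /lookup -/f.
have H s o : foldl f o (pmap (fun p => omap (pair (key_of p)) (action_of p)) s) =
    if p \in s then (if action_of p is Some x then Some x else o) else o.
  elim: s o => //= p' s IH o; rewrite inE; have [Ep|ne] := eqVneq p p'.
    rewrite -Ep; case Ea: (action_of p) => [x|] /=; last by rewrite IH Ea; case: ifP.
    by rewrite IH Ea /f /= eqxx; case: ifP.
  case Ea: (action_of p') => [x|] //=; rewrite IH /f /=.
  by case: eqP => // /key_of_inj E; rewrite E eqxx in ne.
by move=> hp; rewrite H hp; case: action_of.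
Qed.

Definition code_config (c : config M) : uconf :=
  (code_state c.1, code_fun (fun i => (tleft (c.2 i), tright (c.2 i)))).

Definition tm_next (c : config M) : config M := odflt c (tm_step c).

Lemma ukey_config c : ukey (code_config c) = key_of (c.1, [ffun i => tape_read (c.2 i)]).
Proof.
rewrite /ukey /key_of /=; congr (_, _); rewrite /code_fun -map_comp.
by apply: eq_map => i; rewrite /= ffunE.
Qed.

Lemma lookup_config c :
  (lookup table_of (ukey (code_config c)) == None) = ~~ tm_step c.
Proof.
rewrite ukey_config lookup_table /action_of /tm_step /=.
by case: tm_delta => // -[q a].
Qed.

Lemma ustep_config c : ustep table_of (code_config c) = code_config (tm_next c).
Proof.
rewrite /ustep ukey_config lookup_table /action_of /tm_next /tm_step /=.
case: tm_delta => // -[q a] /=; rewrite /uapply /code_config /=; congr (_, _).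
rewrite /code_fun zip_map -map_comp; apply: eq_map => i /=; rewrite ffunE.
by case: (c.2 i) => l r; case: (a i) => s [].
Qed.

Lemma iter_ustep_config n c :
  iter n (ustep table_of) (code_config c) = code_config (iter n tm_next c).
Proof. by elim: n => //= n ->; apply: ustep_config. Qed.

Lemma tm_run_iter n c c' : tm_run n c = Some c' ->
  tm_step c' = None /\ forall m, n <= m -> iter m tm_next c = c'.
Proof.
elim: n c => [|n IH] c /=; case E: (tm_step c) => [c1|] //.
- by case=> <-; split=> // m _; elim: m => //= m ->; rewrite /tm_next E.
- move=> /IH[h H]; split=> // -[|m] //; rewrite ltnS => /H <-.
  by rewrite iterSr /tm_next E.
- by case=> <-; split=> // m _; elim: m => //= m ->; rewrite /tm_next E.
Qed.

Lemma tm_run_halt n c : tm_step (iter n tm_next c) = None ->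
  exists2 m, m <= n & tm_run m c = Some (iter n tm_next c).
Proof.
elim: n c => [|n IH] c; first by move=> E; exists 0; rewrite //= E.
case Ec: (tm_step c) => [c1|].
  have -> : iter n.+1 tm_next c = iter n tm_next c1 by rewrite iterSr {2}/tm_next Ec.
  by move=> /IH[m le E]; exists m.+1; rewrite //= Ec.
have -> : iter n.+1 tm_next c = c by elim: n.+1 => //= j ->; rewrite /tm_next Ec.
by move=> _; exists 0; rewrite //= Ec.
Qed.

Lemma tm_run_inj n m (c c' c'' : config M) :
  @tm_run M n c = Some c' -> @tm_run M m c = Some c'' -> c' = c''.
Proof.
move=> /tm_run_iter[_ H] /tm_run_iter[_ H'].
by rewrite -(H (maxn n m)) ?leq_maxl // (H' (maxn n m)) ?leq_maxr.
Qed.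

Definition inst_of (es : seq bool) (bound : nat) : inst :=
  (table_of, (code_state (tm_start M), (nseq k ([::], [::]), (es, bound)))).

Lemma uinit_config es bound z :
  uinit (inst_of es bound) z = code_config (tm_init M (es ++ after_true z)).
Proof.
rewrite /uinit /code_config /code_fun enum_ordSl /=; congr (_, _).
rewrite ffunE eqxx /=; congr cons; rewrite -map_comp.
have E (s : seq 'I_k) : [seq (tleft ((tm_init M (es ++ after_true z)).2 (lift ord0 i)),
    tright ((tm_init M (es ++ after_true z)).2 (lift ord0 i))) | i <- s] =
    nseq (size s) ([::], [::]).
  by elim: s => //= i s ->; rewrite ffunE.
by rewrite -[X in nseq X](size_enum_ord k) -E.
Qed.

Lemma after_true_pad n u : after_true (nseq n false ++ true :: u) = u.
Proof.
rewrite /after_true foldl_cat; set f := fun st b => _.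
have -> : foldl f (false, [::]) (nseq n false) = (false, [::]) by elim: n.
have H v acc : foldl f (true, acc) v = (true, catrev v acc).
  by elim: v acc => //= b v IH acc; rewrite IH.
by rewrite /= H /= -/(rev u) revK.
Qed.

Lemma acceptsE es bound z :
  accepts (inst_of es bound) z =
  let u := after_true z in
  let c := iter (size z) tm_next (tm_init M (es ++ u)) in
  [&& size u <= bound, ~~ tm_step c & head None (tright (c.2 ord0)) == Some true].
Proof.
rewrite /accepts /ufinal uinit_config iter_ustep_config lookup_config.
by rewrite /code_config /code_fun enum_ordSl.
Qed.

Variables (V : seq bool -> bool).
Hypothesis HV : forall s, exists t, computes_within M s t [:: V s].

(** Every run of the verifier halts and is deterministic, so a simulation that has halted shows its
    true output; padding makes the simulation long enough. *)
Lemma accepts_verifier es bound :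
  (exists z, accepts (inst_of es bound) z) <->
  (exists2 u, size u <= bound & V (es ++ u)).
Proof.
split=> [[z]|[u hu hV]].
  rewrite acceptsE => /and3P[hu hs ht]; exists (after_true z) => //.
  move: hs ht; set c := iter _ _ _ => hs ht.
  have [|m _ Em] := @tm_run_halt (size z) (tm_init M (es ++ after_true z)).
    by move: hs; rewrite -/c; case: tm_step.
  have [t [c' Et]] := HV (es ++ after_true z).
  rewrite (tm_run_inj Et Em) -/c /tm_output.
  by move/eqP: ht; case: (tright _) => //= x r -> [<-].
have [t [c' Et]] := HV (es ++ u); rewrite hV => Eo.
exists (nseq t false ++ true :: u); rewrite acceptsE; cbv zeta.
rewrite after_true_pad hu andTb.
have [hs ->] := tm_run_iter Et; last by rewrite size_cat size_nseq; lia.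
rewrite hs /=; move: Eo; rewrite /tm_output.
by case: (tright _) => //= -[b|] r //= [-> _].
Qed.
End Universal.

(** * Instances of the discrete logarithm problem *)

Definition string_of (i : inst) : seq bool := false :: ser (code i).

Lemma check_string_of i z : check (string_of i) z = accepts i z.
Proof. by rewrite /check /string_of orFb parse_ser decodeK. Qed.

Lemma string_of_accepted i : accepted (string_of i) <-> exists z, accepts i z.
Proof.
split=> [[n]|[z hz]]; first by rewrite check_string_of; exists (string_of_nat n).
by have [n En] := string_of_nat_surj z; exists n; rewrite check_string_of En.
Qed.

Lemma ser_last t : exists s, ser t = rcons s false.
Proof.
elim: t => [|l _ r [s E]]; first by exists [::].
by exists (true :: ser l ++ s); rewrite /= E rcons_cat.
Qed.

Lemma rev_string_of_accepted i : accepted (rev (map negb (string_of i))).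
Proof.
have [s E] := ser_last (code i); exists 0.
by rewrite /string_of E map_cons map_rcons rev_cons rev_rcons.
Qed.

(** [gy ^+ 4] is [tau] and [gy ^+ 2] is [tau] twice, so a syllable stands for one turn followed by
    [sigma]. All exponents are bounded: the hardness does not come from binary exponents. *)
Definition syllable (b : bool) : Z * Z := (Zpos (if b then 2 else 4)%positive, Zpos 1%positive).

Definition twist_syllables (q : seq bool) : seq (Z * Z) :=
  (Zpos 3%positive, Zpos 1%positive) :: [seq syllable b | b <- rev q] ++
  (Zpos 3%positive, Zpos 1%positive) :: [seq syllable (~~ b) | b <- q].

Lemma twist_syllablesP q n :
  all (fun p => ~~ Z.eqb p.1 Z0 && ~~ Z.eqb p.2 Z0)
      (flatten (nseq n (twist_syllables q))).
Proof.
elim: n => //= n IH; rewrite !all_cat /= IH andbT !all_map.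
by apply/andP; split; apply/allP => -[].
Qed.

Definition twist_word (n : nat) (q : seq bool) : word :=
  @Word Z0 _ Z0 (twist_syllablesP q n).

Lemma path_toE q :
  path_to q = sigma :: flatten [seq nseq (nat_of_bool b).+1 tau ++ [:: sigma] | b <- rev q].
Proof.
elim: q => //= b q ->; rewrite rev_cons map_rcons flatten_rcons.
by [].
Qed.

Lemma twist_lettersE q :
  flatten [seq yletters (zbits p.1) ++ xletters (zbits p.2) | p <- twist_syllables q] =
  twist q.
Proof.
set F := fun p : Z * Z => _; set c := (Zpos 3%positive, Zpos 1%positive).
have -> : flatten (map F (twist_syllables q)) =
    F c ++ flatten (map F [seq syllable b | b <- rev q]) ++
    F c ++ flatten (map F [seq syllable (~~ b) | b <- q]).
  by rewrite /twist_syllables map_cons map_cat -[flatten (_ :: _)]/(_ ++ flatten _)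
    flatten_cat.
rewrite /twist path_toE /back_to -!map_comp -[F c]/[:: lamp; sigma].
congr (_ :: _ :: _ ++ _); last congr (_ :: _ :: _).
  by congr flatten; apply: eq_map => -[].
by congr flatten; apply: eq_map => -[].
Qed.

Lemma twist_word_eval n q :
  word_eval (gx ord) (gy ord) (twist_word n q) = (wact ord (twist q) ^+ n)%g.
Proof.
rewrite word_evalE -wact_nseq; congr wact.
have -> : word_letters (twist_word n q) =
    flatten [seq yletters (zbits p.1) ++ xletters (zbits p.2)
            | p <- flatten (nseq n (twist_syllables q))] ++ [::] by [].
rewrite cats0; elim: n => // n IH.
rewrite -[flatten (nseq n.+1 _)]/(twist_syllables q ++ flatten (nseq n _)).
by rewrite map_cat flatten_cat IH twist_lettersE.
Qed.

Definition dlog_instance (i : inst) : word * word :=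
  (twist_word 4 (string_of i), twist_word 2 (string_of i)).

Lemma dlog_instanceP i :
  (exists k, discrete_log (gx ord) (gy ord) (dlog_instance i) k) <->
  exists z, accepts i z.
Proof.
rewrite -string_of_accepted /discrete_log /= !twist_word_eval.
split=> [[k E]|acc].
  apply: contrapT => /ord_not_accepted h; exact: dlog_unsolvable ord_gt2 _ _ h E.
apply: dlog_solvable; [exact: ord_gt2 | exact: odd_ord | ].
by apply: odd_ord; apply: rev_string_of_accepted.
Qed.

Lemma pt_encode_string (A : Type) {dA : data A} (s : A -> seq bool) :
  PT s -> PT (fun a => encode_string (s a)).
Proof.
move=> hs; apply: pt_cat; [|pt]; apply: pt_flatten.
by apply: (pt_map (f := fun _ b => [:: true; b])); pt.
Qed.

Definition item_bits (p : Z * Z) : seq bool := true :: encode_Z p.1 ++ encode_Z p.2.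

Definition twist_bits (q : seq bool) : seq bool := flatten (map item_bits (twist_syllables q)).

Lemma pt_twist_bits (A : Type) {dA : data A} (q : A -> seq bool) :
  PT q -> PT (fun a => twist_bits (q a)).
Proof.
move=> hq; set c := item_bits (Zpos 3%positive, Zpos 1%positive).
pose e b := item_bits (syllable b).
have he (l : A -> seq bool) (g : bool -> bool) : PT l -> PT (fun a => flatten (map (fun b => e (g b)) (l a))).
  move=> hl; apply: pt_flatten; apply: (pt_map (f := fun _ b => e (g b))); [|pt].
  apply: (@pt_eq _ _ _ _ (fun p : A * bool => if p.2 then e (g true) else e (g false))); last by pt.
  by case=> a [].
apply: (@pt_eq _ _ _ _ (fun a => c ++ flatten (map (fun b => e (id b)) (rev (q a))) ++
    c ++ flatten (map (fun b => e (~~ b)) (q a)))).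
  move=> a; rewrite /twist_bits /twist_syllables map_cons map_cat.
  by rewrite -[flatten (_ :: _)]/(_ ++ flatten _) flatten_cat map_cons -!map_comp.
by apply: pt_cat; [pt|]; apply: pt_cat; [apply: he; pt|]; apply: pt_cat; [pt|apply: he].
Qed.

Lemma encode_twist_word n q :
  encode_word (twist_word n q) =
  encode_Z Z0 ++ (flatten (nseq n (twist_bits q)) ++ [:: false]) ++ encode_Z Z0.
Proof.
rewrite /encode_word /encode_seq; congr (_ ++ (_ ++ _) ++ _).
rewrite -/item_bits; elim: n => // n IH.
rewrite -[w_mid _]/(twist_syllables q ++ w_mid (twist_word n q)) map_cat flatten_cat IH.
by [].
Qed.

Lemma pt_encode_twist_word (A : Type) {dA : data A} n (q : A -> seq bool) :
  PT q -> PT (fun a => encode_word (twist_word n (q a))).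
Proof.
move=> hq; apply: (@pt_eq _ _ _ _ (fun a => encode_Z Z0 ++
  (flatten (nseq n (twist_bits (q a))) ++ [:: false]) ++ encode_Z Z0)).
  by move=> a; rewrite encode_twist_word.
apply: pt_cat; [pt|]; apply: pt_cat; [|pt]; apply: pt_cat; [|pt].
elim: n => [|n IH]; first exact: (pt_const [::]).
by apply: pt_cat => //; apply: pt_twist_bits.
Qed.

Lemma polytime_string_PT (f : seq bool -> seq bool) : PT f -> polytime_string f.
Proof.
move=> /PT_computes[M [c [d H]]]; exists M, c, d => s.
have [t ht Ht] := H s; exists t => //.
rewrite -INR_expn -mult_INR -plus_INR; apply: le_INR; exact/ssrnat.leP.
Qed.

Lemma word_problem_elt : polytime_word_problem (gx ord) (gy ord).
Proof.
have h : PT (fun s => [:: decide ord (read_word s)]).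
  by apply: pt_cons; [apply: pt_decide; apply: pt_read_word; pt | pt].
have [M [c [d H]]] := PT_computes h.
exists M, (c * 62 ^ d + c), d => w; have [t ht Ht] := H (encode_word w).
exists t.
  apply: Rle_trans (poly_of_length c d (word_length_ge0 w) (size_encode_word w)).
  by apply: le_INR; apply/ssrnat.leP.
have -> : (word_eval (gx ord) (gy ord) w == 1%g) = decide ord (read_word (encode_word w)) => //.
rewrite read_word_encode word_evalE.
by apply/eqP/(decideP ord_gt2) => H1; apply/wact_is1.
Qed.

Lemma dlog_elt : NP_hard_discrete_log (gx ord) (gy ord).
Proof.
move=> L [V [c [d [[M [c' [d' HV]]] HL]]]].
have HV' s : exists t, computes_within M s t [:: V s].
  by have [t _ h] := HV s; exists t.
(* The certificate bound from the definition of NP is stored in the instance in unary, which is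
   polynomial because [c] and [d] are constants of the language. *)
pose i s := inst_of M (encode_string s) (c * size s ^ d + c).
exists (fun s => dlog_instance (i s)); split; last first.
  move=> s; rewrite HL; apply: iff_sym.
  exact: iff_trans (dlog_instanceP _) (accepts_verifier HV' _ _).
apply: polytime_string_PT.
have hi : PT (fun s => string_of (i s)).
  apply: pt_cons; [pt|]; apply: pt_ser.
  have h : PT i.
    apply: pt_pair; [pt|]; apply: pt_pair; [pt|]; apply: pt_pair; [pt|].
    apply: pt_pair; first by apply: pt_encode_string; pt.
    by apply: pt_addn; [apply: pt_muln; [pt | apply: pt_expn; apply: pt_size; pt] | pt].
  exact: (pt_recode h).
by apply: pt_cat; apply: pt_encode_twist_word.
Qed.

Theorem theorem1p2 :
  exists (G : groupType) (x y : G),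
    [/\ generated_by x y,
        polytime_word_problem x y
      & NP_hard_discrete_log x y].
Proof.
exists (elt ord : groupType), (gx ord), (gy ord); split.
- exact: generated_elt.
- exact: word_problem_elt.
- exact: dlog_elt.
Qed.
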